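(* For every positive integer $d$ there exist constants $C_{p,d}$ ($p>1$ real), depending only on $p$ and $d$, with the following property. Let $A$ be a finite abelian group whose elements have order at most $d$. Then there exists a generating set $S$ of $A$ of minimal size up to a factor of $d$, i.e. $|S|\le d\cdot s$ where $s$ is the minimal cardinality of a generating set of $A$, such that the spherical maximal operator $M$ on the Cayley graph $\Gamma(A,S)$ satisfies $$\|Mf\|_{L^p(A)}\le C_{p,d}\,\|f\|_{L^p(A)}\qquad\text{for all } p>1 \text{ and all } f:A\to\mathbb C.$$
   Context: The Cayley graph $\Gamma(A,S)$ has vertex set $A$ with $x$ and $x+s$ adjacent for $x\in A$, $s\in S$; let $\operatorname{dist}$ be its graph distance. The spherical maximal operator on $\Gamma(A,S)$ is $$Mf(x):=\sup_{r}\left|\frac{1}{|\{y\in A:\operatorname{dist}(x,y)=r\}|}\sum_{y:\operatorname{dist}(x,y)=r}f(y)\right|,$$ the supremum being over integers $r>0$ for which the sphere of radius $r$ is nonempty (a supremum over the empty set is $0$). $L^p$ norms are with respect to counting measure. *)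

(* Defs.v *)
From HB Require Import structures.
From mathcomp Require Import all_boot all_order all_algebra all_fingroup all_solvable.
From mathcomp Require Import complex.
From mathcomp Require Import boolp classical_sets reals exp.

Set Implicit Arguments.
Unset Strict Implicit.
Unset Printing Implicit Defensive.

Import ComplexField.Normc.
Import Order.TTheory GRing.Theory Num.Theory.

Local Open Scope ring_scope.
Local Open Scope complex_scope.

Section GraphDistance.
Variables (T : finType) (e : rel T).

Definition walk (x y : T) (n : nat) : bool :=
  [exists p : n.-tuple T, path e x p && (last x p == y)].

(* [None] stands for infinite distance. *)
Definition dist (x y : T) : option nat :=
  if pselect (exists n, walk x y n) is left h then Some (ex_minn h) else None.

Definition sphere (x : T) (r : nat) : {set T} := [set y | dist x y == Some r].

End GraphDistance.

(* Undirected graph: S is not required to be symmetric. *)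
Definition cayley (A : finZmodType) (S : {set A}) : rel A :=
  fun x y => [exists s in S, (y == x + s) || (x == y + s)].

Definition spherical_average (R : realType) (A : finZmodType) (S : {set A})
    (f : A -> R[i]) (x : A) (r : nat) : R[i] :=
  #|sphere (cayley S) x r|%:R^-1 * \sum_(y in sphere (cayley S) x r) f y.

(* [sup] is the true supremum here: only finitely many spheres are nonempty, so
   the set is bounded; if there is no admissible radius, [sup set0 = 0]. *)
Definition spherical_maximal (R : realType) (A : finZmodType) (S : {set A})
    (f : A -> R[i]) (x : A) : R :=
  sup [set normc (spherical_average S f x r) |
        r in [set r : nat | (0 < r)%N /\ sphere (cayley S) x r != finset.set0]]%classic.

Definition lpnorm (R : realType) (A : finType) (p : R) (f : A -> R[i]) : R :=
  powR (\sum_x powR (normc (f x)) p) p^-1.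

(* Main.v *)
(** Write [A] as a direct sum of cyclic groups (as few as possible), merge the
    summands of order 2 in pairs, and let [S] consist of the nonzero elements of
    the resulting summands.  The Cayley graph is then a Hamming graph, a product
    of complete graphs, with at most one two-element factor.  Collecting the
    factors of equal order [n], the maximal operator is pointwise at most a
    composition of boundedly many maximal operators of powers [K_n^N], so the
    case of [K_n^N] with [n > 2] is enough, with bounds uniform in [N].

    Let [sigma_r] be the mean over the sphere of radius [r] of [K_n^N].
    - Rerandomizing a random set of [r] coordinates is a mean, over orderings of
      the coordinates, of reversed martingales, so Doob's inequality bounds the
      corresponding maximal operator on [l^q], [q > 1].  These operators dominate
      the Cesaro means of [sigma_0, ..., sigma_r] pointwise.
    - On functions depending exactly on the coordinates in [X], [sigma_r] is a
      scalar, a normalized Krawtchouk number with parameter [-1/(n-1)].  It is at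
      most [exp (- c r |X| / N)] since [n > 2], and each differencing in [r]
      brings out a factor [|X| / N].
    - Remove from [sigma_r] its averages over windows of length about [2^-j r],
      [K] times.  The part removed is dominated by [C 2^j] times a Cesaro mean;
      the remainder has a maximal function of norm at most [C 2^(-j K)] on [l^2],
      by a discrete Sobolev inequality on each dyadic block of radii.
    - Choosing [j] in terms of the height of the maximal function gives a bound
      on [l^q] for indicator functions, [q = (1 + 1/K)^2], and interpolation with
      [l^oo] gives all [p > q]. *)

Require Import Defs.
From HB Require Import structures.
From mathcomp Require Import all_boot all_order all_algebra all_fingroup all_solvable.
From mathcomp Require Import complex.
From mathcomp Require Import boolp reals sequences exp.
From mathcomp Require Import ring lra zify.

Set Implicit Arguments.
Unset Strict Implicit.
Unset Printing Implicit Defensive.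

Import Order.TTheory GRing.Theory Num.Theory.

Local Open Scope ring_scope.
Local Open Scope complex_scope.

(** * Real powers *)

Section RealPowers.
Variable R : realType.
Implicit Types (a b q u : R).

Lemma powR_le2 q a b : 0 <= q -> 0 <= a -> a <= b -> a `^ q <= b `^ q.
Proof.
move=> q0 a0 ab; apply: ge0_ler_powR => //; rewrite nnegrE //.
exact: le_trans ab.
Qed.

Lemma powR_exprn (n : nat) a q : 0 <= a -> (a ^+ n) `^ q = (a `^ q) ^+ n.
Proof.
move=> a0; elim: n => [|n IH]; first by rewrite !expr0 powR1.
by rewrite !exprS powRM ?IH // exprn_ge0.
Qed.

(** Young's inequality for the product u * 1 with exponents q and q / (q - 1), multiplied by q. *)
Lemma powR_bernoulli q u : 1 < q -> 0 <= u -> 1 + q * (u - 1) <= u `^ q.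
Proof.
move=> q1 u0; have q0 : 0 < q by apply: lt_trans q1.
have q10 : 0 < q - 1 by rewrite subr_gt0.
have qn0 : q != 0 by rewrite gt_eqF.
have qn1 : q - 1 != 0 by rewrite gt_eqF.
have := @conjugate_powR R u 1 q (q / (q - 1)) u0 ler01 q0 (divr_gt0 q0 q10).
rewrite powR1 mulr1 => /(_ _)/wrap[].
  by field; rewrite qn0 qn1.
have -> : 1 / (q / (q - 1)) = (q - 1) / q by field; rewrite qn0 qn1.
rewrite -mulrDl ler_pdivlMr // => h; nra.
Qed.

(** Bernoulli's inequality for a / b, scaled by b ^ q. Jensen's inequality and the potential in
    Doob's inequality both rest on this tangent line. *)
Lemma powR_tangent q a b : 1 < q -> 0 <= a -> 0 <= b ->
  b `^ q + q * b `^ (q - 1) * (a - b) <= a `^ q.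
Proof.
move=> q1 a0; have q0 : 0 < q by apply: lt_trans q1.
rewrite le_eqVlt => /predU1P[<-|b0].
  by rewrite !powR0 ?subr_eq0 ?gt_eqF // mulr0 mul0r addr0 powR_ge0.
have bq : b `^ q = b * b `^ (q - 1) by rewrite mulr_powRB1 // ltW.
have -> : a = b * (a / b) by field; rewrite gt_eqF.
have h := @powR_bernoulli q (a / b) q1 (divr_ge0 a0 (ltW b0)).
rewrite powRM ?divr_ge0 // ?(ltW b0) //.
apply: le_trans (ler_wpM2l (powR_ge0 b q) h).
rewrite bq; set t := a / b; set s := b `^ (q - 1).
by rewrite le_eqVlt; apply/orP; left; apply/eqP; ring.
Qed.

(** Jensen: average the tangent inequality at the mean b; the linear terms cancel. *)
Lemma powR_mean (T : finType) (P : pred T) (w a : T -> R) q : 1 < q ->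
  (forall i, P i -> 0 <= w i) -> (forall i, P i -> 0 <= a i) ->
  \sum_(i | P i) w i = 1 ->
  (\sum_(i | P i) w i * a i) `^ q <= \sum_(i | P i) w i * a i `^ q.
Proof.
move=> q1 w0 a0 w1; set b := \sum_(i | P i) w i * a i.
have b0 : 0 <= b by apply: sumr_ge0 => i Pi; rewrite mulr_ge0 ?w0 ?a0.
have -> : b `^ q
    = \sum_(i | P i) w i * (b `^ q + q * b `^ (q - 1) * (a i - b)).
  under eq_bigr => i _ do rewrite mulrDr (mulrCA (w i)) mulrBr.
  rewrite big_split /= -mulr_suml w1 mul1r -mulr_sumr sumrB -mulr_suml w1 mul1r.
  by rewrite subrr mulr0 addr0.
by apply: ler_sum => i Pi; rewrite ler_wpM2l ?w0 // powR_tangent ?a0.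
Qed.

Lemma powRD_le q a b : 0 <= q -> 0 <= a -> 0 <= b ->
  (a + b) `^ q <= 2 `^ q * (a `^ q + b `^ q).
Proof.
move=> q0; wlog ab : a b / a <= b.
  move=> H a0 b0; case: (leP a b) => [ab|/ltW ab]; first exact: H.
  by rewrite addrC [X in _ * X]addrC H.
move=> a0 b0; apply: (@le_trans _ _ ((2 * b) `^ q)).
  by apply: powR_le2 => //; [rewrite addr_ge0 | lra].
by rewrite powRM // ler_wpM2l ?powR_ge0 // lerDr powR_ge0.
Qed.

(** This is (2 q') ^ q with q' = q / (q - 1): Doob's constant q' ^ q, up to the factor 2 ^ q lost in
    [young_absorb]. *)
Definition doob_const q : R := 2 * (q / (q - 1)) * (2 * (q / (q - 1))) `^ (q - 1).

(** Split at s = 2 q' a, q' = q / (q - 1). Above it the left side is at most half of s ^ q; below it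
    s ^ (q - 1) is at most (2 q' a) ^ (q - 1). *)
Lemma young_absorb q a s : 1 < q -> 0 <= a -> 0 <= s ->
  q / (q - 1) * a * s `^ (q - 1) <= 2^-1 * s `^ q + 2^-1 * doob_const q * a `^ q.
Proof.
move=> q1 a0 s0; rewrite /doob_const; set c := q / (q - 1).
have q0 : 0 < q by apply: lt_trans q1.
have q10 : 0 < q - 1 by rewrite subr_gt0.
have c0 : 0 < c by rewrite divr_gt0.
have sq : s `^ q = s * s `^ (q - 1) by rewrite mulr_powRB1.
have aq : a `^ q = a * a `^ (q - 1) by rewrite mulr_powRB1.
case: (leP (2 * c * a) s) => [h|/ltW h].
  apply: (@le_trans _ _ (2^-1 * s `^ q)).
    rewrite sq mulrA ler_wpM2r ?powR_ge0 //; lra.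
  by rewrite lerDl !mulr_ge0 ?invr_ge0 ?powR_ge0 // ltW.
apply: (@le_trans _ _ (2^-1 * (2 * c * (2 * c) `^ (q - 1)) * a `^ q)); last first.
  by rewrite lerDr mulr_ge0 ?invr_ge0 ?mulr_ge0 ?powR_ge0.
have -> : 2^-1 * (2 * c * (2 * c) `^ (q - 1)) * a `^ q =
          c * a * ((2 * c) `^ (q - 1) * a `^ (q - 1)).
  by rewrite aq; field.
have c2 : 0 <= 2 * c by rewrite mulr_ge0 // ltW.
have ca0 : 0 <= c * a by rewrite mulr_ge0 // ltW.
rewrite -powRM // ler_wpM2l //.
by apply: powR_le2 => //; rewrite ltW.
Qed.

(* [s ^ q - q' x s ^ (q - 1)] is nonincreasing in [s] on [0, x], q' = q / (q - 1). *)
Lemma doob_potential q s x : 1 < q -> 0 <= s -> s <= x ->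
  x `^ q - q / (q - 1) * x * x `^ (q - 1)
    <= s `^ q - q / (q - 1) * x * s `^ (q - 1).
Proof.
move=> q1 s0 sx; have x0 := le_trans s0 sx.
have q0 : 0 < q by apply: lt_trans q1.
have q10 : 0 < q - 1 by rewrite subr_gt0.
have := @powR_tangent q x s q1 x0 s0.
have sq : s `^ q = s * s `^ (q - 1) by rewrite mulr_powRB1.
have xq : x `^ q = x * x `^ (q - 1) by rewrite mulr_powRB1.
rewrite sq xq; set y := x `^ (q-1); set z := s `^ (q - 1) => h.
rewrite -subr_ge0.
have -> : s * z - q / (q - 1) * x * z - (x * y - q / (q - 1) * x * y) =
  (q - 1)^-1 * (x * y - (s * z + q * z * (x - s))).
  by field; rewrite gt_eqF.
by rewrite mulr_ge0 ?invr_ge0 ?(ltW q10) // subr_ge0.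
Qed.

End RealPowers.

(** * Averages over subgroups and Doob's inequality *)

Section Averages.
Variables (R : realType) (A : finZmodType).
Implicit Types (B : {set A}) (f g : A -> R).

(** For a subgroup this is the conditional expectation on its cosets; for a sphere it is the
    spherical mean. An empty [B] gives 0. *)
Definition avg B f (x : A) : R := #|B|%:R^-1 * \sum_(h in B) f (x + h).

Definition subgroup B := [/\ 0 \in B, (forall x y, x \in B -> y \in B -> x + y \in B)
  & (forall x, x \in B -> - x \in B)].

Definition invariant_under B g := forall x h, h \in B -> g (x + h) = g x.

Lemma avg_ge0 B f x : (forall y, 0 <= f y) -> 0 <= avg B f x.
Proof. by move=> f0; rewrite mulr_ge0 ?invr_ge0 ?ler0n ?sumr_ge0. Qed.

Lemma ler_avg B f g x : (forall y, f y <= g y) -> avg B f x <= avg B g x.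
Proof. by move=> fg; rewrite ler_wpM2l ?invr_ge0 ?ler0n ?ler_sum. Qed.

Lemma avg_sum (T : Type) (r : seq T) (P : pred T) (F : T -> A -> R) B x :
  avg B (fun y => \sum_(i <- r | P i) F i y) x = \sum_(i <- r | P i) avg B (F i) x.
Proof. by rewrite /avg exchange_big mulr_sumr. Qed.

Lemma sum_shift f h : \sum_x f (x + h) = \sum_x f x.
Proof. by rewrite [RHS](reindex_inj (addIr h)). Qed.

Lemma sumr_constM (T : finType) (B : {pred T}) (c : R) :
  \sum_(h in B) c = #|B|%:R * c.
Proof. by rewrite sumr_const mulr_natl. Qed.

Lemma card_subgroup_neq0 B : 0 \in B -> #|B|%:R != 0 :> R.
Proof. by move=> B0; rewrite pnatr_eq0 -lt0n; apply/card_gt0P; exists 0. Qed.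

(** Translation by an element of [B] preserves both counting measure and [g], so each translate of
    [f] pairs with [g] as [f] does. *)
Lemma sum_avg_invariant B f g : subgroup B -> invariant_under B g ->
  \sum_x avg B f x * g x = \sum_x f x * g x.
Proof.
move=> [B0 _ _] Bg; rewrite /avg.
under eq_bigr => x _ do rewrite -mulrA mulr_suml.
rewrite -mulr_sumr exchange_big /=.
under eq_bigr => h hB.
  under eq_bigr => x _ do rewrite -(Bg x h hB).
  rewrite (sum_shift (fun x => f x * g x)).
  over.
by rewrite sumr_constM mulrA mulVf ?mul1r ?card_subgroup_neq0.
Qed.

Lemma avg_invariant B f : subgroup B -> invariant_under B (avg B f).
Proof.
move=> [B0 BD BN] x h hB; congr (_ * _).
rewrite [RHS](reindex_inj (addrI h)) /=; apply: eq_big => [k|k _].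
  apply/idP/idP => kB; first exact: BD.
  by rewrite -(addKr h k) BD // BN.
by rewrite addrA.
Qed.

(** Jensen, then translation invariance. As [B] is arbitrary, this also applies to spheres. *)
Lemma sum_avg_powR B f q : 1 < q -> (forall y, 0 <= f y) ->
  \sum_x avg B f x `^ q <= \sum_x f x `^ q.
Proof.
move=> q1 f0; have q0 : q != 0 by rewrite gt_eqF // (lt_trans _ q1).
have fq0 : 0 <= \sum_x f x `^ q by apply: sumr_ge0 => x _; rewrite powR_ge0.
have [/eqP B0|BN0] := boolP (#|B| == 0)%N.
  rewrite big1 // => x _.
  by rewrite /avg B0 invr0 mul0r powR0.
have Bn : #|B|%:R != 0 :> R by rewrite pnatr_eq0.
apply: (@le_trans _ _ (\sum_x \sum_(h in B) #|B|%:R^-1 * f (x + h) `^ q)).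
  apply: ler_sum => x _; rewrite /avg mulr_sumr.
  have w1 : \sum_(h in B) #|B|%:R^-1 = 1 :> R by rewrite sumr_constM mulfV.
  by apply: powR_mean => // h _; rewrite ?invr_ge0 ?ler0n.
rewrite exchange_big /=.
under eq_bigr => h _ do
  rewrite -mulr_sumr (sum_shift (fun x => f x `^ q)).
by rewrite sumr_constM mulrA mulfV // mul1r.
Qed.

(** Averages over growing subgroups form a reversed martingale. The running maximum [S] is built
    from the coarsest level down, and the invariant is that the sum of S ^ q - q' * avg f * S ^ (q -
    1), q' = q / (q - 1), stays nonpositive. *)
Lemma doob_chain (B : nat -> {set A}) f q (M : nat) : 1 < q ->
  (forall r, subgroup (B r)) -> (forall r, B r \subset B r.+1) ->
  (forall y, 0 <= f y) ->
  exists S : A -> R, (forall r x, (r <= M)%N -> avg (B r) f x <= S x) /\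
    \sum_x S x `^ q <= doob_const q * \sum_x f x `^ q.
Proof.
move=> q1 sB mB f0.
have q0 : 0 < q by apply: lt_trans q1.
have q10 : 0 < q - 1 by rewrite subr_gt0.
have c1 : 1 <= q / (q - 1) by rewrite ler_pdivlMr //; lra.
have H k : (k <= M)%N -> exists S : A -> R, [/\ invariant_under (B (M - k)%N) S,
   (forall x, 0 <= S x),
   (forall r x, (M - k <= r <= M)%N -> avg (B r) f x <= S x) &
   \sum_x (S x `^ q - q / (q - 1) * avg (B (M - k)%N) f x * S x `^ (q - 1)) <= 0].
  elim: k => [_|k IH kM].
    exists (avg (B M) f); rewrite subn0; split.
    - exact: avg_invariant.
    - by move=> x; apply: avg_ge0.
    - by move=> r x; rewrite -eqn_leq => /eqP ->.
    apply: sumr_le0 => x _; have a0 := avg_ge0 (B M) x f0.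
    rewrite -mulrA mulr_powRB1 // -{1}(mul1r (_ `^ q)) -mulrBl.
    by rewrite mulr_le0_ge0 ?powR_ge0 // subr_le0.
  have [S [Sinv S0 Sub Ssum]] := IH (ltnW kM).
  have eM : (M - k = (M - k.+1).+1)%N by lia.
  set n := (M - k.+1)%N in eM *.
  have invS : invariant_under (B n) S.
    by move=> x h hB; apply: Sinv; rewrite eM; apply: (subsetP (mB n)).
  exists (fun x => Num.max (S x) (avg (B n) f x)); split.
  - by move=> x h hB; rewrite invS // avg_invariant.
  - by move=> x; rewrite le_max S0.
  - move=> r x /andP[nr rM]; rewrite le_max.
    have [->|rn] := eqVneq r n; first by rewrite lexx orbT.
    by rewrite Sub // rM eM ltn_neqAle eq_sym rn nr.
  apply: le_trans Ssum.
  (* Where the new average exceeds [S], [doob_potential] says that updating [S] does not raise the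
     potential. The new average is then traded for the coarser one, since [S] is invariant under
     both subgroups. *)
  apply: (@le_trans _ _ (\sum_x (S x `^ q - q / (q - 1) * avg (B n) f x * S x `^ (q - 1)))).
    apply: ler_sum => x _.
    case: (leP (S x) (avg (B n) f x)) => // h.
    exact: doob_potential.
  rewrite !sumrB lerD2l lerN2.
  under eq_bigr => x _ do rewrite -mulrA.
  under [X in _ <= X]eq_bigr => x _ do rewrite -mulrA.
  rewrite -!mulr_sumr sum_avg_invariant // ?sum_avg_invariant //.
    by move=> x h hB; rewrite invS.
  by move=> x h hB; rewrite Sinv.
have [S [Sinv S0 Sub]] := H M (leqnn M).
rewrite subnn in Sinv Sub * => Ssum.
exists S; split; first by move=> r x rM; apply: Sub.
rewrite sumrB subr_le0 in Ssum.
have E : \sum_x q / (q - 1) * avg (B 0) f x * S x `^ (q - 1) =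
         \sum_x q / (q - 1) * f x * S x `^ (q - 1).
  under eq_bigr => x _ do rewrite -mulrA.
  under [RHS]eq_bigr => x _ do rewrite -mulrA.
  rewrite -!mulr_sumr sum_avg_invariant //.
  by move=> x h hB; rewrite Sinv.
rewrite E in Ssum.
have : \sum_x q / (q - 1) * f x * S x `^ (q - 1) <=
   2^-1 * \sum_x S x `^ q + 2^-1 * doob_const q * \sum_x f x `^ q.
  rewrite !mulr_sumr -big_split /=; apply: ler_sum => x _.
  exact: young_absorb.
move=> /(le_trans Ssum) h.
by rewrite -(ler_pM2l (_ : 0 < 2^-1 :> R)) ?invr_gt0 //; lra.
Qed.

End Averages.

(** * Direct sum decompositions *)

Lemma finset_ind (T : finType) (P : {set T} -> Prop) : P set0 ->
  (forall (J : {set T}) i, i \notin J -> P J -> P (i |: J)) -> forall J, P J.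
Proof.
move=> P0 PS J; have [k] := ubnP #|J|; elim: k J => // k IH J.
have [->//|[i iJ]] := set_0Vmem J.
rewrite (cardsD1 i) iJ add1n ltnS => Jk.
by rewrite -(setD1K iJ); apply: PS (IH _ Jk); rewrite !inE eqxx.
Qed.

(* A decomposition of [A] as a direct sum, given by its coordinate projections. *)
Definition projections (A : finZmodType) (I : finType) (pi : I -> A -> A) :=
  [/\ forall i, {morph pi i : x y / x + y},
      forall i j x, pi i (pi j x) = if i == j then pi j x else 0 &
      forall x, \sum_i pi i x = x].

Section Projections.
Variables (A : finZmodType) (I : finType) (pi : I -> A -> A).
Hypothesis pi_proj : projections pi.
Implicit Types (J K : {set I}) (x y a b h : A).

Definition supp (x : A) : {set I} := [set i | pi i x != 0].
Definition summand (J : {set I}) : {set A} := [set h | supp h \subset J].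
Definition level (J : {set I}) : {set A} := [set h | supp h == J].
Definition proj (J : {set I}) (x : A) := \sum_(i in J) pi i x.

Lemma piD i : {morph pi i : x y / x + y}. Proof. by case: pi_proj. Qed.

Lemma pi0 i : pi i 0 = 0.
Proof. by apply: (addrI (pi i 0)); rewrite -piD !addr0. Qed.

Lemma piN i x : pi i (- x) = - pi i x.
Proof. by apply: (addrI (pi i x)); rewrite -piD !subrr pi0. Qed.

Lemma supp0 : supp 0 = set0.
Proof. by apply/setP => i; rewrite !inE pi0 eqxx. Qed.

Lemma suppN x : supp (- x) = supp x.
Proof. by apply/setP => i; rewrite !inE piN oppr_eq0. Qed.

Lemma suppD x y : supp (x + y) \subset supp x :|: supp y.
Proof.
apply/subsetP => i; rewrite !inE piD; apply: contraR.
by rewrite negb_or !negbK => /andP[/eqP -> /eqP ->]; rewrite addr0.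
Qed.

Lemma pi_projE J i x : pi i (proj J x) = if i \in J then pi i x else 0.
Proof.
case: pi_proj => _ pij _.
have -> : pi i (proj J x) = \sum_(j in J) pi i (pi j x).
  by rewrite /proj (big_morph (pi i) (@piD i) (pi0 i)).
under eq_bigr => j _ do rewrite pij.
by rewrite -big_mkcondr /= big_mkcond /= (bigD1 i) //= eqxx andbT big1 ?addr0 // => j
  /negPf ji; rewrite eq_sym ji andbF.
Qed.

Lemma supp_proj J x : supp (proj J x) = J :&: supp x.
Proof.
by apply/setP => i; rewrite !inE pi_projE; case: (i \in J) => //=; rewrite eqxx.
Qed.

Lemma proj_id J x : supp x \subset J -> proj J x = x.
Proof.
case: (pi_proj) => _ _ pisum sJ; rewrite -[RHS]pisum /proj big_mkcond /=.
apply: eq_bigr => i _; case: ifPn => // iJ; apply/esym/eqP.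
by apply: contraNT iJ => h; apply: (subsetP sJ); rewrite inE.
Qed.

Lemma supp_eq0 x : (supp x == set0) = (x == 0).
Proof.
apply/eqP/eqP => [h|->]; last exact: supp0.
by rewrite -(@proj_id set0 x) ?h // /proj big_set0.
Qed.

Lemma projD J x y : proj J (x + y) = proj J x + proj J y.
Proof. by rewrite /proj -big_split; apply: eq_bigr => i _; exact: piD. Qed.

Lemma proj_eq0 J K x : [disjoint J & K] -> supp x \subset K -> proj J x = 0.
Proof.
move=> dJK sK; apply/eqP; rewrite -supp_eq0 supp_proj -subset0.
by rewrite -(disjoint_setI0 dJK) setIS.
Qed.

Lemma subgroup_summand J : subgroup (summand J).
Proof.
split; rewrite ?inE ?supp0 ?sub0set //.
  move=> x y; rewrite !inE => xJ yJ; apply: subset_trans (suppD x y) _.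
  by rewrite subUset xJ.
by move=> x; rewrite !inE suppN.
Qed.

Lemma supp_direct J K a b : [disjoint J & K] -> supp a \subset J -> supp b \subset K ->
  supp (a + b) = supp a :|: supp b.
Proof.
move=> dJK aJ bK; apply/eqP; rewrite eqEsubset suppD subUset /=.
have dKJ : [disjoint K & J] by rewrite disjoint_sym.
have ea : proj J (a + b) = a.
  by rewrite projD (proj_id aJ) (proj_eq0 dJK bK) addr0.
have eb : proj K (a + b) = b.
  by rewrite projD (proj_id bK) (proj_eq0 dKJ aJ) add0r.
by apply/andP; split; [rewrite -{1}ea|rewrite -{1}eb]; rewrite supp_proj subsetIr.
Qed.

Lemma sum_summand (V : nmodType) (J K : {set I}) (G : A -> V) : [disjoint J & K] ->
  \sum_(h in summand (J :|: K)) G h =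
  \sum_(a in summand J) \sum_(b in summand K) G (a + b).
Proof.
move=> dJK; have dKJ : [disjoint K & J] by rewrite disjoint_sym.
rewrite pair_big /=.
rewrite (reindex_onto (fun p : A * A => p.1 + p.2) (fun h => (proj J h, proj K h))).
  apply: eq_bigl => -[a b] /=; rewrite !inE.
  apply/andP/andP => [[sab /eqP[<- <-]]|[aJ bK]].
    by rewrite !supp_proj !subsetIl.
  rewrite !projD (proj_id aJ) (proj_id bK) (proj_eq0 dJK bK) (proj_eq0 dKJ aJ).
  by rewrite addr0 add0r eqxx (supp_direct dJK) // setUSS.
move=> h; rewrite inE => /proj_id /= h'; rewrite -[RHS]h'.
by rewrite [RHS]/proj (eq_bigl [predU J & K]) ?bigU // => i; rewrite !inE.
Qed.

Lemma sum_level1 (V : nmodType) J i (G : A -> V) : i \notin J ->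
  \sum_(h in level (i |: J)) G h =
  \sum_(b in level J) \sum_(a in summand [set i] | a != 0) G (b + a).
Proof.
move=> iJ; have dJi : [disjoint J & [set i]] by rewrite disjoint_sym disjoints1.
(* Extending by 0 to all elements supported in i |: J makes [sum_summand] applicable. *)
pose G' h := if h \in level (i |: J) then G h else 0.
have -> : \sum_(h in level (i |: J)) G h = \sum_(h in summand (J :|: [set i])) G' h.
  rewrite -big_mkcondr /=; apply: eq_bigl => h; rewrite !inE.
  by case: eqP => [->|]; rewrite ?andbF // setUC subxx.
rewrite (sum_summand _ dJi) [RHS]big_mkcond [LHS]big_mkcond /=.
apply: eq_bigr => b _; rewrite !inE.
have [bJ|bJ] := boolP (supp b \subset J); last first.
  by case: eqP => // e; rewrite e subxx in bJ.
have key a : a \in summand [set i] ->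
    (b + a \in level (i |: J)) = (a != 0) && (supp b == J).
  rewrite !inE => ai; rewrite (supp_direct dJi) // -supp_eq0.
  have [sa|sa] := eqVneq (supp a) set0.
    rewrite sa setU0; apply/negbTE; apply: contra iJ => /eqP e.
    by rewrite (subsetP bJ) // e setU11.
  have -> : supp a = [set i] by apply/eqP; move: ai; rewrite subset1 (negPf sa) orbF.
  apply/eqP/eqP => [e|->]; last by rewrite setUC.
  have /(congr1 (fun X => J :&: X)) := e.
  rewrite !setIUr (disjoint_setI0 dJi) setU0 set0U setIid => <-.
  by apply/esym/setIidPr.
rewrite [in RHS]big_mkcondr /=.
case: ifPn => sb.
  by apply: eq_bigr => a ai; rewrite /G' key // sb andbT.
by rewrite big1 // => a ai; rewrite /G' key // (negPf sb) andbF.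
Qed.

Lemma sum_summand_level (V : nmodType) J (G : A -> V) :
  \sum_(h in summand J) G h = \sum_(L in powerset J) \sum_(h in level L) G h.
Proof.
rewrite (partition_big supp (mem (powerset J))) /=; last first.
  by move=> h; rewrite !inE.
apply: eq_bigr => L; rewrite inE => LJ; apply: eq_bigl => h; rewrite !inE.
by case: eqP => [->|]; rewrite ?LJ ?andbF.
Qed.

Section Homogeneous.
Variables (D : {set I}) (n : nat).
Hypothesis card_summand1 : forall i, i \in D -> #|summand [set i]| = n.

Lemma card_nonzero i : i \in D -> #|[set a in summand [set i] | a != 0]| = n.-1.
Proof.
move=> iD; have /= <- := card_summand1 iD.
rewrite (cardsD1 0 (summand [set i])) (_ : 0 \in _) ?inE ?supp0 ?sub0set //=.
by apply: eq_card => a; rewrite !inE andbC.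
Qed.

Lemma card_level J : J \subset D -> #|level J| = (n.-1 ^ #|J|)%N.
Proof.
elim/(@finset_ind I): J => [_|J i iJ IH].
  rewrite cards0 (_ : level set0 = [set 0]) ?cards1 //.
  by apply/setP => h; rewrite !inE supp_eq0.
rewrite subUset sub1set => /andP[iD JD].
rewrite -sum1_card sum_level1 // cardsU1 iJ expnD expn1 mulnC -IH //.
rewrite -sum_nat_const; apply: eq_bigr => b _; rewrite -(card_nonzero iD) -sum1_card.
by apply: eq_bigl => a; rewrite inE.
Qed.

End Homogeneous.

End Projections.

(** * Rerandomizing random sets of coordinates *)

Section UniformSubsets.
Variable T : finType.
Implicit Types (D J K : {set T}).

(** Induction on the size of J minus K: a transposition exchanging a point of J outside K with a
    point of K outside J lowers it. *)
Lemma perm_subset D J K : J \subset D -> K \subset D -> #|J| = #|K| ->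
  exists2 h : {perm T}, perm_on D h & h @: J = K.
Proof.
move=> + KD; have [k] := ubnP #|J :\: K|; elim: k J => // k IH J Jk JD eJK.
have [JK|] := boolP (J \subset K).
  have -> : J = K by apply/eqP; rewrite eqEcard JK eJK /=.
  by exists 1%g; [exact: perm_on1|rewrite (eq_imset (g := id)) ?imset_id // => z; rewrite perm1].
case/subsetPn => a aJ aK.
have [b bK bJ] : exists2 b, b \in K & b \notin J.
  apply/subsetPn; apply: contra aK => KJ.
  by have -> : K = J by apply/eqP; rewrite eqEcard KJ eJK /=.
have ab : a != b by apply: contraNneq bJ => <-.
set J' := tperm a b @: J.
have J'E : J' = b |: (J :\ a).
  apply/setP => z; rewrite !inE; apply/imsetP/idP => [[y yJ ->]|].
    case: tpermP => [_|yb|/eqP ya /eqP yb]; rewrite ?eqxx //.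
      by rewrite yb (negPf bJ) in yJ.
    by rewrite ya yJ orbT.
  case/predU1P => [->|/andP[za zJ]]; first by exists a; rewrite ?tpermL.
  exists z => //; rewrite tpermD // eq_sym //.
  by apply: contraNneq bJ => <-.
have cJ' : #|J'| = #|J| by rewrite card_imset //; exact: perm_inj.
have J'D : J' \subset D.
  rewrite J'E subUset sub1set (subsetP KD) //=.
  by apply: subset_trans JD; rewrite subD1set.
have [||h hD hJ] := IH J' _ J'D; rewrite ?cJ' //.
  rewrite ltnS in Jk; apply: leq_trans Jk; rewrite J'E.
  rewrite [X in (_ < X)%N](cardsD1 a) !inE aJ aK /= add1n ltnS.
  apply: subset_leq_card; apply/subsetP => z; rewrite !inE.
  case/andP => zK /predU1P[zb|/andP[-> ->]]; last by rewrite zK.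
  by rewrite zb bK in zK.
exists (tperm a b * h)%g.
  apply: perm_onM => //; apply: (subset_trans (tperm_on a b)).
  by apply/subsetP => z; rewrite !inE => /orP[]/eqP ->; [apply: (subsetP JD)|apply: (subsetP KD)].
by rewrite -hJ /J' -imset_comp; apply: eq_imset => z; rewrite permM.
Qed.

(** The image of J under a uniformly random permutation of D is a uniformly random subset of its
    size, because the permutations act transitively on such subsets. *)
Lemma mean_perm_imset (R : realType) D J (Phi : {set T} -> R) : J \subset D ->
  #|[set h : {perm T} | perm_on D h]|%:R^-1 *
     \sum_(h in [set h : {perm T} | perm_on D h]) Phi (h @: J) =
  'C(#|D|, #|J|)%:R^-1 * \sum_(K : {set T} | (K \subset D) && (#|K| == #|J|)) Phi K.
Proof.
move=> JD; set G := [set h : {perm T} | perm_on D h].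
have imD (h : {perm T}) K : h \in G -> K \subset D -> h @: K \subset D.
  rewrite inE => hD KD; apply/subsetP => z /imsetP[y yK ->].
  by rewrite (perm_closed _ hD) (subsetP KD).
pose c K := #|[set h in G | h @: J == K]|.
(* Right multiplication by a permutation taking J to K is a bijection between the fibres over J and
   over K. *)
have cE K : K \subset D -> #|K| = #|J| -> c K = c J.
  move=> KD eK; have [g gD gJ] := perm_subset JD KD (esym eK).
  rewrite /c -[RHS](card_imset _ (mulIg g)); apply: eq_card => h; rewrite !inE.
  apply/andP/imsetP => [[hD /eqP hJ]|[k]].
    exists (h * g^-1)%g; rewrite ?mulgKV // !inE perm_onM ?perm_onV //=.
    apply/eqP; rewrite -[RHS](imset_id J).
    have -> : (h * g^-1)%g @: J = g^-1%g @: (h @: J).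
      by rewrite -imset_comp; apply: eq_imset => z; rewrite permM.
    rewrite hJ -gJ -imset_comp; apply: eq_imset => z /=.
    by rewrite permK.
  rewrite !inE => /andP[kD /eqP kJ] ->; split; first exact: perm_onM.
  apply/eqP; rewrite -gJ -[in RHS]kJ -imset_comp.
  by apply: eq_imset => z; rewrite permM.
have sumE (F : {set T} -> R) : \sum_(h in G) F (h @: J) =
    (c J)%:R * \sum_(K : {set T} | (K \subset D) && (#|K| == #|J|)) F K.
  rewrite (partition_big (fun h : {perm T} => h @: J)
    (fun K : {set T} => (K \subset D) && (#|K| == #|J|))) /=; last first.
    by move=> h hG; rewrite imD //= card_imset //; exact: perm_inj.
  rewrite mulr_sumr; apply: eq_bigr => K /andP[KD /eqP eK].
  rewrite -(cE K KD eK) /c.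
  under eq_bigr => h /andP[_ /eqP ->] do over.
  rewrite -sum1_card natr_sum mulr_suml; apply: eq_big => h; first by rewrite !inE.
  by rewrite mul1r.
(* The constant function 1 yields the common fibre size. *)
have := sumE (fun=> 1); rewrite sumr_const => cG.
have cards : \sum_(K : {set T} | (K \subset D) && (#|K| == #|J|)) 1 = 'C(#|D|, #|J|)%:R :> R.
  rewrite -cards_draws -sumr_const; apply: eq_bigl => K; by rewrite inE.
rewrite cards in cG.
have C0 : 'C(#|D|, #|J|)%:R != 0 :> R by rewrite pnatr_eq0 -lt0n bin_gt0 subset_leq_card.
have G0 : #|G|%:R != 0 :> R.
  by rewrite pnatr_eq0 -lt0n; apply/card_gt0P; exists 1%g; rewrite inE perm_on1.
rewrite sumE mulrA; congr (_ * _); apply: (mulfI G0).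
by rewrite mulrA mulfV // mul1r cG mulfK.
Qed.

End UniformSubsets.

(** * Binomial weights of rerandomization *)

Section NegativeBinomial.
Variable R : realType.
Implicit Types p : R.

(** The probability that exactly s of r rerandomized coordinates change, p = 1 / n being the chance
    that a coordinate keeps its value. *)
Definition binom_weight p (r s : nat) : R :=
  'C(r, s)%:R * (1 - p) ^+ s * p ^+ (r - s).

Lemma binom_weightS p r s : binom_weight p r.+1 s.+1 =
  p * binom_weight p r s.+1 + (1 - p) * binom_weight p r s.
Proof.
set q := 1 - p; have qE : 1 - p = q by [].
move: q qE => q qE; rewrite /binom_weight qE; clear qE.
rewrite binS natrD !mulrDl subSS; congr (_ + _).
  have [rs|sr] := leqP r s; first by rewrite bin_small ?mul0r ?mulr0.
  by rewrite -(subnSK sr) [p ^+ _]exprS mulrCA.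
by rewrite exprS !mulrA [_ * q]mulrC.
Qed.

(* The generating-function (Chernoff) bound for a negative binomial tail. *)
Lemma sum_binom_weight p s M : 0 <= p -> 3 * p <= 1 ->
  1 - 3 ^+ s * (2 / 3) ^+ M <= (1 - p) * \sum_(r < M.+1) binom_weight p r s.
Proof.
move=> p_ge0 p_le.
elim: M s => [|M IH] [|s].
- by rewrite big_ord1 /binom_weight bin0 /= !expr0 !mulr1; lra.
- rewrite big_ord1 /binom_weight bin0n /= !mul0r mulr0 expr0 mulr1 subr_le0.
  by rewrite exprn_ege1 // ler1n.
- have -> : (1 - p) * \sum_(r < M.+2) binom_weight p r 0 = 1 - p ^+ M.+2.
    rewrite -[RHS]opprB subrX1 -mulNr opprB; congr (_ * _).
    by apply: eq_bigr => r _; rewrite /binom_weight bin0 subn0 expr0 !mul1r.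
  rewrite expr0 mul1r lerD2l lerN2.
  apply: (@le_trans _ _ (p ^+ M.+1)).
    rewrite exprS ler_piMl ?exprn_ge0 //; lra.
  by rewrite lerXn2r ?nnegrE //; lra.
rewrite big_ord_recl {1}/binom_weight bin0n /= !mul0r add0r.
under eq_bigr => r _ do rewrite /bump /= add1n binom_weightS.
rewrite big_split /= -!mulr_sumr mulrDr !(mulrCA (1 - p)).
have h1 := ler_wpM2l p_ge0 (IH s.+1).
have q0 : 0 <= 1 - p by lra.
have h2 := ler_wpM2l q0 (IH s).
apply: le_trans (lerD h1 h2).
rewrite !exprS; set x := 3 ^+ s; set y := _ ^+ M.
have xy : 0 <= x * y by rewrite mulr_ge0 ?exprn_ge0 // divr_ge0.
nra.
Qed.

(** With M = 4 r and s <= r the tail is at most (3 * (2 / 3) ^ 4) ^ r = (16 / 27) ^ r <= 16 / 27,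
    which leaves 11 / 27. *)
Lemma sum_binom_weight_ge p (s r : nat) : 0 <= p -> 3 * p <= 1 ->
  (0 < r)%N -> (s <= r)%N ->
  11 / 27 <= \sum_(j < (4 * r).+1) binom_weight p j s.
Proof.
move=> p_ge0 p_le r0 sr; have := sum_binom_weight s (4 * r) p_ge0 p_le.
have h : 3 ^+ s * (2 / 3) ^+ (4 * r) <= 16 / 27 :> R.
  apply: (@le_trans _ _ (3 ^+ r * (2 / 3) ^+ (4 * r))).
    rewrite ler_wpM2r ?exprn_ge0 ?divr_ge0 // ler_weXn2l //.
    by rewrite ler1n.
  rewrite exprM -exprMn -(prednK r0) exprS.
  have -> : 3 * (2 / 3) ^+ 4 = 16 / 27 :> R by field.
  rewrite ler_piMr ?exprn_ile1 ?divr_ge0 // ler_pdivrMr // mul1r ler_nat //.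
have S0 : 0 <= \sum_(j < (4 * r).+1) binom_weight p j s.
  have q0 : 0 <= 1 - p by lra.
  by apply: sumr_ge0 => j _; rewrite !mulr_ge0 ?exprn_ge0.
nra.
Qed.

End NegativeBinomial.

(** * Maximal bounds for rerandomization and Cesaro means *)

Section Resampling.
Variables (R : realType) (A : finZmodType) (I : finType) (pi : I -> A -> A).
Hypothesis pi_proj : projections pi.
Implicit Types (J K L : {set I}) (f : A -> R).

Variables (D : {set I}) (n : nat).
Hypothesis card_summand1 : forall i, i \in D -> #|summand pi [set i]| = n.

(* The sphere of radius [s] of the subgraph on the coordinates in [D]. *)
Definition hsphere s : {set A} := [set h in summand pi D | #|supp pi h| == s].
Definition sph s f := avg (hsphere s) f.
Definition resample r f x :=
  'C(#|D|, r)%:R^-1 * \sum_(J : {set I} | (J \subset D) && (#|J| == r))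
    avg (summand pi J) f x.

Lemma sum_hsphere (V : nmodType) s (G : A -> V) :
  \sum_(h in hsphere s) G h =
  \sum_(L : {set I} | (L \subset D) && (#|L| == s)) \sum_(h in level pi L) G h.
Proof.
transitivity (\sum_(h in summand pi D) if #|supp pi h| == s then G h else 0).
  by rewrite -big_mkcondr /=; apply: eq_bigl => h; rewrite !inE.
rewrite sum_summand_level [RHS]big_mkcondr /=.
apply: eq_big => [L|L _]; first by rewrite !inE.
case: ifPn => Ls.
  by apply: eq_bigr => h; rewrite inE => /eqP ->; rewrite Ls.
by rewrite big1 // => h; rewrite inE => /eqP ->; rewrite (negPf Ls).
Qed.

Lemma card_summand J : (0 < n)%N -> J \subset D -> #|summand pi J| = (n ^ #|J|)%N.
Proof.
move=> n0; elim/(@finset_ind I): J => [_|J i iJ IH].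
  rewrite cards0 (_ : summand pi set0 = [set 0]) ?cards1 //.
  by apply/setP => h; rewrite !inE subset0 supp_eq0.
rewrite subUset sub1set => /andP[iD JD].
have dij : [disjoint [set i] & J] by rewrite disjoints1.
rewrite -sum1_card sum_summand // cardsU1 iJ expnD expn1 -IH // -(card_summand1 iD).
by under eq_bigr do rewrite sum1_card; rewrite sum_nat_const.
Qed.

Lemma card_hsphere s : #|hsphere s| = ('C(#|D|, s) * n.-1 ^ s)%N.
Proof.
rewrite -sum1_card sum_hsphere -cards_draws -sum_nat_const.
apply: eq_big => [L|L /andP[LD /eqP <-]]; first by rewrite inE.
by rewrite sum1_card (card_level _ card_summand1).
Qed.

Lemma card_between L r : L \subset D ->
  #|[set J : {set I} | [&& L \subset J, J \subset D & #|J| == r]]| =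
  if (#|L| <= r)%N then 'C(#|D| - #|L|, r - #|L|) else 0%N.
Proof.
move=> LD; case: leqP => Lr; last first.
  apply: eq_card0 => J; rewrite inE; apply/negP => /and3P[LJ _ /eqP Jr].
  by move: Lr; rewrite -Jr ltnNge subset_leq_card.
rewrite -(cardsDS LD) -cards_draws.
have inj : {in [set B : {set I} | B \subset D :\: L & #|B| == (r - #|L|)%N] &,
             injective (fun B => L :|: B)}.
  move=> B B'; rewrite !inE => /andP[+ _] /andP[+ _].
  rewrite !subsetD => /andP[_ dB] /andP[_ dB'] e.
  have /(congr1 (fun X => X :\: L)) := e.
  rewrite !setDUl setDv !set0U.
  by rewrite (setDidPl dB) (setDidPl dB').
rewrite -(card_in_imset inj); apply: eq_card => J; rewrite inE.
apply/and3P/imsetP => [[LJ JD /eqP Jr]|[B]].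
  exists (J :\: L); last by rewrite -{1}(setID J L) (setIidPr LJ).
  by rewrite inE setSD //= cardsDS // Jr.
rewrite inE subsetD => /andP[/andP[BD dBL] /eqP Br] ->.
rewrite subsetUl subUset LD BD cardsU (_ : L :&: B = set0) ?cards0 ?subn0 ?Br.
  by rewrite subnKC.
by apply/disjoint_setI0; rewrite disjoint_sym.
Qed.

Lemma mul_bin_bin (N r s : nat) : (s <= r)%N -> (r <= N)%N ->
  ('C(N, r) * 'C(r, s) = 'C(N, s) * 'C(N - s, r - s))%N.
Proof.
move=> sr rN; have sN := leq_trans sr rN.
apply/eqP; rewrite -(eqn_pmul2r (fact_gt0 s)) -(eqn_pmul2r (fact_gt0 (r - s))).
rewrite -(eqn_pmul2r (fact_gt0 (N - r))); apply/eqP.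
have e1 := bin_fact sr; have e2 := bin_fact rN; have e3 := bin_fact sN.
have e4 : ('C(N - s, r - s) * ((r - s)`! * (N - r)`!) = (N - s)`!)%N.
  have -> : (N - r = (N - s) - (r - s))%N by lia.
  by rewrite bin_fact // leq_sub2r.
transitivity N`!; first by rewrite -e2 -e1; ring.
by rewrite -e3 -e4; ring.
Qed.

(** The number of coordinates changed by rerandomizing r of them is binomial and, given that number,
    the change is uniform on a sphere. *)
Lemma resampleE r f x : (1 < n)%N -> (r <= #|D|)%N ->
  resample r f x = \sum_(s < #|D|.+1) binom_weight n%:R^-1 r s * sph s f x.
Proof.
move=> n1 rN; have n0 : (0 < n)%N by lia.
have nR : n%:R != 0 :> R by rewrite pnatr_eq0 -lt0n.
have yR : n.-1%:R != 0 :> R by rewrite pnatr_eq0; lia.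
have yE : 1 - n%:R^-1 = n.-1%:R / n%:R :> R.
  by rewrite -[in RHS]subn1 natrB // mulrBl mulfV ?mul1r.
pose lev L := \sum_(h in level pi L) f (x + h).
have C0 s : (s <= #|D|)%N -> 'C(#|D|, s)%:R != 0 :> R.
  by move=> sD; rewrite pnatr_eq0 -lt0n bin_gt0.
(* First sort by the exact set L of changed coordinates and count the r-subsets of D that contain
   L. *)
transitivity (\sum_(L : {set I} | L \subset D)
    binom_weight n%:R^-1 r #|L| * ('C(#|D|, #|L|) * n.-1 ^ #|L|)%:R^-1 * lev L).
  rewrite /resample /avg.
  under eq_bigr => J /andP[JD /eqP Jr].
    rewrite card_summand // Jr sum_summand_level // -/lev.
    rewrite [\sum_(L in powerset J) _](_ : _ =
      \sum_(L : {set I} | L \subset D) (L \subset J)%:R * lev L); last first.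
      rewrite big_mkcond [RHS]big_mkcond /=; apply: eq_bigr => L _.
      rewrite inE; case: (boolP (L \subset J)) => LJ; last by rewrite mul0r if_same.
      by rewrite (subset_trans LJ JD) mul1r.
    over.
  rewrite -mulr_sumr exchange_big /= !mulr_sumr.
  apply: eq_bigr => L LD; rewrite -mulr_suml mulrA mulrA; congr (_ * _).
  have -> : \sum_(J : {set I} | (J \subset D) && (#|J| == r)) (L \subset J)%:R =
     #|[set J : {set I} | [&& L \subset J, J \subset D & #|J| == r]]|%:R :> R.
    rewrite -sum1_card natr_sum big_mkcond [RHS]big_mkcond /=; apply: eq_bigr => J _.
    by rewrite inE; case: (L \subset J); case: (_ && _).
  rewrite card_between //; have LN := subset_leq_card LD.
  case: leqP => Lr; last by rewrite /binom_weight (bin_small Lr) mulr0n !mul0r !mulr0.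
  have := mul_bin_bin Lr rN => /(congr1 (fun k => k%:R : R)).
  rewrite !natrM !natrX => e.
  have -> : 'C(#|D| - #|L|, r - #|L|)%:R = 'C(#|D|, r)%:R * 'C(r, #|L|)%:R / 'C(#|D|, #|L|)%:R :> R.
    by rewrite e mulrAC mulfV ?mul1r ?C0.
  rewrite /binom_weight yE exprMn exprVn -[in LHS](subnKC Lr) exprD.
  rewrite subnKC // exprVn.
  by field; rewrite !expf_neq0 // !C0.
rewrite (partition_big (fun L : {set I} => inord #|L| : 'I_#|D|.+1) xpredT) //=.
apply: eq_bigr => s _; rewrite /sph /avg sum_hsphere card_hsphere !mulr_sumr.
apply: eq_big => [L|L /andP[LD /eqP Ls]].
  apply: andb_id2l => LD; rewrite -val_eqE /= inordK //.
  by rewrite ltnS subset_leq_card.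
have -> : #|L| = s by rewrite -Ls inordK // ltnS subset_leq_card.
by rewrite mulrA.
Qed.

(** A random r-subset is the initial segment of length r of a random ordering. For a fixed ordering
    these segments give a chain of subgroups, to which Doob's inequality applies; the majorants are
    then averaged over all orderings. *)
Lemma resample_maximal f q : 1 < q -> (forall y, 0 <= f y) ->
  exists S : A -> R, (forall r x, (r <= #|D|)%N -> resample r f x <= S x) /\
    \sum_x S x `^ q <= doob_const q * \sum_x f x `^ q.
Proof.
move=> q1 f0.
(* Initial segments of one fixed ordering of D; the other orderings are reached by permutations. *)
pose J0 r : {set I} := [set i in take r (enum D)].
have J0S r : J0 r \subset J0 r.+1.
  apply/subsetP => i; rewrite !inE.
  have [h|h] := ltnP r (size (enum D)); last by rewrite !take_oversize // ltnW.
  have [i0 _] : exists i0, i0 \in D by apply/card_gt0P; rewrite cardE; lia.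
  by rewrite (take_nth i0) // mem_rcons inE => ->; rewrite orbT.
have J0D r : J0 r \subset D.
  by apply/subsetP => i; rewrite inE => /mem_take; rewrite mem_enum.
have cJ0 r : (r <= #|D|)%N -> #|J0 r| = r.
  move=> rD; rewrite cardsE; have /card_uniqP -> : uniq (take r (enum D)).
    by rewrite take_uniq // enum_uniq.
  by rewrite size_takel // -cardE.
set G := [set h : {perm I} | perm_on D h].
have chain (g : {perm I}) : exists S : A -> R,
    (forall r x, (r <= #|D|)%N -> avg (summand pi (g @: J0 r)) f x <= S x) /\
    \sum_x S x `^ q <= doob_const q * \sum_x f x `^ q.
  apply: doob_chain => // r; first exact: subgroup_summand.
  apply/subsetP => h; rewrite !inE => /subset_trans; apply.
  exact: imsetS.
have [S Sprop] := boolp.choice chain.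
have S0 g x : 0 <= S g x.
  by have [/(_ 0%N x (leq0n _)) h _] := Sprop g; apply: le_trans h; apply: avg_ge0.
have G0 : #|G|%:R != 0 :> R.
  by rewrite pnatr_eq0 -lt0n; apply/card_gt0P; exists 1%g; rewrite inE perm_on1.
exists (fun x => \sum_(g in G) #|G|%:R^-1 * S g x); split.
  move=> r x rD; rewrite /resample.
  have := mean_perm_imset (fun J => avg (summand pi J) f x) (J0D r).
  rewrite cJ0 // => <-; rewrite mulr_sumr.
  apply: ler_sum => g _; rewrite ler_wpM2l ?invr_ge0 ?ler0n //.
  by have [h _] := Sprop g; apply: h.
have w1 : \sum_(g in G) #|G|%:R^-1 = 1 :> R by rewrite sumr_constM mulfV.
apply: (@le_trans _ _ (\sum_x \sum_(g in G) #|G|%:R^-1 * S g x `^ q)).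
  apply: ler_sum => x _; apply: powR_mean => // g _; by rewrite ?invr_ge0 ?ler0n.
rewrite exchange_big /=.
under eq_bigr do rewrite -mulr_sumr.
rewrite -[leRHS]mul1r -[X in _ <= X * _]w1 mulr_suml; apply: ler_sum => g _.
by rewrite ler_wpM2l ?invr_ge0 ?ler0n //; case: (Sprop g).
Qed.

Definition cesaro_const q : R :=
  2 `^ q * (15 `^ q * doob_const q + 4 `^ q).

(** When 4 r <= #|D|, adding up the rerandomizations of j <= 4 r coordinates gives every sphere of
    radius at most r a weight of at least 11 / 27; this needs 1 / n <= 1 / 3. For larger r the mean
    over all radii suffices. *)
Lemma cesaro_maximal f q : (2 < n)%N -> 1 < q -> (forall y, 0 <= f y) ->
  exists U : A -> R, [/\ (forall x, 0 <= U x),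
    (forall r x, (0 < r <= #|D|)%N -> \sum_(s < r.+1) sph s f x <= r%:R * U x) &
    \sum_x U x `^ q <= cesaro_const q * \sum_x f x `^ q].
Proof.
move=> n2 q1 f0; have [S [Sub Ssum]] := resample_maximal q1 f0.
have q0 : 0 < q by apply: lt_trans q1.
pose N := #|D|.
have s0 s x : 0 <= sph s f x by apply: avg_ge0.
pose W x := \sum_(s < N.+1) N.+1%:R^-1 * sph s f x.
have N0 : N.+1%:R != 0 :> R by rewrite pnatr_eq0.
have W0 x : 0 <= W x by apply: sumr_ge0 => s _; rewrite mulr_ge0 ?invr_ge0.
have S0 x : 0 <= S x.
  apply: le_trans (Sub 0%N x (leq0n _)).
  by rewrite mulr_ge0 ?invr_ge0 ?ler0n // sumr_ge0 // => J _; apply: avg_ge0.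
have w1 : \sum_(s < N.+1) N.+1%:R^-1 = 1 :> R.
  by rewrite sumr_constM card_ord mulfV.
have Wsum : \sum_x W x `^ q <= \sum_x f x `^ q.
  apply: (@le_trans _ _ (\sum_x \sum_(s < N.+1) N.+1%:R^-1 * sph s f x `^ q)).
    by apply: ler_sum => x _; apply: powR_mean => // s _; rewrite invr_ge0.
  rewrite exchange_big /=.
  under eq_bigr do rewrite -mulr_sumr.
  rewrite -[leRHS]mul1r -[X in _ <= X * _]w1 mulr_suml; apply: ler_sum => s _.
  by rewrite ler_wpM2l ?invr_ge0 ?ler0n // sum_avg_powR.
(* The factor 15 exceeds 5 * 27 / 11, where 4 r + 1 <= 5 r counts the rerandomizations; the factor 4
   comes from #|D| + 1 <= 4 r in the other case. *)
exists (fun x => 15 * S x + 4 * W x); split.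
- by move=> x; rewrite addr_ge0 ?mulr_ge0.
- move=> r x /andP[r0 rN]; rewrite mulrDr.
  have [r4|r4] := leqP (4 * r) N.
    apply: (@le_trans _ _ (r%:R * (15 * S x))); last first.
      by rewrite lerDl !mulr_ge0 ?ler0n.
    have p0 : 0 <= n%:R^-1 :> R by rewrite invr_ge0.
    have p1 : 3 * n%:R^-1 <= 1 :> R.
      rewrite ler_pdivrMr ?mul1r ?ltr0n ?ler_nat //; lia.
    have h : 11 / 27 * \sum_(s < r.+1) sph s f x <=
        \sum_(j < (4 * r).+1) resample j f x.
      have -> : \sum_(j < (4 * r).+1) resample j f x =
        \sum_(s < N.+1) (\sum_(j < (4 * r).+1) binom_weight n%:R^-1 j s) * sph s f x.
        under [RHS]eq_bigr do rewrite mulr_suml.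
        rewrite exchange_big /=; apply: eq_bigr => j _; rewrite resampleE //.
          exact: ltnW.
        by apply: leq_trans r4; rewrite -ltnS.
      rewrite -(big_mkord xpredT (fun s => sph s f x)).
      rewrite -(big_mkord xpredT (fun s =>
        (\sum_(j < (4 * r).+1) binom_weight n%:R^-1 j s) * sph s f x)).
      rewrite [leRHS](big_cat_nat (n := r.+1)) //= mulr_sumr.
      rewrite -[leLHS]addr0; apply: lerD.
        apply: ler_sum_nat => s /andP[_ sr].
        by rewrite ler_wpM2r // sum_binom_weight_ge.
      apply: sumr_ge0 => s _; rewrite mulr_ge0 // sumr_ge0 // => j _.
      rewrite !mulr_ge0 ?exprn_ge0 //; lra.
    have h2 : \sum_(j < (4 * r).+1) resample j f x <= (4 * r).+1%:R * S x.
      rewrite -[X in X%:R * _]card_ord -sumr_constM.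
      apply: ler_sum => j _; apply: Sub; apply: leq_trans r4; by rewrite -ltnS.
    have h3 : (4 * r).+1%:R <= 5 * r%:R :> R by rewrite -natrM ler_nat; lia.
    have h4 : (4 * r).+1%:R * S x <= 5 * r%:R * S x by rewrite ler_wpM2r.
    have := S0 x; have : 0 <= r%:R :> R by [].
    move: h h2 h4; set a := \sum_(s < _) _; set b := \sum_(s < _) _; set c := S x.
    move=> h h2 h4 rr cc; have rc : 0 <= r%:R * c by rewrite mulr_ge0.
    have -> : r%:R * (15 * c) = 15 * (r%:R * c) by ring.
    have : 5 * r%:R * c = 5 * (r%:R * c) by ring.
    lra.
  apply: (@le_trans _ _ (r%:R * (4 * W x))); last first.
    by rewrite lerDr !mulr_ge0 ?ler0n.
  apply: (@le_trans _ _ (N.+1%:R * W x)).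
    rewrite /W mulr_sumr.
    under [leRHS]eq_bigr do rewrite mulrA mulfV // mul1r.
    rewrite -(big_mkord xpredT (fun s => sph s f x)).
    rewrite -(big_mkord xpredT (fun s => sph s f x)).
    rewrite [leRHS](big_cat_nat (n := r.+1)) //= lerDl.
    by apply: sumr_ge0.
  rewrite mulrA ler_wpM2r // -natrM ler_nat; lia.
apply: (@le_trans _ _ (\sum_x 2 `^ q * ((15 * S x) `^ q + (4 * W x) `^ q))).
  by apply: ler_sum => x _; apply: powRD_le; rewrite ?mulr_ge0 // ltW.
rewrite -mulr_sumr /cesaro_const -mulrA ler_wpM2l ?powR_ge0 //.
rewrite big_split /= mulrDl.
under eq_bigr do rewrite powRM //.
under [X in _ + X]eq_bigr do rewrite powRM //.
rewrite -!mulr_sumr -mulrA.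
by apply: lerD; rewrite ler_wpM2l ?powR_ge0.
Qed.

End Resampling.

(** * Krawtchouk numbers *)

Section Krawtchouk.
Variable R : realType.
Implicit Types c : R.

(** For c = -1 / (n - 1) this is the value at a of the r-th Krawtchouk polynomial of length a + b
    over n letters, divided by (n - 1) ^ r; the body is its generating function. *)
Definition kraw c (a b r : nat) : R := ((1 + c *: 'X) ^+ a * (1 + 'X) ^+ b)`_r.

Lemma kraw0 c a b : kraw c a b 0 = 1.
Proof.
rewrite /kraw -horner_coef0 hornerM !horner_exp !hornerD hornerZ hornerX hornerC.
by rewrite mulr0 addr0 !expr1n mulr1.
Qed.

Lemma krawSl c a b r : kraw c a.+1 b r.+1 = kraw c a b r.+1 + c * kraw c a b r.
Proof.
by rewrite /kraw exprS -mulrA mulrDl mul1r coefD -scalerAl coefZ mulrC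
  mulrC coefXM.
Qed.

Lemma krawSr c a b r : kraw c a b.+1 r.+1 = kraw c a b r.+1 + kraw c a b r.
Proof. by rewrite /kraw exprS mulrCA mulrDl mul1r coefD coefXM. Qed.

Lemma kraw0n c b r : kraw c 0 b r = 'C(b, r)%:R.
Proof.
elim: b r => [|b IH] [|r]; rewrite ?kraw0 ?bin0 //.
  by rewrite /kraw !expr0 mulr1 coef1.
by rewrite krawSr !IH binS natrD.
Qed.

Lemma deriv_kraw c a b : ((1 + c *: 'X) ^+ a * (1 + 'X) ^+ b)^`() =
  (a%:R * c) *: ((1 + c *: 'X) ^+ a.-1 * (1 + 'X) ^+ b) +
  b%:R *: ((1 + c *: 'X) ^+ a * (1 + 'X) ^+ b.-1).
Proof.
rewrite derivM !deriv_exp !derivD !derivC !derivZ derivX !add0r.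
rewrite -scalerAl !mul1r -!scaler_nat -!scalerAl -!scalerAr scalerA.
by [].
Qed.

Lemma krawD c a b r : r.+1%:R * kraw c a b r.+1 =
  a%:R * c * kraw c a.-1 b r + b%:R * kraw c a b.-1 r.
Proof.
by rewrite mulr_natl -coef_deriv deriv_kraw coefD !coefZ.
Qed.

(** The coefficient form of (a + b) G - X G', G being the generating function: subtracting X G'
    strips one linear factor from each term. *)
Lemma krawC c a b r : ((a + b)%:R - r%:R) * kraw c a b r =
  a%:R * kraw c a.-1 b r + b%:R * kraw c a b.-1 r.
Proof.
have e1 : a%:R * kraw c a b r = a%:R * (kraw c a.-1 b r + c * (if r is r'.+1 then kraw c a.-1 b r' else 0)).
  case: a => [|a]; first by rewrite !mul0r.
  by case: r => [|r]; rewrite /= ?kraw0 ?mulr0 ?addr0 // krawSl.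
have e2 : b%:R * kraw c a b r = b%:R * (kraw c a b.-1 r + (if r is r'.+1 then kraw c a b.-1 r' else 0)).
  case: b {e1} => [|b]; first by rewrite !mul0r.
  by case: r => [|r]; rewrite /= ?kraw0 ?addr0 // krawSr.
rewrite mulrBl natrD mulrDl e1 e2.
case: r {e1 e2} => [|r]; first by rewrite !mulr0 !addr0 mul0r subr0.
by rewrite krawD; ring.
Qed.

(** Changing the sign of c only changes signs in an expansion with nonnegative terms. *)
Lemma norm_kraw c a b r : 0 <= c ->
  0 <= kraw c a b r /\ `|kraw (- c) a b r| <= kraw c a b r.
Proof.
move=> c0; elim: a r => [|a IH] [|r]; rewrite ?kraw0 ?kraw0n ?normr1 //.
  by rewrite ger0_norm.
rewrite !krawSl; have [h1 h2] := IH r.+1; have [h3 h4] := IH r.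
split; first by rewrite addr_ge0 // mulr_ge0.
apply: le_trans (ler_normD _ _) _; apply: lerD => //.
by rewrite normrM normrN (ger0_norm c0) ler_wpM2l.
Qed.

(* The eigenvalue of [sph D r] on functions of exactly [a] of [a + b] coordinates
   is [nkraw c a b r] with [c = - 1 / (n - 1)]. *)
Definition nkraw c a b r := kraw c a b r / 'C(a + b, r)%:R.

Lemma nkraw0n c b r : (r <= b)%N -> nkraw c 0 b r = 1.
Proof. by move=> rb; rewrite /nkraw kraw0n add0n mulfV // pnatr_eq0 -lt0n bin_gt0. Qed.

(** Over the common denominator (N - r) * 'C(N, r) = N * 'C(N - 1, r), N = a + b, the terms in b of
    [krawD] and [krawC] cancel. Each differencing thus gains a / N and lowers a by one. *)
Lemma nkrawB c a b r : (r < a + b)%N ->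
  nkraw c a b r.+1 - nkraw c a b r = (c - 1) * (a%:R / (a + b)%:R) * nkraw c a.-1 b r.
Proof.
case: a => [|a] rN.
  by rewrite !nkraw0n ?add0n // ?subrr ?mul0r ?mulr0 ?mul0r // ltnW.
rewrite /nkraw /=; set N := (a.+1 + b)%N in rN *.
have NE : N = (a + b).+1 by rewrite /N addSn.
have C0 : 'C(N, r)%:R != 0 :> R by rewrite pnatr_eq0 -lt0n bin_gt0 ltnW.
have C1 : 'C(N, r.+1)%:R != 0 :> R by rewrite pnatr_eq0 -lt0n bin_gt0.
have C2 : 'C(a + b, r)%:R != 0 :> R by rewrite pnatr_eq0 -lt0n bin_gt0; lia.
have N0 : N%:R != 0 :> R by rewrite pnatr_eq0 NE.
have Nr : N%:R - r%:R != 0 :> R by rewrite subr_eq0 eqr_nat; lia.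
have r0 : r.+1%:R != 0 :> R by rewrite pnatr_eq0.
have B1 : r.+1%:R * 'C(N, r.+1)%:R = (N%:R - r%:R) * 'C(N, r)%:R :> R.
  by rewrite -natrB ?(ltnW rN) // -!natrM mul_bin_left.
have B2 : (N%:R - r%:R) * 'C(N, r)%:R = N%:R * 'C(a + b, r)%:R :> R.
  rewrite -natrB ?(ltnW rN) // -!natrM -mul_bin_left NE -mul_bin_diag /=.
  by [].
have K1 := krawD c a.+1 b r; have K2 := krawC c a.+1 b r.
rewrite /= -/N in K1 K2.
have e1 : kraw c a.+1 b r.+1 / 'C(N, r.+1)%:R =
    r.+1%:R * kraw c a.+1 b r.+1 / ((N%:R - r%:R) * 'C(N, r)%:R).
  by rewrite -B1 invfM mulrACA mulfV // mul1r.
have e2 : kraw c a.+1 b r / 'C(N, r)%:R =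
   (N%:R - r%:R) * kraw c a.+1 b r / ((N%:R - r%:R) * 'C(N, r)%:R).
  by rewrite invfM mulrACA mulfV // mul1r.
rewrite e1 e2 K1 K2 -mulrBl B2 invfM mulrACA; ring.
Qed.

(** Once binomials are cleared and [krawSl] applied, the claim is c * (N - r) * x <= (r + 1) * y for
    consecutive coefficients x and y, N = a + b. As c <= 1, this follows by comparing [krawC] with
    [krawD]. *)
Lemma nkraw_pred_ge c a b r : 0 <= c <= 1 -> (r < a.+1 + b)%N ->
  nkraw c a.+1 b r <= nkraw c a b r.
Proof.
move=> /andP[c0 c1] rN; rewrite /nkraw addSn.
have C0 : 0 < 'C((a + b).+1, r)%:R :> R by rewrite ltr0n bin_gt0; lia.
have C2 : 0 < 'C(a + b, r)%:R :> R by rewrite ltr0n bin_gt0; lia.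
rewrite ler_pdivrMr // mulrAC ler_pdivlMr //.
have q0 a' b' r' : 0 <= kraw c a' b' r' by have [] := norm_kraw a' b' r' c0.
have B : ((a + b).+1%:R - r%:R) * 'C((a + b).+1, r)%:R = (a + b).+1%:R * 'C(a + b, r)%:R :> R.
  rewrite -natrB; last lia.
  by rewrite -!natrM -mul_bin_left -mul_bin_diag.
have key : ((a + b).+1%:R - r%:R) * kraw c a.+1 b r <= (a + b).+1%:R * kraw c a b r.
  case: r {rN C0 C2 B} => [|r]; first by rewrite !kraw0 subr0.
  rewrite krawSl; have K1 := krawD c a b r; have K2 := krawC c a b r.
  have h : c * (a%:R * kraw c a.-1 b r + b%:R * kraw c a b.-1 r) <=
      a%:R * c * kraw c a.-1 b r + b%:R * kraw c a b.-1 r.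
    rewrite mulrDr mulrA [c * _]mulrC lerD2l ler_piMl //.
    by rewrite mulr_ge0.
  rewrite -K1 -K2 in h.
  move: h; rewrite -!natr1; set x := kraw c a b r; set y := kraw c a b r.+1.
  set s := (a + b)%:R; set t := r%:R => h; nra.
have Nr : 0 < (a + b).+1%:R - r%:R :> R by rewrite subr_gt0 ltr_nat.
rewrite -(ler_pM2l Nr) mulrA.
apply: (@le_trans _ _ ((a + b).+1%:R * kraw c a b r * 'C(a + b, r)%:R)).
  by rewrite ler_wpM2r // ltW.
by rewrite mulrCA B [leLHS]mulrAC [leLHS]mulrC.
Qed.

(** By [nkrawB] and [nkraw_pred_ge], raising r by one multiplies the value by at most 1 - (1 - c) *
    a / (a + b). *)
Lemma nkraw_le c a b r : 0 <= c <= 1 -> (r <= a + b)%N ->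
  nkraw c a b r <= (1 - (1 - c) * (a%:R / (a + b)%:R)) ^+ r.
Proof.
move=> c01; have /andP[c0 c1] := c01; elim: r => [_|r IH rN].
  by rewrite expr0 /nkraw kraw0 bin0 divr1.
case: a rN IH => [|a] rN IH.
  by rewrite nkraw0n // mul0r mulr0 subr0 expr1n.
set t := a.+1%:R / _ in IH *.
have t01 : 0 <= t <= 1.
  rewrite divr_ge0 //= ler_pdivrMr ?mul1r ?ltr0n // ler_nat; lia.
have e : nkraw c a.+1 b r.+1 = nkraw c a.+1 b r - (1 - c) * t * nkraw c a b r.
  by have := nkrawB c rN; rewrite -/t /= => /(canRL (subrK _)) ->; ring.
have h := nkraw_pred_ge c01 rN; have h' := IH (ltnW rN).
case/andP: t01 => t0 t1.
have ct : 0 <= (1 - c) * t by rewrite mulr_ge0 // subr_ge0.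
have ct1 : 0 <= 1 - (1 - c) * t by rewrite subr_ge0 -[leRHS]mulr1 ler_pM // ?subr_ge0 // gerBl.
rewrite e exprS.
apply: le_trans (ler_wpM2l ct1 h').
have := ler_wpM2l ct h; lra.
Qed.

End Krawtchouk.

(** * Removing window averages from a sequence *)

Section Smoothing.
Variable R : realType.
Implicit Types (u v : nat -> R) (w K r : nat).

(* Indices below 0 are truncated to 0. *)
Definition detrend w u r := u r - w%:R^-1 * \sum_(i < w) u (r - i)%N.

(** K detrendings look back at most K * w steps, so identities valid only away from the truncation
    at 0 can be substituted. *)
Lemma iter_detrend_local w K u v r :
  (forall s, (r - K * w <= s <= r)%N -> u s = v s) ->
  iter K (detrend w) u r = iter K (detrend w) v r.
Proof.
elim: K r => [|K IH] r uv /=; first by apply: uv; lia.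
rewrite /detrend (IH r); last by move=> s sr; apply: uv; lia.
congr (_ - _ * _); apply: eq_bigr => i _; apply: IH => s sr; apply: uv.
by have := ltn_ord i; lia.
Qed.

Lemma iter_detrend_sum (T : Type) (l : seq T) (P : pred T) (c : T -> R)
    (u : T -> nat -> R) w K r :
  iter K (detrend w) (fun s => \sum_(t <- l | P t) c t * u t s) r =
  \sum_(t <- l | P t) c t * iter K (detrend w) (u t) r.
Proof.
elim: K r => [//|K IH] r /=; rewrite /detrend IH.
under [X in _ - _ * X]eq_bigr do rewrite IH.
rewrite exchange_big /= mulr_sumr -sumrB; apply: eq_bigr => t _.
by rewrite -mulr_sumr mulrBr mulrCA.
Qed.

Lemma iter_detrend_shift w K u l r :
  iter K (detrend w) (fun s => u (s - l)%N) r = iter K (detrend w) u (r - l)%N.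
Proof.
elim: K r => [//|K IH] r /=; rewrite /detrend IH; congr (_ - _ * _).
by apply: eq_bigr => i _; rewrite IH subnAC.
Qed.

Lemma iter_detrend0 w K r : iter K (detrend w) (fun=> 0 : R) r = 0.
Proof.
elim: K r => [//|K IH] r /=; rewrite /detrend IH sub0r.
by under eq_bigr do rewrite IH; rewrite big1 // mulr0 oppr0.
Qed.

Lemma detrend1 u r : detrend 1 u r = 0.
Proof. by rewrite /detrend big_ord1 subn0 invr1 mul1r subrr. Qed.

Lemma iter_detrend_diff w K u s : (K * w <= s)%N ->
  iter K (detrend w) u s.+1 - iter K (detrend w) u s =
  iter K (detrend w) (fun s => u s.+1 - u s) s.
Proof.
elim: K s => [//|K IH] s Ks /=; rewrite /detrend -IH; last by lia.
have -> : \sum_(i < w) iter K (detrend w) (fun s => u s.+1 - u s) (s - i)%N =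
  \sum_(i < w) iter K (detrend w) u (s.+1 - i)%N -
  \sum_(i < w) iter K (detrend w) u (s - i)%N.
  rewrite -sumrB; apply: eq_bigr => i _; have := ltn_ord i => iw.
  by rewrite -IH; [rewrite subSn //; lia | lia].
by ring.
Qed.

Lemma detrend_telescope w u r : (0 < w)%N -> (w <= r.+1)%N ->
  detrend w u r = \sum_(i < w) \sum_(l < i)
    w%:R^-1 * (u (r - l.+1).+1 - u (r - l.+1)%N).
Proof.
move=> w0 wr; rewrite /detrend.
have wn : w%:R != 0 :> R by rewrite pnatr_eq0 -lt0n.
have {1}-> : u r = w%:R^-1 * \sum_(i < w) u r.
  by rewrite sumr_constM card_ord mulrA mulVf // mul1r.
rewrite -mulrBr -sumrB mulr_sumr; apply: eq_bigr => i _.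
rewrite -mulr_sumr; congr (_ * _); have := ltn_ord i; move: (nat_of_ord i) => {i} i iw.
elim: i iw => [|i IH] iw; first by rewrite big_ord0 subn0 subrr.
rewrite big_ord_recr /= -IH; last lia.
have -> : ((r - i.+1).+1 = r - i)%N by lia.
ring.
Qed.

(** With V the window average, u - (1 - V) ^ K u is the sum over k < K of V (1 - V) ^ k u, and the
    k-th term is at most 2 ^ k * C. A window of length 1 removes everything, and then u itself is at
    most C. *)
Lemma detrend_majorant w K u r C : (forall s, 0 <= u s) -> (0 < w)%N ->
  (forall s, (s <= r)%N -> w%:R^-1 * \sum_(j < s.+1) u j <= C) ->
  (K * w <= r.+1)%N \/ w = 1%N ->
  `|u r - iter K (detrend w) u r| <= 2 ^+ K * C.
Proof.
move=> u0 w0 uC.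
have C0 : 0 <= C.
  apply: le_trans (uC 0%N (leq0n _)).
  by rewrite mulr_ge0 ?invr_ge0 ?ler0n ?sumr_ge0.
have K2 : 1 <= 2 ^+ K :> R by rewrite exprn_ege1 // ler1n.
case=> [Kw|w1]; last first.
  have ur : u r <= C.
    apply: le_trans (uC r (leqnn _)); rewrite w1 invr1 mul1r.
    by rewrite big_ord_recr /= lerDr sumr_ge0.
  case: K K2 => [|K] K2; first by rewrite /= subrr normr0 expr0 mul1r.
  rewrite /= w1 detrend1 subr0 ger0_norm //.
  by apply: le_trans ur _; rewrite ler_peMl.
pose V v r := w%:R^-1 * \sum_(i < w) v (r - i)%N.
have wn : w%:R != 0 :> R by rewrite pnatr_eq0 -lt0n.
have Vbound v s B : (w <= s.+1)%N -> (forall i, (i < w)%N -> `|v (s - i)%N| <= B) ->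
    `|V v s| <= B.
  move=> ws vB; rewrite /V normrM ger0_norm ?invr_ge0 ?ler0n //.
  rewrite mulrC ler_pdivrMr ?ltr0n //.
  apply: le_trans (ler_norm_sum _ _ _) _.
  rewrite mulr_natr -[X in _ *+ X]card_ord -sumr_const.
  by apply: ler_sum => i _; apply: vB.
(* Induction through V (1 - V) ^ (k + 1) = V (1 - V) ^ k - V V (1 - V) ^ k, which doubles the
   bound. *)
have H k s : (s <= r)%N -> (k.+1 * w <= s.+1)%N ->
    `|V (iter k (detrend w) u) s| <= 2 ^+ k * C.
  elim: k s => [|k IH] s sr ks.
    rewrite expr0 mul1r /= ger0_norm; last by rewrite mulr_ge0 ?invr_ge0 ?ler0n ?sumr_ge0.
    apply: le_trans (uC s sr); rewrite ler_wpM2l ?invr_ge0 ?ler0n //.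
    rewrite -(big_mkord xpredT u) -(big_mkord xpredT (fun i => u (s - i)%N)).
    rewrite [leRHS]big_nat_rev /= add0n.
    rewrite [leRHS](big_cat_nat (n := w)) //=; last lia.
    apply: (@le_trans _ _ (\sum_(0 <= i < w) u (s.+1 - i.+1)%N)).
      by apply: ler_sum => i _; rewrite subSS.
    by rewrite lerDl sumr_ge0.
  have -> : V (iter k.+1 (detrend w) u) s =
     V (iter k (detrend w) u) s - V (V (iter k (detrend w) u)) s.
    by rewrite /V -mulrBr -sumrB.
  apply: le_trans (ler_normB _ _) _; rewrite exprS -mulrA mulrDl mul1r.
  apply: lerD; first by apply: IH => //; lia.
  apply: Vbound; first lia.
  by move=> i iw; apply: IH; lia.
have : `|u r - iter K (detrend w) u r| <= (2 ^+ K - 1) * C.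
  elim: K Kw {K2} => [|K IH] Kw; first by rewrite /= expr0 !subrr mul0r normr0.
  have -> : u r - iter K.+1 (detrend w) u r =
     (u r - iter K (detrend w) u r) + V (iter K (detrend w) u) r.
    by rewrite /= /detrend /V opprB addrA addrAC.
  apply: le_trans (ler_normD _ _) _.
  have h1 := IH _; have h2 := H K r (leqnn _) Kw.
  rewrite exprS; have := lerD (h1 _) h2; move/(_ _)/le_trans; apply; first lia.
  by rewrite le_eqVlt; apply/orP; left; apply/eqP; ring.
by move/le_trans; apply; rewrite ler_wpM2r // gerBl.
Qed.

(** A detrending is a combination of differences with total weight at most w, and by [nkrawB] each
    of these gains 2 a / (a + b) and lowers a by one. *)
Lemma nkraw_detrend c (a b r w K : nat) (B : R) : `|c - 1| <= 2 -> (0 < w)%N ->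
  (K * w <= r)%N -> (r <= a + b)%N -> 0 <= B ->
  (forall s, (r - K * w <= s)%N -> (s + K <= r)%N -> `|nkraw c (a - K) b s| <= B) ->
  `|iter K (detrend w) (nkraw c a b) r| <= (2 * w%:R * (a%:R / (a + b)%:R)) ^+ K * B.
Proof.
move=> c2 w0; elim: K a r => [|K IH] a r Kr rN B0 HB.
  rewrite expr0 mul1r /=; have := HB r; rewrite subn0; apply; lia.
rewrite iterSr; set t := a%:R / _.
have t0 : 0 <= t by rewrite divr_ge0.
have wt0 : 0 <= 2 * w%:R * t by apply: mulr_ge0 => //; rewrite mulr_ge0 ?ler0n.
(* For a = 0 the sequence is constantly 1 on the range in question, and a single detrending kills
   it. *)
case: a rN HB @t t0 wt0 => [|a] rN HB t t0 wt0.
  rewrite (@iter_detrend_local w K _ (fun=> 0)) ?iter_detrend0.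
    by rewrite normr0; apply: mulr_ge0 => //; apply: exprn_ge0.
  move=> s sr; rewrite /detrend nkraw0n; last lia.
  have e (i : 'I_w) : true -> nkraw c 0 b (s - i) = 1 by move=> _; rewrite nkraw0n //; lia.
  rewrite (eq_bigr _ e) sumr_constM card_ord mulr1 mulVf ?subrr //.
  by rewrite pnatr_eq0 -lt0n.
rewrite (@iter_detrend_local w K _ (fun s => \sum_(i < w) \sum_(l < i)
    (w%:R^-1 * ((c - 1) * t)) * nkraw c a b (s - l.+1)%N)); last first.
  move=> s sr; rewrite detrend_telescope //; last lia.
  apply: eq_bigr => i _; apply: eq_bigr => l _; rewrite -mulrA; congr (_ * _).
  by rewrite nkrawB //; have := ltn_ord l; have := ltn_ord i; lia.
have -> : iter K (detrend w) (fun s => \sum_(i < w) \sum_(l < i)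
    (w%:R^-1 * ((c - 1) * t)) * nkraw c a b (s - l.+1)%N) r =
   \sum_(i < w) \sum_(l < i)
    (w%:R^-1 * ((c - 1) * t)) * iter K (detrend w) (nkraw c a b) (r - l.+1)%N.
  rewrite (@iter_detrend_local w K _ (fun s => \sum_(i < w) 1 * \sum_(l < i)
    (w%:R^-1 * ((c - 1) * t)) * nkraw c a b (s - l.+1)%N)); last first.
    by move=> s _; apply: eq_bigr => i _; rewrite mul1r.
  rewrite iter_detrend_sum; apply: eq_bigr => i _; rewrite mul1r.
  by rewrite iter_detrend_sum; apply: eq_bigr => l _; rewrite iter_detrend_shift.
pose t' : R := a%:R / (a + b)%:R.
have t't : t' <= t.
  have [/eqP|N0] := posnP (a + b).
    by rewrite addn_eq0 => /andP[/eqP a0 _]; rewrite /t' a0 mul0r.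
  rewrite /t' /t addSn ler_pdivrMr ?ltr0n // mulrAC ler_pdivlMr ?ltr0n //.
  by rewrite -!natrM ler_nat; lia.
have t'0 : 0 <= t' by rewrite divr_ge0.
clearbody t.
set Z := (2 * w%:R * t) ^+ K * B.
have Z0 : 0 <= Z by rewrite mulr_ge0 // exprn_ge0.
have term (i : 'I_w) (l : 'I_i) :
   `|(w%:R^-1 * ((c - 1) * t)) * iter K (detrend w) (nkraw c a b) (r - l.+1)%N|
     <= w%:R^-1 * (2 * t) * Z.
  have li := ltn_ord l; have iw := ltn_ord i.
  rewrite !normrM (ger0_norm t0) ger0_norm ?invr_ge0 ?ler0n //.
  rewrite ler_pM // ?mulr_ge0 ?invr_ge0 ?ler0n //.
    by rewrite ler_wpM2l ?invr_ge0 ?ler0n // ler_wpM2r.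
  apply: le_trans (IH a (r - l.+1)%N _ _ _ _) _ => //; [lia|lia| |].
    move=> s s1 s2; have := HB s; rewrite subSS; apply; lia.
  have w2 : 0 <= 2 * w%:R :> R by rewrite mulr_ge0 ?ler0n.
  apply: ler_wpM2r => //; apply: lerXn2r; rewrite ?nnegrE //.
    exact: mulr_ge0.
  exact: ler_wpM2l.
apply: le_trans (ler_norm_sum _ _ _) _.
apply: (@le_trans _ _ (\sum_(i < w) 2 * t * Z)); last first.
  rewrite sumr_constM card_ord exprS /Z.
  by rewrite le_eqVlt; apply/orP; left; apply/eqP; ring.
apply: ler_sum => i _; apply: le_trans (ler_norm_sum _ _ _) _.
apply: (@le_trans _ _ (\sum_(l < i) w%:R^-1 * (2 * t) * Z)).
  by apply: ler_sum.
rewrite sumr_constM card_ord.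
have -> : i%:R * (w%:R^-1 * (2 * t) * Z) = (i%:R / w%:R) * (2 * t * Z) by ring.
have tZ : 0 <= 2 * t * Z by apply: mulr_ge0 => //; apply: mulr_ge0.
by rewrite ler_piMl // ler_pdivrMr ?ltr0n // mul1r ler_nat ltnW.
Qed.

End Smoothing.

(** * Spectral decomposition of spherical means *)

Section SubsetSums.
Variables (I : finType) (V : nmodType).

Lemma sum_subsetU1 (J : {set I}) i (Phi : {set I} -> V) : i \notin J ->
  \sum_(X : {set I} | X \subset i |: J) Phi X =
  \sum_(X : {set I} | X \subset J) (Phi X + Phi (i |: X)).
Proof.
move=> iJ; rewrite (bigID (fun X : {set I} => i \in X)) /= addrC big_split /=.
congr (_ + _).
  apply: eq_bigl => X; apply/andP/idP => [[XJ iX]|XJ].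
    by apply/subsetP => k kX; have := subsetP XJ k kX; rewrite !inE => /predU1P[ki|//];
      rewrite ki (negPf iX) in kX.
  by rewrite (subset_trans XJ) ?subsetUr //; split=> //; apply: contra iJ; apply: subsetP.
rewrite (reindex_onto (fun X : {set I} => i |: X) (fun X => X :\ i)) /=; last first.
  by move=> X /andP[_ iX]; rewrite setD1K.
apply: eq_bigl => X; rewrite setU11 andbT; apply/andP/idP => [[XJ /eqP <-]|XJ].
  by rewrite -(setU1K iJ) setSD.
rewrite setUS //; split => //; apply/eqP/setU1K; apply: contra iJ; exact: subsetP.
Qed.

End SubsetSums.

Section Anova.
Variables (R : realType) (A : finZmodType) (I : finType) (pi : I -> A -> A).
Hypothesis pi_proj : projections pi.
Implicit Types (J K L X Y : {set I}) (f : A -> R) (B C : {set A}).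

Lemma eq_avg B f (g : A -> R) x : f =1 g -> avg B f x = avg B g x.
Proof. by move=> fg; rewrite /avg; under eq_bigr do rewrite fg. Qed.

Lemma avgB B f (g : A -> R) x : avg B (fun y => f y - g y) x = avg B f x - avg B g x.
Proof. by rewrite /avg sumrB mulrBr. Qed.

Lemma avg_comm B C f x : avg B (avg C f) x = avg C (avg B f) x.
Proof.
rewrite /avg.
under eq_bigr do rewrite mulr_sumr.
under [in RHS]eq_bigr do rewrite mulr_sumr.
rewrite exchange_big !mulr_sumr; apply: eq_bigr => c _.
rewrite !mulr_sumr; apply: eq_bigr => b _.
by rewrite mulrCA addrAC.
Qed.

Lemma avg_id B f x : subgroup B -> invariant_under B f -> avg B f x = f x.
Proof.
move=> [B0 _ _] Bf; rewrite /avg.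
under eq_bigr => h hB do rewrite Bf //.
by rewrite sumr_constM mulrA mulVf ?mul1r ?card_subgroup_neq0.
Qed.

Lemma avg_idem B f x : subgroup B -> avg B (avg B f) x = avg B f x.
Proof. by move=> sB; rewrite avg_id //; apply: avg_invariant. Qed.

Lemma avg_adjoint B f (g : A -> R) : subgroup B ->
  \sum_x f x * avg B g x = \sum_x avg B f x * g x.
Proof.
move=> sB; have inv (h : A -> R) : invariant_under B (avg B h) by apply: avg_invariant.
rewrite -(sum_avg_invariant f sB (inv g)).
under [RHS]eq_bigr do rewrite mulrC.
rewrite -(sum_avg_invariant g sB (inv f)).
by apply: eq_bigr => x _; rewrite mulrC.
Qed.

(** Says that, within J, [F X] depends on exactly the coordinates in X, by making it a joint
    eigenvector of the commuting coordinate averages. *)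
Definition eigenfamily J (F : {set I} -> A -> R) := forall i X x,
  i \in J -> X \subset J -> avg (summand pi [set i]) (F X) x = if i \in X then 0 else F X x.

(* Hoeffding's decomposition. *)
Lemma anova J f : exists2 F : {set I} -> A -> R,
  (forall x, f x = \sum_(X : {set I} | X \subset J) F X x) & eigenfamily J F.
Proof.
elim/(@finset_ind I): J => [|J i iJ [F Fsum Feig]].
  exists (fun=> f) => [x|i X x]; last by rewrite inE.
  rewrite (big_pred1 set0) // => X; by rewrite subset0.
pose E : (A -> R) -> A -> R := avg (summand pi [set i]).
have sE : subgroup (summand pi [set i]) := subgroup_summand pi_proj _.
(* Every old component splits into its average over coordinate i and the remainder, which this
   average kills. *)
exists (fun X x => if i \in X then F (X :\ i) x - E (F (X :\ i)) x else E (F X) x).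
  move=> x; rewrite sum_subsetU1 // Fsum; apply: eq_bigr => X XJ.
  have iX : i \notin X by apply: contra iJ; apply: subsetP.
  by rewrite setU11 (negPf iX) setU1K // subrKC.
move=> j X x jJ XJ.
have XiJ : X :\ i \subset J by rewrite -(setU1K iJ) setSD.
have XJ' : i \notin X -> X \subset J.
  by move=> iX; rewrite -(setU1K iJ) subsetD1 XJ iX.
move: jJ; rewrite !inE => /predU1P[->|jJ].
  have [iX|iX] := boolP (i \in X).
    by rewrite avgB avg_idem // subrr.
  exact: avg_idem.
have ji : j != i by apply: contraNneq iJ => <-.
have [iX|iX] := boolP (i \in X).
  rewrite avgB /E (avg_comm _ _ (F _)) Feig //.
  rewrite (@eq_avg _ _ (fun y => if j \in X then 0 else F (X :\ i) y)); last first.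
    by move=> y; rewrite Feig // !inE ji.
  rewrite !inE ji /=; case: (j \in X) => //.
  by rewrite /avg big1 ?mulr0 ?subrr.
rewrite /E avg_comm (@eq_avg _ _ (fun y => if j \in X then 0 else F X y)); last first.
  by move=> y; rewrite Feig // XJ'.
case: (j \in X) => //.
by rewrite /avg big1 ?mulr0.
Qed.

(** A coordinate in one of X, Y but not the other gives a self-adjoint average with eigenvalue 0 on
    one component and 1 on the other. *)
Lemma eigen_orthogonal J F X Y : eigenfamily J F -> X \subset J -> Y \subset J ->
  X != Y -> \sum_x F X x * F Y x = 0.
Proof.
move=> Feig; wlog [i iX iY] : X Y / exists2 i, i \in X & i \notin Y.
  move=> H XJ YJ XY; have [XsY|] := boolP (X \subset Y); last first.
    by case/subsetPn => i iX iY; apply: H => //; exists i.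
  have : ~~ (Y \subset X) by apply: contra XY => YsX; rewrite eqEsubset XsY.
  case/subsetPn => i iY iX; under eq_bigr do rewrite mulrC.
  by apply: H => //; [exists i|rewrite eq_sym].
move=> XJ YJ _; have iJ := subsetP XJ i iX.
transitivity (\sum_x F X x * avg (summand pi [set i]) (F Y) x).
  by apply: eq_bigr => x _; rewrite Feig // (negPf iY).
rewrite avg_adjoint; last exact: subgroup_summand.
by rewrite big1 // => x _; rewrite Feig // iX mul0r.
Qed.

Lemma eigen_norm J F (a : {set I} -> R) : eigenfamily J F ->
  \sum_x (\sum_(X : {set I} | X \subset J) a X * F X x) ^+ 2 =
  \sum_(X : {set I} | X \subset J) a X ^+ 2 * \sum_x F X x ^+ 2.
Proof.
move=> Feig.
under eq_bigr => x _ do (rewrite expr2 mulr_suml;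
  under eq_bigr => X _ do rewrite mulr_sumr).
rewrite exchange_big /=; apply: eq_bigr => X XJ.
rewrite exchange_big /= (bigD1 X) //= [X in _ + X]big1 ?addr0; last first.
  move=> Y /andP[YJ YX].
  transitivity (a X * a Y * \sum_x F X x * F Y x).
    by rewrite mulr_sumr; apply: eq_bigr => x _; ring.
  by rewrite (eigen_orthogonal Feig) ?mulr0 // eq_sym.
by rewrite mulr_sumr; apply: eq_bigr => x _; ring.
Qed.

Variables (D : {set I}) (n : nat).
Hypothesis card_summand1 : forall i, i \in D -> #|summand pi [set i]| = n.

(** Coordinate by coordinate: the sum over nonzero a in the i-th summand is n times the average
    minus the term at 0, hence -1 or n - 1 times the function. *)
Lemma sum_level_eigen F X J x : (0 < n)%N -> eigenfamily D F -> X \subset D ->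
  J \subset D -> \sum_(h in level pi J) F X (x + h) =
  (\prod_(i in J) (if i \in X then -1 else n.-1%:R)) * F X x.
Proof.
move=> n0 Feig XD; elim/(@finset_ind I): J x => [|J i iJ IH] x.
  rewrite big_set0 mul1r (_ : level pi set0 = [set 0]) ?big_set1 ?addr0 //.
  by apply/setP => h; rewrite !inE supp_eq0.
rewrite subUset sub1set => /andP[iD JD].
rewrite sum_level1 // big_setU1 //= -mulrA -IH // mulr_sumr.
apply: eq_bigr => b _; have := Feig i X (x + b) iD XD.
rewrite /avg card_summand1 // (bigD1 0) /=; last by rewrite !inE supp0 // sub0set.
have nn : n%:R != 0 :> R by rewrite pnatr_eq0 -lt0n.
move=> /(canRL (mulKf _)) => /(_ (invr_neq0 nn)); rewrite addr0 invrK.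
under eq_bigr do rewrite -addrA.
move/(canRL (addKr _)) => ->.
by rewrite -subn1 natrB //; case: ifP => _; ring.
Qed.

(** Both sides are the r-th elementary symmetric polynomial of the values c on X and 1 off X. *)
Lemma sum_prod_kraw (c : R) X J r : \sum_(L : {set I} | (L \subset J) && (#|L| == r))
    \prod_(i in L) (if i \in X then c else 1) =
  kraw c #|J :&: X| #|J :\: X| r.
Proof.
elim/(@finset_ind I): J r => [|J i iJ IH] r.
  rewrite set0I set0D cards0 kraw0n bin0n.
  rewrite (eq_bigl (fun L : {set I} => (L == set0) && (0%N == r))); last first.
    by move=> L; rewrite subset0; case: eqP => // ->; rewrite cards0.
  rewrite eq_sym; case: eqP => _ /=; last by rewrite big1 // => L; rewrite andbF.
  by under eq_bigl do rewrite andbT; rewrite big_pred1_eq big_set0.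
rewrite big_mkcondr /= sum_subsetU1 // big_split /= -big_mkcondr /= IH.
have -> : \sum_(L : {set I} | L \subset J)
    (if #|i |: L| == r then \prod_(k in i |: L) (if k \in X then c else 1) else 0) =
    if r is r'.+1 then (if i \in X then c else 1) * kraw c #|J :&: X| #|J :\: X| r' else 0.
  case: r => [|r].
    by rewrite big1 // => L _; rewrite cards_eq0 setU_eq0 -cards_eq0 cards1.
  rewrite -IH mulr_sumr big_mkcondr /=; apply: eq_bigr => L LJ.
  have iL : i \notin L by apply: contra iJ; apply: subsetP.
  rewrite cardsU1 iL add1n eqSS; case: ifP => // _; by rewrite big_setU1.
have cI : #|(i |: J) :&: X| = ((i \in X) + #|J :&: X|)%N.
  rewrite setIUl; case: (boolP (i \in X)) => iX.
    rewrite (setIidPl _) ?sub1set // cardsU1 inE negb_and iJ /=; lia.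
  by rewrite (disjoint_setI0 _) ?disjoints1 // set0U.
have cD : #|(i |: J) :\: X| = ((i \notin X) + #|J :\: X|)%N.
  rewrite setDUl; case: (boolP (i \in X)) => iX /=.
    by rewrite (_ : [set i] :\: X = set0) ?set0U //; apply/eqP; rewrite setD_eq0 sub1set.
  rewrite (setDidPl _) ?disjoints1 // cardsU1 inE negb_and iJ orbT; lia.
rewrite cI cD; case: (i \in X); case: r => [|r]; rewrite /= ?add0n ?add1n ?kraw0 ?addr0 //.
  by rewrite krawSl.
by rewrite krawSr mul1r.
Qed.

(** Pulling n - 1 out of each of the r coordinates turns the factors -1 and n - 1 of
    [sum_level_eigen] into -1 / (n - 1) and 1. *)
Lemma sph_eigen F X r x : (1 < n)%N -> eigenfamily D F -> X \subset D ->
  sph pi D r (F X) x = nkraw (- n.-1%:R^-1) #|X| (#|D| - #|X|) r * F X x.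
Proof.
move=> n1 Feig XD; have XN := subset_leq_card XD.
have y0 : n.-1%:R != 0 :> R by rewrite pnatr_eq0; lia.
rewrite /sph /avg sum_hsphere // (card_hsphere pi_proj card_summand1).
have n0 : (0 < n)%N by lia.
under eq_bigr => L /andP[LD _] do rewrite sum_level_eigen //.
rewrite /nkraw.
have -> : kraw (- n.-1%:R^-1) #|X| (#|D| - #|X|) r =
   n.-1%:R ^- r * \sum_(L : {set I} | (L \subset D) && (#|L| == r))
     \prod_(i in L) (if i \in X then -1 else n.-1%:R) :> R.
  have {1}-> : #|X| = #|D :&: X| by rewrite (setIidPr XD).
  rewrite -cardsDS // -sum_prod_kraw mulr_sumr; apply: eq_bigr => L /andP[_ /eqP <-].
  rewrite -prodr_const -prodfV -big_split /=; apply: eq_bigr => i _.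
  by case: ifP => _; rewrite ?mulrN1 ?mulVf.
rewrite -mulr_suml mulrA; congr (_ * _).
rewrite subnKC // natrM natrX invfM; ring.
Qed.

End Anova.

(** * The l^2 estimate *)

Section BlockEstimate.
Variable R : realType.
Implicit Types c lam : R.

(** Raise 1 + lam <= 4 m * (1 + lam / (4 m)) <= 4 m * exp (lam / (4 m)) to the power m. *)
Lemma poly_expR_bound (m : nat) lam : (0 < m)%N -> 0 <= lam ->
  (1 + lam) ^+ m * expR (- (lam / 4)) <= (4 * m)%:R ^+ m.
Proof.
move=> m0 l0; have mR : 0 < (4 * m)%:R :> R by rewrite ltr0n; lia.
rewrite expRN ler_pdivrMr ?expR_gt0 //.
have -> : lam / 4 = m%:R * (lam / (4 * m)%:R).
  by rewrite natrM; field; rewrite pnatr_eq0; lia.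
rewrite expRM_natl -exprMn lerXn2r ?nnegrE ?addr_ge0 ?mulr_ge0 ?expR_ge0 ?ler0n //.
apply: (@le_trans _ _ ((4 * m)%:R * (1 + lam / (4 * m)%:R))).
  rewrite mulrDr mulr1 mulrCA mulfV ?gt_eqF // mulr1 lerD2r ler1n; lia.
by rewrite ler_wpM2l ?ler0n // expR_ge1Dx.
Qed.

(* [t / (1 + t)] increases by at least [t / (1 + t) ^ 2 / 2] from [t] to [2 t]. *)
Lemma sum_dyadic_le lam (M : nat) : 0 <= lam ->
  \sum_(m < M) (lam * 2 ^+ m) / (1 + lam * 2 ^+ m) ^+ 2 <= 2.
Proof.
move=> l0; set S := \sum_(_ < _) _.
have pos m : 0 <= lam * 2 ^+ m by rewrite mulr_ge0 // exprn_ge0.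
suff : S <= 2 * (lam * 2 ^+ M / (1 + lam * 2 ^+ M)).
  move/le_trans; apply; rewrite -[leRHS]mulr1 ler_wpM2l //.
  rewrite ler_pdivrMr ?mul1r ?lerDr //; have := pos M; lra.
rewrite /S; elim: M {S} => [|M IH]; first by rewrite big_ord0 mulr_ge0 // divr_ge0 // addr_ge0.
rewrite big_ord_recr /=; have := lerD IH (lexx (lam * 2 ^+ M / (1 + lam * 2 ^+ M) ^+ 2)).
move/le_trans; apply; have -> : lam * 2 ^+ M.+1 = lam * 2 ^+ M * 2 by rewrite exprSr mulrA.
have := pos M.
set t := lam * 2 ^+ M => t0.
have h1 : 0 < 1 + t by lra.
have h2 : 0 < 1 + t * 2 by lra.
rewrite -subr_ge0.
have -> : 2 * (t * 2 / (1 + t * 2)) - (2 * (t / (1 + t)) + t / (1 + t) ^+ 2) =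
   t / ((1 + t) ^+ 2 * (1 + t * 2)).
  by field; rewrite !gt_eqF.
by rewrite divr_ge0 // mulr_ge0 ?exprn_ge0 // ltW.
Qed.

(** If a < 2 k, the claimed decay is already absorbed by exp (k / 4). Otherwise a - k >= a / 2 and s
    >= Q / 2, and [nkraw_le] yields the exponent. *)
Lemma nkraw_decay c (a b k s Q : nat) : 0 <= c -> 2 * c <= 1 -> (0 < a + b)%N ->
  (Q <= a + b)%N -> (Q <= 2 * s)%N -> (s <= (a - k) + b)%N ->
  `|nkraw (- c) (a - k) b s| <=
     expR (k%:R / 4) * expR (- (a%:R * Q%:R / (a + b)%:R / 8)).
Proof.
move=> c0 c1 N0 QN Qs sN.
have c01 : 0 <= c <= 1 by rewrite c0 /=; lra.
have [q0 q1] := norm_kraw (a - k) b s c0.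
apply: (@le_trans _ _ (nkraw c (a - k) b s)).
  by rewrite /nkraw normrM normfV [X in _ / X]ger0_norm // ler_wpM2r ?invr_ge0.
apply: le_trans (nkraw_le c01 sN) _.
set t := (a - k)%:R / _; have t0 : 0 <= t by rewrite divr_ge0.
have t1 : t <= 1.
  rewrite /t; have [->|N'] := posnP (a - k + b); first by rewrite invr0 mulr0.
  by rewrite ler_pdivrMr ?ltr0n // mul1r ler_nat leq_addr.
apply: (@le_trans _ _ (expR (s%:R * (- (t / 2))))).
  rewrite expRM_natl lerXn2r ?nnegrE ?expR_ge0 //; first by nra.
  by apply: le_trans (expR_ge1Dx _); nra.
rewrite -expRD ler_expR.
have NR : 0 < (a + b)%:R :> R by rewrite ltr0n.
have [ak|ka] := ltnP a (2 * k).
  have : a%:R * Q%:R / (a + b)%:R <= 2 * k%:R :> R.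
    rewrite ler_pdivrMr // ler_pM // ?ler_nat //.
    by rewrite -natrM ler_nat ltnW.
  have : 0 <= s%:R * t by rewrite mulr_ge0.
  lra.
have h : a%:R * Q%:R / (a + b)%:R <= 4 * (s%:R * t).
  have aR : a%:R <= 2 * (a - k)%:R :> R by rewrite -natrM ler_nat; lia.
  have QR : Q%:R <= 2 * s%:R :> R by rewrite -natrM ler_nat.
  apply: (@le_trans _ _ (a%:R * Q%:R / (a - k + b)%:R)).
    have [e|a0] := posnP a; first by rewrite e !mul0r.
    rewrite ler_wpM2l ?mulr_ge0 // lef_pV2 ?posrE ?ltr0n ?ler_nat //; clear - a0 ka N0; lia.
  rewrite /t; have -> : 4 * (s%:R * ((a - k)%:R / (a - k + b)%:R)) =
     (2 * (a - k)%:R) * (2 * s%:R) / (a - k + b)%:R :> R by ring.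
  by rewrite ler_wpM2r ?invr_ge0 // ler_pM.
have : 0 <= k%:R :> R by [].
lra.
Qed.

(** The exponential comes from [nkraw_decay] with k <= K + 1, the power from [poly_expR_bound] with
    m = 2 K + 3, and 8 from 2 + 8 lam ^ 2 <= 8 (1 + lam) ^ 2. *)
Definition l2_const K : R :=
  8 * expR (K.+1%:R / 4) ^+ 2 * (4 * (2 * K + 3))%:R ^+ (2 * K + 3).

(** The block is the range of radii from Q = 2 ^ m to 2 Q. Each detrending gains 2 ^ -j * lam and
    the final differencing gains 2 lam / Q; exponential decay in lam absorbs the powers of lam up to
    a quantity summable over m. *)
Lemma detrend_block c (a b K j m w Q : nat) (V : nat -> R) lam :
  0 <= c -> 2 * c <= 1 -> (0 < K)%N ->
  w = (2 ^ m %/ (K * 2 ^ j.+1))%N -> (0 < w)%N ->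
  V = iter K (detrend w) (nkraw (- c) a b) -> Q = (2 ^ m)%N ->
  lam = a%:R / (a + b)%:R * 2 ^+ m -> (Q <= a + b)%N ->
  2 * V Q ^+ 2 + 2 * Q%:R * \sum_(s < Q | (Q + s < a + b)%N) (V (Q + s).+1 - V (Q + s)%N) ^+ 2
    <= l2_const K * (2^-1 ^+ j) ^+ (2 * K) * (lam / (1 + lam) ^+ 2).
Proof.
move=> c0 c1 K0 wE w0 VE QE lamD QN.
have Q0 : (0 < Q)%N by rewrite QE expn_gt0.
have N0 : (0 < a + b)%N by apply: leq_trans QN.
have lam0 : 0 <= lam by rewrite lamD mulr_ge0 ?divr_ge0 ?exprn_ge0.
have lamE : lam = a%:R * Q%:R / (a + b)%:R by rewrite lamD QE natrX; ring.
have wQ : (w * (K * 2 ^ j.+1) <= Q)%N by rewrite wE QE leq_trunc_div.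
have KwQ : (2 * (K * w) <= Q)%N.
  apply: leq_trans wQ; rewrite expnS; have : (0 < 2 ^ j)%N by rewrite expn_gt0.
  by nia.
have KwQ' : (K * w <= Q)%N by clear - KwQ; lia.
have cN : `|- c - 1| <= 2 by rewrite -opprD normrN ger0_norm; lra.
set t : R := a%:R / (a + b)%:R in lamD.
have t0 : 0 <= t by rewrite divr_ge0.
have tE : t = a%:R / (a + b)%:R by [].
clearbody t.
pose e : R := 2^-1 ^+ j.
have e0 : 0 <= e by rewrite exprn_ge0 // invr_ge0.
have wt : 2 * w%:R * t <= e * lam.
  rewrite lamD mulrC [e * _]mulrCA ler_wpM2l //.
  have h : (2 * w)%:R * 2 ^+ j <= 2 ^+ m :> R.
    rewrite -!natrX -natrM ler_nat -QE; apply: leq_trans wQ.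
    by rewrite expnS; nia.
  rewrite /e exprVn [leRHS]mulrC ler_pdivlMr ?exprn_gt0 // -natrM //.
have lamtQ : lam = t * Q%:R by rewrite lamD QE natrX.
clear wE wQ QE.
have wR0 : 0 <= 2 * w%:R :> R by rewrite mulr_ge0.
have wt0 : 0 <= 2 * w%:R * t by rewrite (mulr_ge0 wR0 t0).
pose E : R := expR (K.+1%:R / 4).
pose X : R := expR (- (lam / 8)).
have E0 : 0 <= E by rewrite expR_ge0.
have X0 : 0 <= X by rewrite expR_ge0.
have EX0 : 0 <= E * X by rewrite (mulr_ge0 E0 X0).
have el0 : 0 <= e * lam by rewrite (mulr_ge0 e0 lam0).
have decay k s : (k <= K.+1)%N -> (Q <= 2 * s)%N -> (s <= (a - k) + b)%N ->
    `|nkraw (- c) (a - k) b s| <= E * X.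
  move=> kK Qs sN; apply: le_trans (nkraw_decay c0 c1 N0 QN Qs sN) _.
  rewrite -lamE ler_wpM2r // ler_expR ler_wpM2r ?invr_ge0 // ler_nat //.
have VQ : `|V Q| <= (e * lam) ^+ K * (E * X).
  rewrite VE.
  apply: le_trans (nkraw_detrend (B := E * X) cN w0 KwQ' QN _ _) _.
  - exact: EX0.
  - move=> s s1 s2; have Qs : (Q <= 2 * s)%N by clear - KwQ s1; lia.
    have [Ka|aK] := leqP K a.
      by apply: decay => //; clear - Ka QN s2; lia.
    (* Subtraction truncates at 0 here, so the decay bound is taken with k = a. *)
    have -> : (a - K = a - a)%N by clear - aK; lia.
    by apply: decay => //; clear - aK QN s2; lia.
  by rewrite -tE ler_wpM2r // lerXn2r ?nnegrE.
(* The difference commutes with the detrendings, and [nkrawB] turns it into a factor of size at most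
   2 t with a lowered by one. *)
have dV s : (Q + s < a + b)%N ->
    `|V (Q + s).+1 - V (Q + s)%N| <= 2 * t * ((e * lam) ^+ K * (E * X)).
  move=> sN; rewrite VE iter_detrend_diff; last by clear - KwQ'; lia.
  have KwQs : (K * w <= Q + s)%N by clear - KwQ'; lia.
  have -> : iter K (detrend w) (fun s => nkraw (- c) a b s.+1 - nkraw (- c) a b s) (Q + s) =
     ((- c - 1) * t) * iter K (detrend w) (nkraw (- c) a.-1 b) (Q + s).
    rewrite (@iter_detrend_local _ w K _ (fun s => \sum_(u <- [:: tt]) ((- c - 1) * t) *
       nkraw (- c) a.-1 b s)); last first.
      by move=> s' s's; rewrite big_seq1 tE nkrawB //; clear - sN s's; lia.
    by rewrite iter_detrend_sum big_seq1.
  rewrite !normrM (ger0_norm t0).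
  have [a0|a0] := posnP a.
    by rewrite tE a0 mul0r !mulr0 !mul0r.
  rewrite ler_pM ?mulr_ge0 // ?ler_wpM2r //.
  have sN' : (Q + s <= a.-1 + b)%N by clear - sN a0; lia.
  apply: le_trans (nkraw_detrend (B := E * X) cN w0 KwQs sN' _ _) _.
  - exact: EX0.
  - move=> s' s1 s2; have Qs : (Q <= 2 * s')%N by clear - KwQ s1; lia.
    have -> : (a.-1 - K = a - K.+1)%N by clear; lia.
    have [Ka|aK] := leqP K.+1 a.
      by apply: decay => //; clear - Ka sN s2; lia.
    have -> : (a - K.+1 = a - a)%N by clear - aK; lia.
    by apply: decay => //; clear - aK sN s2; lia.
  rewrite ler_wpM2r // lerXn2r ?nnegrE //.
    by rewrite (mulr_ge0 wR0) // divr_ge0.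
  apply: le_trans wt; rewrite ler_wpM2l // tE.
  have [->|N1] := posnP (a.-1 + b); first by rewrite invr0 mulr0 divr_ge0.
  rewrite ler_pdivrMr ?ltr0n // mulrAC ler_pdivlMr ?ltr0n // -!natrM ler_nat; clear - a0 N0; nia.
set Y := (e * lam) ^+ K * (E * X) in VQ dV.
have Y0 : 0 <= Y by rewrite mulr_ge0 // exprn_ge0.
have YE : Y = (e * lam) ^+ K * (E * X) by [].
clearbody Y.
have sqle (x y : R) : `|x| <= y -> x ^+ 2 <= y ^+ 2.
  move=> xy; rewrite -[x ^+ 2]real_normK ?num_real // lerXn2r ?nnegrE //.
  exact: le_trans xy.
apply: (@le_trans _ _ (2 * Y ^+ 2 + 2 * Q%:R * (Q%:R * (2 * t * Y) ^+ 2))).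
  apply: lerD; first by rewrite ler_wpM2l // sqle.
  rewrite ler_wpM2l ?mulr_ge0 //.
  apply: (@le_trans _ _ (\sum_(s < Q) (2 * t * Y) ^+ 2)); last first.
    by rewrite sumr_constM card_ord.
  rewrite big_mkcond; apply: ler_sum => s _; case: ifP => [h|_].
    by rewrite sqle // dV.
  by rewrite sqr_ge0.
have -> : 2 * Y ^+ 2 + 2 * Q%:R * (Q%:R * (2 * t * Y) ^+ 2) = (2 + 8 * lam ^+ 2) * Y ^+ 2.
  by rewrite lamtQ; ring.
have -> : Y ^+ 2 = e ^+ (2 * K) * (E ^+ 2 * (lam ^+ (2 * K) * expR (- (lam / 4)))).
  rewrite YE !exprMn -!exprM [(K * 2)%N]mulnC.
  have -> : X ^+ 2 = expR (- (lam / 4)).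
    by rewrite /X -expRM_natl; congr expR; field.
  ring.
(* One factor lam is kept for small lam. The other powers are bounded by 2 + (2 K - 1) + 2 = 2 K + 3
   factors 1 + lam. *)
have key : (2 + 8 * lam ^+ 2) * (lam ^+ (2 * K) * expR (- (lam / 4))) <=
   8 * (4 * (2 * K + 3))%:R ^+ (2 * K + 3) * (lam / (1 + lam) ^+ 2).
  have l1 : 0 < 1 + lam by lra.
  rewrite mulrA [leRHS]mulrA ler_pdivlMr ?exprn_gt0 //.
  have h := @poly_expR_bound (2 * K + 3) lam; rewrite addn3 /= in h.
  have {}h := h isT lam0.
  rewrite addn3.
  have h1 : 2 + 8 * lam ^+ 2 <= 8 * (1 + lam) ^+ 2 by nra.
  have h2 : lam ^+ (2 * K) <= lam * (1 + lam) ^+ (2 * K).-1.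
    rewrite -{1}(@prednK (2 * K)) ?muln_gt0 // exprS ler_wpM2l // lerXn2r ?nnegrE ?(ltW l1) //.
    by rewrite lerDr.
  apply: (@le_trans _ _ ((8 * (1 + lam) ^+ 2) * (lam * (1 + lam) ^+ (2 * K).-1) *
    expR (- (lam / 4)) * (1 + lam) ^+ 2)).
    apply: ler_wpM2r; first by rewrite exprn_ge0 // ltW.
    apply: ler_wpM2r; first exact: expR_ge0.
    apply: ler_pM => //; last exact: exprn_ge0.
    by rewrite addr_ge0 // mulr_ge0 ?exprn_ge0.
  have -> : 8 * (1 + lam) ^+ 2 * (lam * (1 + lam) ^+ (2 * K).-1) * expR (- (lam / 4)) * (1 + lam) ^+ 2
     = 8 * lam * ((1 + lam) ^+ (2 + (2 * K).-1 + 2) * expR (- (lam / 4))).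
    by rewrite !exprD; ring.
  have -> : (2 + (2 * K).-1 + 2 = (2 * K).+3)%N by clear - K0; lia.
  apply: le_trans (ler_wpM2l _ h) _; first by rewrite mulr_ge0.
  by rewrite le_eqVlt; apply/orP; left; apply/eqP; ring.
rewrite /l2_const -/E.
have := ler_wpM2l (mulr_ge0 (exprn_ge0 (2 * K) e0) (exprn_ge0 2 E0)) key.
have -> : e ^+ (2 * K) * E ^+ 2 * ((2 + 8 * lam ^+ 2) * (lam ^+ (2 * K) * expR (- (lam / 4)))) =
  (2 + 8 * lam ^+ 2) * (e ^+ (2 * K) * (E ^+ 2 * (lam ^+ (2 * K) * expR (- (lam / 4))))) by ring.
move/le_trans; apply; rewrite -/e.
by rewrite le_eqVlt; apply/orP; left; apply/eqP; ring.
Qed.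

End BlockEstimate.

(** * The l^2 maximal inequality, summed over dyadic blocks *)

Section L2Maximal.
Variables (R : realType) (A : finZmodType) (I : finType) (pi : I -> A -> A).
Hypothesis pi_proj : projections pi.
Variables (D : {set I}) (n : nat).
Hypothesis card_summand1 : forall i, i \in D -> #|summand pi [set i]| = n.
Implicit Types f : A -> R.

Lemma sqr_sum_le (k : nat) (d : nat -> R) :
  (\sum_(s < k) d s) ^+ 2 <= k%:R * \sum_(s < k) d s ^+ 2.
Proof.
rewrite expr2 mulr_suml.
apply: (@le_trans _ _ (\sum_(i < k) \sum_(s < k) 2^-1 * (d i ^+ 2 + d s ^+ 2))).
  apply: ler_sum => i _; rewrite mulr_sumr; apply: ler_sum => s _.
  have := sqr_ge0 (d i - d s); rewrite sqrrB; lra.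
under eq_bigr do rewrite -mulr_sumr big_split /= sumr_constM card_ord.
rewrite -mulr_sumr big_split /= sumr_constM card_ord -mulr_sumr.
by rewrite le_eqVlt; apply/orP; left; apply/eqP; field.
Qed.

(** Constant on dyadic blocks of radii, so that differences inside a block commute with the
    detrending. If the quotient is 0 the window is 1, and detrending leaves nothing. *)
Definition window K j r := maxn 1 (2 ^ trunc_log 2 r %/ (K * 2 ^ j.+1)).

(** [G] sums one majorant per block, a discrete Sobolev norm in the radius. Hoeffding's
    decomposition reduces its l^2 bound to [detrend_block] for each set X of coordinates, and
    [sum_dyadic_le] sums over the blocks. *)
Lemma l2_maximal K j f : (2 < n)%N -> (0 < K)%N ->
  exists G : A -> R, [/\ forall x, 0 <= G x,
    (forall x r, (0 < r <= #|D|)%N ->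
       iter K (detrend (window K j r)) (fun s => sph pi D s f x) r ^+ 2 <= G x) &
    \sum_x G x <= 2 * l2_const R K * (2^-1 ^+ j) ^+ (2 * K) * \sum_x f x ^+ 2].
Proof.
move=> n2 K0; set N := #|D|; have [F Fsum Feig] := anova pi_proj D f.
pose wm m := (2 ^ m %/ (K * 2 ^ j.+1))%N.
pose c : R := n.-1%:R^-1.
have y2 : 2 <= n.-1%:R :> R by rewrite ler_nat; lia.
have y0 : 0 < n.-1%:R :> R by lra.
have c0 : 0 <= c by rewrite invr_ge0 ltW.
have c1 : 2 * c <= 1 by rewrite ler_pdivrMr // mul1r.
pose v m s x := iter K (detrend (wm m)) (fun s => sph pi D s f x) s.
pose V m (X : {set I}) s := iter K (detrend (wm m)) (nkraw (- c) #|X| (N - #|X|)) s.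
have vE m s x : v m s x = \sum_(X : {set I} | X \subset D) V m X s * F X x.
  rewrite /v (@iter_detrend_local _ _ _ _ (fun s => \sum_(X : {set I} | X \subset D)
     F X x * nkraw (- c) #|X| (N - #|X|) s)); last first.
    move=> s' _; rewrite /sph (@eq_avg _ _ _ _ (fun y => \sum_(X : {set I} | X \subset D) F X y)) //.
    rewrite avg_sum; apply: eq_bigr => X XD.
    have := sph_eigen pi_proj card_summand1 s' x _ Feig XD; rewrite /sph => ->; last lia.
    by rewrite mulrC.
  by rewrite iter_detrend_sum; apply: eq_bigr => X _; rewrite mulrC.
(* From (a + b) ^ 2 <= 2 a ^ 2 + 2 b ^ 2, with a the value at the start of the block and b a sum of
   at most 2 ^ m differences, bounded by Cauchy-Schwarz. *)
pose Gm m x : R := 2 * v m (2 ^ m)%N x ^+ 2 + 2 * (2 ^ m)%:R *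
   \sum_(s < 2 ^ m | (2 ^ m + s < N)%N) (v m (2 ^ m + s).+1 x - v m (2 ^ m + s)%N x) ^+ 2.
have Gm0 m x : 0 <= Gm m x.
  apply: addr_ge0; first by rewrite (mulr_ge0 _ (sqr_ge0 _)).
  by apply: mulr_ge0; [rewrite mulr_ge0|]; rewrite ?sumr_ge0 // => s _; apply: sqr_ge0.

(* The other blocks contain no admissible radius or have window 1, where the detrended sequence
   vanishes. *)
pose ok m := (2 ^ m <= N)%N && (0 < wm m)%N.
exists (fun x => \sum_(m < N | ok m) Gm m x); split.
- by move=> x; apply: sumr_ge0.
- move=> x r /andP[r0 rN]; set m := trunc_log 2 r.
  have mr : (2 ^ m <= r)%N by apply: trunc_logP.
  have rm : (r < 2 ^ m.+1)%N by apply: trunc_log_ltn.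
  have [w0|w0] := posnP (wm m).
    have -> : window K j r = 1%N by rewrite /window -/m -/(wm m) w0.
    rewrite -(prednK K0) /= detrend1 expr0n /=; exact: sumr_ge0.
  have -> : window K j r = wm m by rewrite /window -/m -/(wm m); apply/maxn_idPr.
  have mN : (m < N)%N by apply: leq_trans rN; apply: leq_trans mr; apply: ltn_expl.
  apply: (@le_trans _ _ (Gm m x)); last first.
    rewrite (bigD1 (Ordinal mN)) /=; last by rewrite /ok w0 (leq_trans mr).
    by rewrite lerDl sumr_ge0.
  rewrite -/(v m r x) /Gm.
  pose d s := v m (2 ^ m + s).+1 x - v m (2 ^ m + s)%N x.
  have -> : v m r x = v m (2 ^ m)%N x + \sum_(s < r - 2 ^ m) d s.
    have : (r = 2 ^ m + (r - 2 ^ m))%N by lia.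
    move: (r - 2 ^ m)%N => k ->; elim: k => [|k IH]; first by rewrite big_ord0 addr0 addn0.
    by rewrite big_ord_recr /= addrA -IH /d addnS subrKC.
  have h := sqr_sum_le (r - 2 ^ m) d.
  have h2 : (r - 2 ^ m)%:R * \sum_(s < r - 2 ^ m) d s ^+ 2 <=
      (2 ^ m)%:R * \sum_(s < 2 ^ m | (2 ^ m + s < N)%N) d s ^+ 2.
    rewrite ler_pM ?ler0n ?sumr_ge0 //; last 2 first.
    - by rewrite ler_nat; rewrite expnS in rm; lia.
    - rewrite -(big_mkord xpredT (fun s => d s ^+ 2)).
      rewrite -(big_mkord (fun s => (2 ^ m + s < N)%N) (fun s => d s ^+ 2)).
      rewrite [leRHS](big_cat_nat (n := r - 2 ^ m)) //=; last by rewrite expnS in rm; lia.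
      rewrite -[leLHS]addr0; apply: lerD; last by apply: sumr_ge0 => s _; rewrite sqr_ge0.
      rewrite le_eqVlt; apply/orP; left; apply/eqP.
      rewrite big_nat_cond [RHS]big_nat_cond; apply: eq_bigl => s.
      by rewrite andbT; case: (boolP (0 <= s < r - 2 ^ m)%N) => //= sr; apply/esym; lia.
    by move=> s _; rewrite sqr_ge0.
  rewrite -mulrA; have := le_trans h h2.
  rewrite -/(d _); set a := v _ _ _; set b := \sum_(s < _) d s.
  set e := _ * _ => be; have := sqr_ge0 (a - b); rewrite sqrrB sqrrD; lra.
have GmE m : \sum_x Gm m x = \sum_(X : {set I} | X \subset D)
   (2 * V m X (2 ^ m)%N ^+ 2 + 2 * (2 ^ m)%:R * \sum_(s < 2 ^ m | (2 ^ m + s < N)%N)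
     (V m X (2 ^ m + s).+1 - V m X (2 ^ m + s)%N) ^+ 2) * \sum_x F X x ^+ 2.
  rewrite /Gm big_split /= -!mulr_sumr.
  under [X in 2 * X + _]eq_bigr do rewrite vE.
  rewrite (eigen_norm pi_proj (fun X => V m X (2 ^ m)%N) Feig) exchange_big /=.
  under [X in _ + _ * X]eq_bigr => s _.
    under eq_bigr => x _ do rewrite !vE -sumrB.
    rewrite (eq_bigr (fun x => (\sum_(X : {set I} | X \subset D)
       (V m X (2 ^ m + s).+1 - V m X (2 ^ m + s)%N) * F X x) ^+ 2)); last first.
      by move=> x _; congr (_ ^+ 2); apply: eq_bigr => X _; rewrite mulrBl.
    rewrite (eigen_norm pi_proj (fun X => V m X (2 ^ m + s).+1 - V m X (2 ^ m + s)%N) Feig).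
    over.
  rewrite exchange_big /= !mulr_sumr -big_split /=; apply: eq_bigr => X _.
  by rewrite -mulr_suml !mulrA -mulrDl.
rewrite exchange_big /=.
under eq_bigr do rewrite GmE.
have fE : \sum_x f x ^+ 2 = \sum_(X : {set I} | X \subset D) \sum_x F X x ^+ 2.
  transitivity (\sum_x (\sum_(X : {set I} | X \subset D) 1 * F X x) ^+ 2).
    by apply: eq_bigr => x _; rewrite Fsum; congr (_ ^+ 2); apply: eq_bigr => X _; rewrite mul1r.
  by rewrite (eigen_norm pi_proj (fun=> 1) Feig); apply: eq_bigr => X _; rewrite expr1n mul1r.
rewrite fE exchange_big /= mulr_sumr; apply: ler_sum => X XD.
rewrite -mulr_suml ler_wpM2r ?sumr_ge0 // => [x _|]; first by rewrite sqr_ge0.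
have XN : (#|X| <= N)%N by apply: subset_leq_card.
pose lam m : R := #|X|%:R / N%:R * 2 ^+ m.
have Cpos : 0 <= l2_const R K * (2^-1 ^+ j) ^+ (2 * K).
  by rewrite /l2_const !mulr_ge0 ?exprn_ge0 ?expR_ge0 ?invr_ge0 ?ler0n.
apply: (@le_trans _ _ (\sum_(m < N) l2_const R K * (2^-1 ^+ j) ^+ (2 * K) *
    (lam m / (1 + lam m) ^+ 2))).
  rewrite [leLHS]big_mkcond; apply: ler_sum => m _; case: ifP => [/andP[mN w0]|_].
    have NE : (#|X| + (N - #|X|) = N)%N by lia.
    have := @detrend_block R c #|X| (N - #|X|) K j m (wm m) (2 ^ m) (V m X) (lam m)
      c0 c1 K0 erefl w0 erefl erefl.
    by rewrite NE; apply.
  have l0 : 0 <= lam m by rewrite /lam mulr_ge0 ?divr_ge0 ?exprn_ge0.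
  by rewrite mulr_ge0 // divr_ge0 // exprn_ge0 // addr_ge0.
rewrite -mulr_sumr mulrC -!mulrA [leRHS]mulrA.
have := @sum_dyadic_le R (#|X|%:R / N%:R) N; rewrite divr_ge0 // => /(_ isT) h.
have := ler_wpM2r Cpos h; rewrite -!mulrA; apply.
Qed.

End L2Maximal.

(** * From l^2 to l^p *)

Section Restricted.
Variable R : realType.

Lemma exists_level (t y : R) (k : nat) : 0 <= t -> y <= 1 -> t ^+ k.+1 < y ->
  exists2 j : nat, (j <= k)%N & t ^+ j.+1 < y <= t ^+ j.
Proof.
move=> t0 y1 ky; have ex : exists j, t ^+ j.+1 < y by exists k.
have [j jy jmin] := ex_minnP ex.
exists j; first exact: jmin.
rewrite jy /=; case: j jy jmin => [|j] jy jmin; first by rewrite expr0.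
by rewrite leNgt; apply/negP => /jmin; rewrite ltnn.
Qed.

Definition indic (A : finType) (E : {set A}) (x : A) : R := (x \in E)%:R.

Lemma sum_indic_powR (A : finType) (E : {set A}) q : q != 0 ->
  \sum_x indic E x `^ q = #|E|%:R.
Proof.
move=> q0; rewrite -sum1_card natr_sum [RHS]big_mkcond /=; apply: eq_bigr => x _.
by rewrite /indic; case: (x \in E); rewrite ?powR1 ?powR0.
Qed.

Lemma sum_indic (A : finType) (E : {set A}) : \sum_x indic E x = #|E|%:R.
Proof.
rewrite -sum1_card natr_sum [RHS]big_mkcond /=; apply: eq_bigr => x _.
by rewrite /indic; case: (x \in E).
Qed.

Lemma sum_half_le (M : nat) : \sum_(j < M) 2^-1 ^+ j.+1 <= 1 :> R.
Proof.
suff -> : \sum_(j < M) 2^-1 ^+ j.+1 = 1 - 2^-1 ^+ M :> R.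
  by rewrite gerBl exprn_ge0 // invr_ge0.
elim: M => [|M IH]; first by rewrite big_ord0 expr0 subrr.
by rewrite big_ord_recr /= IH exprS; field.
Qed.

Lemma sum_indic_sqr (A : finType) (E : {set A}) : \sum_x indic E x ^+ 2 = #|E|%:R.
Proof.
rewrite -sum1_card natr_sum [RHS]big_mkcond /=; apply: eq_bigr => x _.
by rewrite /indic; case: (x \in E); rewrite ?expr1n ?expr0n.
Qed.

(** With Q the power of 2 below r and q the quotient in [window]: r < 2 Q, Q < (q + 1) * K * 2 ^ (j
    + 1) and q + 1 <= 2 * [window K j r]. *)
Lemma window_ratio K j r : (0 < K)%N -> (0 < r)%N ->
  (r <= 8 * K * 2 ^ j * window K j r)%N.
Proof.
move=> K0 r0; rewrite /window; set m := trunc_log 2 r.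
have rm : (r < 2 ^ m.+1)%N by apply: trunc_log_ltn.
have d0 : (0 < K * 2 ^ j.+1)%N by rewrite muln_gt0 K0 expn_gt0.
have := ltn_ceil (2 ^ m) d0; set w := (_ %/ _)%N; clearbody w; rewrite expnS in rm.
rewrite expnS; move: (2 ^ m)%N (2 ^ j)%N rm => a b rm h; apply: ltnW; apply: leq_trans rm _.
have h2 : (w.+1 <= 2 * maxn 1 w)%N by clear; lia.
apply: (@leq_trans (2 * (w.+1 * (K * (2 * b))))); first by rewrite leq_mul2l /= ltnW.
apply: (@leq_trans (2 * ((2 * maxn 1 w) * (K * (2 * b))))).
  by rewrite leq_mul2l /= leq_mul2r h2 orbT.
by rewrite leq_eqVlt; apply/orP; left; apply/eqP; ring.
Qed.

Lemma window_le K j r : (0 < K)%N -> (0 < r)%N ->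
  (K * window K j r <= r.+1)%N \/ window K j r = 1%N.
Proof.
move=> K0 r0; rewrite /window; set m := trunc_log 2 r.
have mr : (2 ^ m <= r)%N by apply: trunc_logP.
set w := (_ %/ _)%N; have [w1|w1] := leqP w 1; first by right.
left; apply: leqW; apply: leq_trans mr.
apply: leq_trans (leq_trunc_div (2 ^ m) (K * 2 ^ j.+1)).
by rewrite -/w mulnC leq_mul2l leq_pmulr ?expn_gt0 ?orbT.
Qed.

Section Fixed.
Variables (A : finZmodType) (I : finType) (pi : I -> A -> A).
Hypothesis pi_proj : projections pi.
Variables (D : {set I}) (n : nat).
Hypothesis card_summand1 : forall i, i \in D -> #|summand pi [set i]| = n.

Lemma avg_le1 (B : {set A}) (f : A -> R) x : (forall y, f y <= 1) -> avg B f x <= 1.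
Proof.
move=> f1; rewrite /avg; have [->|B0] := posnP #|B|; first by rewrite invr0 mul0r.
rewrite mulrC ler_pdivrMr ?ltr0n // mul1r -[leRHS]mulr1 -sumr_constM.
by apply: ler_sum.
Qed.

(** A positive lower bound on nonzero averages, which leaves finitely many levels j to treat. *)
Lemma avg_indic_gt0 (B E : {set A}) x : 0 < avg B (indic E) x ->
  #|A|%:R^-1 <= avg B (indic E) x.
Proof.
rewrite /avg; have [->|B0] := posnP #|B|; first by rewrite invr0 mul0r ltxx.
have A0 : (0 < #|A|)%N by apply: leq_trans B0 (max_card _).
rewrite -natr_sum; set k := (\sum_(_ in _) _)%N; case: k => [|k]; first by rewrite mulr0 ltxx.
move=> _; apply: (@le_trans _ _ #|B|%:R^-1).
  by rewrite lef_pV2 ?posrE ?ltr0n // ler_nat max_card.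
by rewrite ler_peMr ?invr_ge0 // ler1n.
Qed.

Lemma sph0 (f : A -> R) x : sph pi D 0 f x = f x.
Proof.
rewrite /sph /avg (_ : hsphere pi D 0 = [set 0]).
  by rewrite cards1 invr1 mul1r big_set1 addr0.
apply/setP => h; rewrite !inE cards_eq0 supp_eq0 //.
by case: eqP => [->|]; rewrite ?andbF // supp0 // sub0set.
Qed.

(** 2 ^ K comes from [detrend_majorant] and 8 K from [window_ratio]. *)
Definition loss K : R := 2 ^+ K * (8 * K)%:R.
Definition restricted_const K (p0 : R) : R :=
  1 + (2 * loss K) `^ p0 * cesaro_const p0 + 16 * 2 ^+ K * l2_const R K.

(** For a value g of a spherical mean, take j with g between 2 ^ (-K (j + 1)) and 2 ^ (-K j), and
    split g into the part removed by detrending and the remainder v. [H] adds one majorant for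
    radius 0, one for the removed part, and one per level j for v. *)
Lemma restricted_maximal K (p0 : R) (E : {set A}) : (2 < n)%N -> (0 < K)%N ->
  p0 = 1 + K%:R^-1 ->
  exists H : A -> R, [/\ forall x, 0 <= H x,
    (forall x s, (s <= #|D|)%N -> sph pi D s (indic E) x `^ (p0 * p0) <= H x) &
    \sum_x H x <= restricted_const K p0 * #|E|%:R].
Proof.
move=> n2 K0 p0E; pose f := indic E.
have KR : 0 < K%:R :> R by rewrite ltr0n.
have p01 : 1 < p0 by rewrite p0E ltrDl invr_gt0.
have p00 : 0 < p0 by apply: lt_trans p01.
have f0 y : 0 <= f y by rewrite ler0n.
have f1 y : f y <= 1 by rewrite /f /indic; case: (y \in E).
have [U [U0 Uub Usum]] := cesaro_maximal pi_proj card_summand1 n2 p01 f0.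
have := @boolp.choice _ _ _ (fun j => @l2_maximal R A I pi pi_proj D n card_summand1 K j f n2 K0).
move=> [G Gprop].
have G0 j x : 0 <= G j x by have [] := Gprop j.
have L0 : 0 <= loss K by rewrite mulr_ge0 ?exprn_ge0.
have c0 j : 0 <= 4 * 2 ^+ (K * j.+1) :> R by rewrite mulr_ge0 ?exprn_ge0.
pose H x := f x + (2 * loss K * U x) `^ p0 + \sum_(j < #|A|.+1) 4 * 2 ^+ (K * j.+1) * G j x.
have S0 x : 0 <= \sum_(j < #|A|.+1) 4 * 2 ^+ (K * j.+1) * G j x.
  by apply: sumr_ge0 => j _; rewrite (mulr_ge0 (c0 j) (G0 j x)).
exists H; split.
- by move=> x; rewrite addr_ge0 // addr_ge0 // powR_ge0.
- move=> x [_|s sD].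
    rewrite sph0 -/f /H; apply: (@le_trans _ _ (f x)).
      by rewrite /f /indic; case: (x \in E); rewrite ?powR1 ?powR0 ?mulf_neq0 ?gt_eqF.
    by rewrite -addrA lerDl addr_ge0 // powR_ge0.
  set r := s.+1 in sD *; set g := sph pi D r f x.
  have g0 : 0 <= g by apply: avg_ge0.
  have g1 : g <= 1 by apply: avg_le1.
  have [ge0|gpos] := eqVneq g 0.
    by rewrite ge0 powR0 ?mulf_neq0 ?gt_eqF // addr_ge0 // addr_ge0 // powR_ge0.
  have {}gpos : 0 < g by rewrite lt_neqAle eq_sym gpos.
  pose t : R := 2^-1 ^+ K.
  have t0 : 0 <= t by rewrite exprn_ge0 // invr_ge0.
  have tg : t ^+ #|A|.+1 < g.
    apply: lt_le_trans (avg_indic_gt0 gpos).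
    have A0 : (0 < #|A|)%N by apply/card_gt0P; exists 0.
    rewrite /t -exprM exprVn ltf_pV2 ?posrE ?exprn_gt0 ?ltr0n //.
    rewrite -natrX ltr_nat; apply: leq_ltn_trans (ltn_expl (K * #|A|.+1) (ltnSn 1)).
    by apply: leq_trans (leqnSn _) _; rewrite leq_pmull.
  have [j jA /andP[gj1 gj2]] := exists_level t0 g1 tg.
  have [_ /(_ x r) Gub _] := Gprop j.
  have w0 : (0 < window K j r)%N by rewrite leq_max.
  set w := window K j r in w0 Gub.
  set v := iter K (detrend w) (fun s => sph pi D s f x) r in Gub.
  have gv : `|g - v| <= loss K * 2 ^+ j * U x.
    apply: le_trans (detrend_majorant (C := (8 * K * 2 ^ j)%:R * U x) _ w0 _ _) _.
    - by move=> s'; apply: avg_ge0.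
    - move=> s' s'r.
      apply: (@le_trans _ _ (w%:R^-1 * \sum_(i < r.+1) sph pi D i f x)).
        rewrite ler_wpM2l ?invr_ge0 //.
        rewrite -(big_mkord xpredT (fun i => sph pi D i f x)).
        rewrite -(big_mkord xpredT (fun i => sph pi D i f x)).
        rewrite [leRHS](big_cat_nat (n := s'.+1)) //= lerDl.
        by apply: sumr_ge0 => i _; apply: avg_ge0.
      apply: (@le_trans _ _ (w%:R^-1 * (r%:R * U x))).
        by rewrite ler_wpM2l ?invr_ge0 // Uub //.
      rewrite mulrA ler_wpM2r // mulrC ler_pdivrMr ?ltr0n // -natrM ler_nat.
      exact: window_ratio.
    - exact: window_le.
    by rewrite /loss natrM natrX !mulrA.
  have j1 : (j < #|A|.+1)%N by rewrite ltnS.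
  have gle : g <= loss K * 2 ^+ j * U x + `|v|.
    have : g <= `|g - v| + `|v| by rewrite -{1}(ger0_norm g0) -{1}(subrK v g) ler_normD.
    by move/le_trans; apply; rewrite lerD2r.
  (* If the removed part carries half of g, then g ^ (1 / K) <= 2 ^ -j cancels the loss 2 ^ j,
     whence g ^ p0 <= 2 * loss * U. Otherwise |v| >= g / 2 and the l^2 bound takes over. *)
  have [h|h] := leP (g / 2) (loss K * 2 ^+ j * U x).
    apply: (@le_trans _ _ ((2 * loss K * U x) `^ p0)); last first.
      by rewrite /H addrAC lerDr addr_ge0.
    rewrite powRrM; apply: powR_le2; rewrite ?powR_ge0 //; first exact: ltW.
    have gK : g `^ (K%:R^-1) <= 2^-1 ^+ j.
      have := @powR_le2 R (K%:R^-1) g (t ^+ j); rewrite invr_ge0 ler0n => /(_ isT g0 gj2).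
      move/le_trans; apply; rewrite /t exprAC -powR_mulrn ?exprn_ge0 ?invr_ge0 //.
      by rewrite -powRrM mulfV ?gt_eqF // powRr1 // exprn_ge0 // invr_ge0.
    rewrite p0E powRD ?(gt_eqF gpos) ?implybT // powRr1 //.
    apply: le_trans (ler_wpM2l g0 gK) _.
    rewrite exprVn ler_pdivrMr ?exprn_gt0 //.
    have -> : 2 * loss K * U x * 2 ^+ j = 2 * (loss K * 2 ^+ j * U x) by ring.
    lra.
  have v2 : g ^+ 2 <= 4 * v ^+ 2.
    have h' : g / 2 <= `|v| by lra.
    rewrite -(real_normK (num_real v)).
    have -> : g ^+ 2 = 4 * (g / 2) ^+ 2 by field.
    by rewrite ler_wpM2l // lerXn2r ?nnegrE // divr_ge0.
  (* As g <= 1, the power may be lowered to 1; then g = g ^ 2 / g with g > 2 ^ (-K (j + 1)) brings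
     in the square of v. *)
  apply: (@le_trans _ _ g).
    by apply: ge1r_powR; [rewrite gpos | rewrite mulr_ege1 // ltW].
  apply: (@le_trans _ _ (4 * 2 ^+ (K * j.+1) * G j x)); last first.
    rewrite /H (bigD1 (Ordinal j1)) //= addrCA lerDl addr_ge0 //.
      by rewrite addr_ge0 // powR_ge0.
    by apply: sumr_ge0 => i _; rewrite (mulr_ge0 (c0 i) (G0 i x)).
  apply: (@le_trans _ _ (4 * 2 ^+ (K * j.+1) * v ^+ 2)); last first.
    by rewrite ler_wpM2l //; apply: Gub; rewrite sD.
  rewrite mulrAC -ler_pdivrMr ?exprn_gt0 // -exprVn exprM.
  apply: le_trans v2; rewrite expr2 ler_wpM2l // ltW //.
rewrite /H !big_split /= /restricted_const [leRHS]mulrDl [X in _ <= X + _]mulrDl mul1r.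
apply: lerD; first apply: lerD.
- by rewrite -sum_indic.
- have L2 : 0 <= 2 * loss K by apply: mulr_ge0.
  under eq_bigr => x _ do rewrite (powRM _ L2 (U0 x)).
  rewrite -mulr_sumr -mulrA ler_wpM2l ?powR_ge0 //.
  by rewrite sum_indic_powR ?gt_eqF // in Usum.
rewrite exchange_big /=.
(* The gain 2 ^ (-2 K j) beats the factor 2 ^ (K (j + 1)) and leaves a geometric series, so the
   number of levels does not enter the constant. *)
apply: (@le_trans _ _ (\sum_(j < #|A|.+1) 2^-1 ^+ j.+1 * (16 * 2 ^+ K * l2_const R K * #|E|%:R))).
  apply: ler_sum => j _; rewrite -mulr_sumr.
  have [_ _] := Gprop j; rewrite sum_indic_sqr => h.
  apply: le_trans (ler_wpM2l (c0 j) h) _.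
  have l0 : 0 <= l2_const R K.
    by rewrite /l2_const !mulr_ge0 ?exprn_ge0 ?expR_ge0.
  have -> : 4 * 2 ^+ (K * j.+1) * (2 * l2_const R K * (2^-1 ^+ j) ^+ (2 * K) * #|E|%:R) =
    ((2 ^+ (K * j.+1)) * (2^-1 ^+ j) ^+ (2 * K)) * (8 * (l2_const R K * #|E|%:R)) by ring.
  have -> : 2^-1 ^+ j.+1 * (16 * 2 ^+ K * l2_const R K * #|E|%:R) =
    (2^-1 ^+ j * 2 ^+ K) * (8 * (l2_const R K * #|E|%:R)) by rewrite exprS; field.
  have c8 : 0 <= 8 * (l2_const R K * #|E|%:R) by rewrite mulr_ge0 // mulr_ge0.
  apply: ler_wpM2r => //; rewrite mulnS exprD -mulrA [leRHS]mulrC.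
  apply: ler_wpM2l; first exact: exprn_ge0.
  rewrite mulrC.
  have -> : (2^-1 ^+ j) ^+ (2 * K) * 2 ^+ (K * j) = 2^-1 ^+ (j * K) :> R.
    rewrite -exprM mulnCA mul2n -addnn exprD [(K * j)%N]mulnC -mulrA !exprVn mulVf ?mulr1 //.
    by rewrite expf_neq0 ?pnatr_eq0.
  by apply: ler_wiXn2l; rewrite ?invr_ge0 ?invf_le1 ?ler1n // leq_pmulr.
have l0 : 0 <= l2_const R K.
  by rewrite /l2_const !mulr_ge0 ?exprn_ge0 ?expR_ge0.
rewrite -mulr_suml -[leRHS]mul1r ler_wpM2r ?sum_half_le //.
by apply: mulr_ge0 => //; apply: mulr_ge0 => //; rewrite mulr_ge0 ?exprn_ge0.
Qed.

End Fixed.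
End Restricted.

(** * Interpolation over dyadic levels *)

Section Interpolation.
Variable R : realType.

(** Chosen so that its q-th power is 2 ^ -(p - q), the ratio at which (F * 2 ^ -k) ^ (p - q) decays
    in k. *)
Definition interp_ratio (p q : R) : R := 2^-1 `^ ((p - q) / q).
Definition interp_const (p q : R) : R :=
  4 `^ p / (1 - interp_ratio p q) `^ q.

Lemma sum_geom_le (r : R) (M : nat) : 0 <= r < 1 ->
  \sum_(k < M) r ^+ k <= (1 - r)^-1.
Proof.
move=> /andP[r0 r1]; have r1' : 0 < 1 - r by rewrite subr_gt0.
rewrite -[leRHS]mul1r ler_pdivlMr // mulrC -[leLHS]opprK -mulNr opprB -subrX1 opprB.
by rewrite gerBl exprn_ge0.
Qed.

(* Marcinkiewicz between l^q and l^oo, pointwise in [x] and with dyadic levels. *)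
Lemma interp_levels (p q a F : R) (B : nat) (b : nat -> R) :
  0 < q -> q < p -> 0 < F -> 0 <= a -> (forall k, 0 <= b k <= 1) ->
  a <= \sum_(k < B) F * 2^-1 ^+ k * b k ->
  a `^ p <= interp_const p q * \sum_(k < B) (F * 2^-1 ^+ k) `^ p * b k `^ q.
Proof.
move=> q0 qp F0 a0 b01 aS.
have p0 : 0 < p by apply: lt_trans qp.
have pq0 : 0 < p - q by rewrite subr_gt0.
set rho := interp_ratio p q.
have h0 : 0 < 2^-1 :> R by rewrite invr_gt0.
have rho0 : 0 < rho by rewrite powR_gt0.
have rho1 : rho < 1.
  have := @gt0_ltr_powR R ((p - q) / q) (divr_gt0 pq0 q0) 2^-1 1.
  by rewrite powR1 !nnegrE; apply; rewrite ?ltW // invf_lt1 // ltr1n.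
have c0 : 0 < 1 - rho by rewrite subr_gt0.
have C0 : 0 < interp_const p q by rewrite divr_gt0 ?powR_gt0.
have T0 k : 0 <= (F * 2^-1 ^+ k) `^ p * b k `^ q by rewrite mulr_ge0 ?powR_ge0.
have Fk k : 0 < F * 2^-1 ^+ k by rewrite mulr_gt0 ?exprn_gt0.
have [->|an] := eqVneq a 0.
  by rewrite powR0 ?gt_eqF // mulr_ge0 ?(ltW C0) // sumr_ge0.
have {an}apos : 0 < a by rewrite lt_neqAle eq_sym an.
have S2 (M : nat) : \sum_(k < M) F * 2^-1 ^+ k <= 2 * F.
  rewrite -mulr_sumr mulrC ler_wpM2r ?(ltW F0) //.
  apply: le_trans (sum_geom_le M _) _; first by rewrite ltW //= invf_lt1 // ltr1n.
  by rewrite le_eqVlt; apply/orP; left; apply/eqP; field.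
(* The level k1 has height comparable to a; the levels beyond it add up to at most a / 2, since b k
   <= 1. *)
have [k1 k1lo k1hi] : exists2 k1, F * 2^-1 ^+ k1 <= a / 2 & a / 4 <= F * 2^-1 ^+ k1.
  have ex : exists k, F * 2^-1 ^+ k <= a / 2.
    pose m := Num.bound (F / (a / 2)); exists m.
    have a2 : 0 < a / 2 by rewrite divr_gt0.
    rewrite exprVn ler_pdivrMr ?exprn_gt0 // mulrC -ler_pdivrMr //.
    apply: (@le_trans _ _ m%:R); first by rewrite ltW // archi_boundP // ltW // divr_gt0.
    by rewrite -natrX ler_nat ltnW // ltn_expl.
  have [k klo kmin] := ex_minnP ex; exists k => //.
  case: k klo kmin => [|k] klo kmin.
    rewrite expr0 mulr1.
    have : a <= 2 * F.
      apply: le_trans aS _; apply: le_trans (S2 B); apply: ler_sum => k _.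
      by have /andP[_ b1] := b01 k; rewrite ler_piMr // ltW.
    lra.
  have : a / 2 < F * 2^-1 ^+ k.
    by rewrite ltNge; apply/negP => /kmin; rewrite ltnn.
  rewrite exprS; lra.
(* Pigeonhole: the levels up to k1 carry the rest of a, so one of them has at least its share in a
   geometric distribution of a / 2 with ratio rho. This single term gives the bound. *)
have [k kk1 hk] : exists2 k : 'I_B, (k <= k1)%N &
     (1 - rho) * (a / 2) * rho ^+ (k1 - k) <= F * 2^-1 ^+ k * b k.
  apply: contrapT => nex.
  have lt k : (k < minn k1.+1 B)%N ->
      F * 2^-1 ^+ k * b k <= (1 - rho) * (a / 2) * rho ^+ (k1 - k).
    rewrite leq_min => /andP[kk1 kB]; rewrite leNgt; apply/negP => /ltW h.
    by apply: nex; exists (Ordinal kB).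
  have tail : \sum_(minn k1.+1 B <= k < B) F * 2^-1 ^+ k * b k <= a / 2.
    apply: le_trans k1lo.
    apply: (@le_trans _ _ (\sum_(minn k1.+1 B <= k < B) F * 2^-1 ^+ k)).
      apply: ler_sum => k _; have /andP[_ b1] := b01 k.
      by rewrite ler_piMr // (ltW (Fk k)).
    case: (leqP k1.+1 B) => [k1B|_]; last by rewrite big_geq // (ltW (Fk _)).
    rewrite -[X in \sum_(X <= _ < _) _]add0n big_addn big_mkord -mulr_sumr.
    rewrite ler_wpM2l ?(ltW F0) //.
    under eq_bigr do rewrite addnS -addSn exprD.
    by rewrite -mulr_suml ler_piMl ?exprn_ge0 ?(ltW h0) // sum_half_le.
  have head : \sum_(0 <= k < minn k1.+1 B) F * 2^-1 ^+ k * b k < a / 2.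
    apply: (@le_lt_trans _ _ (\sum_(0 <= k < k1.+1) (1 - rho) * (a / 2) * rho ^+ (k1 - k))).
      rewrite [leRHS](big_cat_nat (n := minn k1.+1 B)) //= ?geq_minl //.
      rewrite -[leLHS]addr0; apply: lerD.
        by apply: ler_sum_nat => k /andP[_ /lt].
      apply: sumr_ge0 => k _; apply: mulr_ge0; last by rewrite exprn_ge0 // ltW.
      by apply: mulr_ge0; rewrite ?(ltW c0) // divr_ge0 // ltW.
    rewrite -mulr_sumr big_nat_rev /= add0n big_mkord.
    have -> : \sum_(i < k1.+1) rho ^+ (k1 - (k1.+1 - i.+1)) = \sum_(i < k1.+1) rho ^+ i.
      by apply: eq_bigr => i _; rewrite subSS subKn // -ltnS.
    rewrite mulrAC -[X in X < _]mulrC.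
    have -> : (1 - rho) * (\sum_(i < k1.+1) rho ^+ i) = 1 - rho ^+ k1.+1.
      by rewrite -[RHS]opprB subrX1 -mulNr opprB.
    rewrite gtr_pMr; last by rewrite divr_gt0.
    by rewrite gtrBl exprn_gt0.
  have : \sum_(k < B) F * 2^-1 ^+ k * b k < a.
    rewrite -(big_mkord xpredT (fun k => F * 2^-1 ^+ k * b k)).
    rewrite (big_cat_nat (n := minn k1.+1 B)) //= ?geq_minr //.
    have := ltr_leD head tail; lra.
  by rewrite ltNge aS.
apply: (@le_trans _ _ (interp_const p q * ((F * 2^-1 ^+ k) `^ p * b k `^ q))); last first.
  by rewrite ler_wpM2l ?(ltW C0) // (bigD1 k) //= lerDl sumr_ge0.
rewrite /interp_const -/rho mulrAC ler_pdivlMr ?powR_gt0 // mulrC.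
have -> : (F * 2^-1 ^+ k) `^ p * b k `^ q =
    (F * 2^-1 ^+ k) `^ (p - q) * (F * 2^-1 ^+ k * b k) `^ q.
  have /andP[bk0 _] := b01 k.
  rewrite [X in _ = _ * X]powRM ?(ltW (Fk k)) // mulrA -powRD ?subrK //.
  by rewrite (gt_eqF p0).
have rhoq : (rho ^+ (k1 - k)) `^ q = (2^-1 ^+ (k1 - k)) `^ (p - q).
  rewrite !powR_exprn ?(ltW rho0) ?(ltW h0) //; congr (_ ^+ _).
  by rewrite /rho /interp_ratio -powRrM mulfVK // gt_eqF.
have a20 : 0 <= a / 2 by rewrite divr_ge0.
have h1 : ((1 - rho) * (a / 2) * rho ^+ (k1 - k)) `^ q <= (F * 2^-1 ^+ k * b k) `^ q.
  apply: powR_le2 => //; first exact: ltW.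
  by rewrite mulr_ge0 ?exprn_ge0 ?(ltW rho0) // mulr_ge0 // ltW.
have h2 : (a / 4) `^ (p - q) <= (F * 2^-1 ^+ k) `^ (p - q) * (2^-1 ^+ (k1 - k)) `^ (p - q).
  rewrite -powRM ?(ltW (Fk k)) ?exprn_ge0 ?(ltW h0) //.
  rewrite -mulrA -exprD subnKC //; apply: powR_le2 => //; first exact: ltW.
  by rewrite divr_ge0.
apply: (@le_trans _ _ (4 `^ p * ((F * 2^-1 ^+ k) `^ (p - q) *
    ((1 - rho) * (a / 2) * rho ^+ (k1 - k)) `^ q))); last first.
  by rewrite ler_wpM2l ?powR_ge0 // ler_wpM2l ?powR_ge0.
have cr : 0 <= (1 - rho) * (a / 2) by rewrite mulr_ge0 // ltW.
rewrite (powRM _ cr) ?exprn_ge0 ?(ltW rho0) // (powRM _ (ltW c0) a20) rhoq.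
apply: (@le_trans _ _ ((1 - rho) `^ q * (4 `^ p * ((a / 4) `^ (p - q) * (a / 4) `^ q)))).
  rewrite ler_wpM2l ?powR_ge0 // -powRD ?subrK ?(gt_eqF p0) // -powRM ?divr_ge0 //.
  by rewrite [4 * _]mulrC mulfVK ?pnatr_eq0.
have h3 : (a / 4) `^ q <= (a / 2) `^ q.
  by apply: powR_le2; [exact: ltW|rewrite divr_ge0|lra].
have h4 := ler_pM (powR_ge0 _ _) (powR_ge0 _ _) h2 h3.
rewrite mulrCA.
set x1 := (F * _) `^ _ in h4 *; set x2 := (2^-1 ^+ _) `^ _ in h4 *.
set x3 := (a / 2) `^ _ in h4 *; set x4 := (1 - rho) `^ q.
have -> : x1 * (x4 * x3 * x2) = x4 * (x1 * x2 * x3) by ring.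
by rewrite ler_wpM2l ?powR_ge0 // ler_wpM2l ?powR_ge0.
Qed.

End Interpolation.

(** * The strong bound for powers of one complete graph *)

Section StrongType.
Variable R : realType.

(* Unlike [spherical_maximal], this includes the radius 0. *)
Definition maximal (A : finZmodType) (I : finType) (pi : I -> A -> A) (D : {set I})
    (f : A -> R) (x : A) : R :=
  \big[Num.max/0]_(s < #|D|.+1) sph pi D s f x.

Section Maximal.
Variables (A : finZmodType) (I : finType) (pi : I -> A -> A) (D : {set I}).
Implicit Types f : A -> R.

Lemma maximal_ge0 f x : 0 <= maximal pi D f x.
Proof. exact: bigmax_ge_id. Qed.

Lemma sph_le_maximal f x s : (s <= #|D|)%N -> sph pi D s f x <= maximal pi D f x.
Proof.
rewrite -ltnS => sD.
exact: (le_bigmax 0 (fun s : 'I_#|D|.+1 => sph pi D s f x) (Ordinal sD)).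
Qed.

Lemma maximal_le f x a : 0 <= a ->
  (forall s, (s <= #|D|)%N -> sph pi D s f x <= a) -> maximal pi D f x <= a.
Proof. by move=> a0 sa; apply: bigmax_le => // s _; apply: sa; rewrite -ltnS. Qed.

End Maximal.

(** Cut f at the heights F * 2 ^ -k, F = max f, apply [restricted_maximal] to every level set and
    recombine by [interp_levels] at each point. C is chosen before the group, D and n. *)
Lemma strong_maximal (p : R) : 1 < p -> exists2 C : R, 0 <= C &
  forall (A : finZmodType) (I : finType) (pi : I -> A -> A), projections pi ->
  forall (D : {set I}) (n : nat), (forall i, i \in D -> #|summand pi [set i]| = n) ->
  (2 < n)%N -> forall f : A -> R, (forall x, 0 <= f x) ->
  \sum_x maximal pi D f x `^ p <= C * \sum_x f x `^ p.
Proof.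
move=> p1; have p0 : 0 < p by apply: lt_trans p1.
have [K K0 Kp] : exists2 K : nat, (0 < K)%N & (1 + K%:R^-1) * (1 + K%:R^-1) < p.
  (* With k = 1 / K <= 1, (1 + k) ^ 2 <= 1 + 3 k < p. *)
  pose K := (Num.bound (3 / (p - 1))).+1; exists K => //.
  have pp : 0 < p - 1 by rewrite subr_gt0.
  have h : 3 / (p - 1) < K%:R.
    apply: (@lt_le_trans _ _ (Num.bound (3 / (p - 1)))%:R); last by rewrite ler_nat.
    by rewrite archi_boundP // divr_ge0 // ltW.
  rewrite ltr_pdivrMr // in h.
  have K1 : 1 <= K%:R :> R by rewrite ler1n.
  have k0 : 0 < K%:R :> R by lra.
  set k := K%:R^-1; have kK : k * K%:R = 1 by rewrite mulVf // gt_eqF.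
  have k1 : 0 < k by rewrite invr_gt0.
  have k2 : k <= 1 by rewrite invf_le1.
  have h3 : 3 * k < p - 1.
    have : k * 3 < k * (K%:R * (p - 1)) by rewrite ltr_pM2l.
    by rewrite [X in _ < X]mulrA kK mul1r mulrC.
  nra.
set p0' := 1 + K%:R^-1 in Kp; set q := p0' * p0' in Kp.
have p01 : 1 < p0' by rewrite ltrDl invr_gt0 ltr0n.
have q1 : 1 < q by rewrite /q; nra.
have q0 : 0 < q by apply: lt_trans q1.
have rc0 : 0 <= restricted_const K p0'.
  rewrite /restricted_const addr_ge0 //.
    rewrite addr_ge0 // mulr_ge0 ?powR_ge0 // /cesaro_const mulr_ge0 ?powR_ge0 //.
    rewrite addr_ge0 ?powR_ge0 // mulr_ge0 ?powR_ge0 // /doob_const.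
    have pp : 0 <= p0' / (p0' - 1) by rewrite divr_ge0 ?subr_ge0 // ltW // (lt_trans _ p01).
    by rewrite mulr_ge0 ?powR_ge0 // mulr_ge0.
  by rewrite /l2_const !mulr_ge0 ?exprn_ge0 ?expR_ge0.
have ic0 : 0 <= interp_const p q.
  rewrite /interp_const divr_ge0 ?powR_ge0 //.
have C0 : 0 <= interp_const p q * restricted_const K p0' * 2 `^ p.
  by rewrite mulr_ge0 ?powR_ge0 // mulr_ge0.
exists (interp_const p q * restricted_const K p0' * 2 `^ p) => //.
move=> A I pi pi_proj D n cD n2 f f0.
pose F := \big[Num.max/0]_x f x.
have fF x : f x <= F by apply: le_bigmax.
have F0 : 0 <= F by apply: bigmax_ge_id.
have [FE|Fn] := eqVneq F 0.
  have fz x : f x = 0 by apply/eqP; rewrite eq_le f0 -FE fF.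
  rewrite big1; last first.
    move=> x _; have -> : maximal pi D f x = 0.
      apply/eqP; rewrite eq_le maximal_ge0 andbT; apply: maximal_le => // s _.
      by rewrite /sph /avg big1 ?mulr0.
    by rewrite powR0 // gt_eqF.
  by rewrite (mulr_ge0 C0) // sumr_ge0 // => x _; rewrite powR_ge0.
have {Fn}Fpos : 0 < F by rewrite lt_neqAle eq_sym Fn.
have h0 : 0 <= 2^-1 :> R by rewrite invr_ge0.
have levx x : exists j : nat, 0 < f x -> F * 2^-1 ^+ j.+1 < f x <= F * 2^-1 ^+ j.
  have [fx|fx] := ltP 0 (f x); last by exists 0%N.
  pose m := Num.bound (F / f x).
  have := @exists_level R 2^-1 (f x / F) m h0.
  rewrite ler_pdivrMr // mul1r fF => /(_ isT)[|j _ /andP[j1 j2]].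
    rewrite exprVn ltr_pdivlMr // mulrC ltr_pdivrMr ?exprn_gt0 // mulrC -ltr_pdivrMr //.
    apply: (@lt_le_trans _ _ m%:R); first by rewrite archi_boundP // divr_ge0.
    by rewrite -natrX ler_nat; apply: leq_trans (leqnSn _) _; rewrite ltnW // ltn_expl.
  exists j => _; rewrite ltr_pdivlMr // in j1; rewrite ler_pdivrMr // in j2.
  by rewrite mulrC j1 mulrC.
have [lev levP] := boolp.choice levx.
pose E k := [set x | (0 < f x) && (lev x == k)].
pose B := (\max_x lev x).+1.
have levB x : (lev x < B)%N by rewrite ltnS leq_bigmax.
have fsum x : f x <= \sum_(k < B) F * 2^-1 ^+ k * indic R (E k) x.
  have [fx|fx] := ltP 0 (f x).
    rewrite (bigD1 (Ordinal (levB x))) //= /indic inE fx eqxx mulr1.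
    have /andP[_ h] := levP x fx; apply: le_trans h _.
    by rewrite lerDl sumr_ge0 // => k _; rewrite !mulr_ge0 ?exprn_ge0.
  apply: le_trans fx _; apply: sumr_ge0 => k _; by rewrite !mulr_ge0 ?exprn_ge0.
have := boolp.choice (fun k => @restricted_maximal R A I pi pi_proj D n cD K p0' (E k) n2 K0 erefl).
move=> [H Hprop].
pose b x k := maximal pi D (indic R (E k)) x.
have b1 x k : 0 <= b x k <= 1.
  rewrite maximal_ge0 /=; apply: maximal_le => // s _; apply: avg_le1 => y.
  by rewrite /indic; case: (y \in E k).
have bH x k : b x k `^ q <= H k x.
  have [H0 Hs _] := Hprop k.
  have h : b x k <= H k x `^ q^-1.
    apply: maximal_le; first exact: powR_ge0.
    move=> s sD; have s0 : 0 <= sph pi D s (indic R (E k)) x.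
      by apply: avg_ge0 => y; rewrite ler0n.
    rewrite -[leLHS](powRr1 s0) -(mulfV (_ : q != 0)) ?gt_eqF // powRrM.
    by apply: powR_le2; rewrite ?powR_ge0 ?Hs // invr_ge0 ltW.
  have /andP[b0 _] := b1 x k.
  apply: le_trans (powR_le2 (ltW q0) b0 h) _.
  by rewrite -powRrM mulVf ?gt_eqF // powRr1.
have Msum x : maximal pi D f x <= \sum_(k < B) F * 2^-1 ^+ k * b x k.
  apply: maximal_le.
    apply: sumr_ge0 => k _; have /andP[h _] := b1 x k.
    by rewrite mulr_ge0 // mulr_ge0 ?exprn_ge0.
  move=> s sD; apply: le_trans (ler_avg _ _ fsum) _.
  rewrite avg_sum; apply: ler_sum => k _.
  have -> : avg (hsphere pi D s) (fun y => F * 2^-1 ^+ k * indic R (E k) y) x =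
      F * 2^-1 ^+ k * sph pi D s (indic R (E k)) x.
    by rewrite /sph /avg -mulr_sumr mulrCA.
  rewrite ler_wpM2l ?mulr_ge0 ?exprn_ge0 //.
  exact: sph_le_maximal.
have Fk k : 0 <= F * 2^-1 ^+ k by rewrite mulr_ge0 ?exprn_ge0.
apply: (@le_trans _ _ (\sum_x interp_const p q * \sum_(k < B) (F * 2^-1 ^+ k) `^ p * H k x)).
  apply: ler_sum => x _.
  apply: le_trans (interp_levels q0 Kp Fpos (maximal_ge0 _ _ _ _) (b1 x) (Msum x)) _.
  rewrite ler_wpM2l //; apply: ler_sum => k _.
  by rewrite ler_wpM2l ?powR_ge0.
move: (restricted_const K p0') rc0 Hprop (interp_const p q) ic0 {C0} => rc rc0 Hprop ic ic0.
rewrite -mulr_sumr -!mulrA ler_wpM2l // exchange_big /=.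
apply: (@le_trans _ _ (\sum_(k < B) (F * 2^-1 ^+ k) `^ p * (rc * #|E k|%:R))).
  apply: ler_sum => k _; rewrite -mulr_sumr ler_wpM2l ?powR_ge0 //.
  by have [] := Hprop k.
rewrite (eq_bigr (fun k : 'I_B => rc * ((F * 2^-1 ^+ k) `^ p * #|E k|%:R))); last first.
  by move=> k _; exact: mulrCA.
rewrite -mulr_sumr ler_wpM2l //.
(* On level k, F * 2 ^ -k is at most 2 f; the level sets are disjoint. *)
apply: (@le_trans _ _ (\sum_(k < B) \sum_x (if x \in E k then (2 * f x) `^ p else 0))).
  apply: ler_sum => k _; rewrite mulrC -sumr_constM big_mkcond /=.
  apply: ler_sum => x _; case: ifPn => //; rewrite inE => /andP[fx /eqP lk].
  apply: powR_le2; rewrite ?(ltW p0) //.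
  by have /andP[h _] := levP x fx; move: h; rewrite lk exprS; lra.
rewrite exchange_big mulr_sumr /=; apply: ler_sum => x _.
rewrite (bigD1 (Ordinal (levB x))) //= big1 ?addr0; last first.
  move=> k kl; rewrite inE; case: ifP => // /andP[_ /eqP e].
  by case/negP: kl; rewrite -val_eqE /= e.
case: ifP => _; first by rewrite powRM.
by rewrite mulr_ge0 ?powR_ge0.
Qed.

End StrongType.

(** * Coordinates on a finite abelian group *)

Section Merge.
Variables (A : finZmodType) (I J : finType) (pi : I -> A -> A) (c : I -> J).
Hypothesis pi_proj : projections pi.

(** A value that [c] does not take gives the zero projection, so the index type can stay the same
    when factors are merged. *)
Definition merge (j : J) (x : A) : A := proj pi [set i | c i == j] x.

Lemma merge_projections : projections merge.
Proof.
split.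
- by move=> j x y; rewrite /merge projD.
- move=> j k x; rewrite /merge; case: eqVneq => [->|jk].
    by rewrite proj_id // supp_proj // subsetIl.
  rewrite (@proj_eq0 _ _ _ pi_proj _ [set i | c i == k]) ?supp_proj ?subsetIl //.
  rewrite -setI_eq0; apply/eqP/setP => i; rewrite !inE.
  by apply/negP => /andP[/eqP cj /eqP ck]; rewrite -cj ck eqxx in jk.
- move=> x; case: (pi_proj) => _ _ pis; rewrite -[RHS]pis /merge /proj.
  rewrite [RHS](partition_big c xpredT) //=; apply: eq_bigr => j _.
  by apply: eq_bigl => i; rewrite inE.
Qed.

Lemma summand_merge j : summand merge [set j] = summand pi [set i | c i == j].
Proof.
apply/setP => h; rewrite !inE; apply/idP/idP => hs.
  rewrite -(proj_id merge_projections hs) /proj big_set1 /merge supp_proj //.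
  exact: subsetIl.
apply/subsetP => k; rewrite !inE; apply: contraR => kj.
rewrite /merge (@proj_eq0 _ _ _ pi_proj _ [set i | c i == j]) //.
rewrite -setI_eq0; apply/eqP/setP => i; rewrite !inE.
by apply/negP => /andP[/eqP ck /eqP cj]; rewrite -ck cj eqxx in kj.
Qed.

Lemma card_summand_prod (K : {set I}) :
  #|summand pi K| = (\prod_(i in K) #|summand pi [set i]|)%N.
Proof.
elim/(@finset_ind I): K => [|K i iK IH].
  rewrite big_set0 (_ : summand pi set0 = [set 0]) ?cards1 //.
  by apply/setP => h; rewrite !inE subset0 supp_eq0.
have diK : [disjoint [set i] & K] by rewrite disjoints1.
rewrite big_setU1 //= -IH -[LHS]sum1_card (sum_summand pi_proj) //.
by under eq_bigr do rewrite sum1_card; rewrite sum_nat_const.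
Qed.

End Merge.

(** * Cyclic factors and their pairing *)

Section Structure.
Variable A : finZmodType.

(** The coordinates are selected by choice; uniqueness of the decomposition makes them additive and
    idempotent. *)
Lemma bigdprod_projections (k : nat) (F : 'I_k -> {group A}) :
  \big[dprod/1%g]_(i < k) F i = [set: A] ->
  exists2 pi : 'I_k -> A -> A, projections pi & forall i, summand pi [set i] = F i.
Proof.
move=> defA.
have ex (x : A) : exists c : 'I_k -> A, [/\ forall i, c i \in F i, x = \sum_i c i &
    forall e, (forall i, e i \in F i) -> x = \sum_i e i -> forall i, e i = c i].
  have [c [cF xc cU]] := mem_bigdprod defA (in_setT x).
  exists c; split => //; first by move=> i; apply: cF.
  by move=> e eF xe i; exact: (cU e (fun i _ => eF i) xe i isT).
have [pi piP] := boolp.choice ex.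
have piF x i : pi x i \in F i by have [] := piP x.
have pis x : x = \sum_i pi x i by have [] := piP x.
have piU x e : (forall i, e i \in F i) -> x = \sum_i e i -> forall i, e i = pi x i.
  by have [_ _ h] := piP x; exact: h.
have pi1 i x j : x \in F i -> pi x j = if j == i then x else 0.
  move=> xF; apply/esym; move: j; apply: piU.
    by move=> j; case: eqP => [->//|_]; exact: (group1 (F j)).
  by rewrite (bigD1 i) //= eqxx big1 ?addr0 // => j /negPf ->.
have prj : projections (fun i x => pi x i).
  split.
  - move=> i x y; apply/esym; move: i; apply: piU.
      by move=> i; apply: (groupM (piF x i) (piF y i)).
    by rewrite big_split /= -!pis.
  - by move=> i j x; rewrite (pi1 j).
  - by move=> x; rewrite -pis.
exists (fun i x => pi x i) => // i; apply/setP => x; rewrite inE.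
apply/idP/idP => [xs|xF].
  by rewrite -(proj_id prj xs) /proj big_set1.
apply/subsetP => j; rewrite !inE (pi1 i) //; case: (j == i) => //.
by rewrite eqxx.
Qed.

(** In the invariant factor decomposition the number of factors is the minimal number of generators;
    the bound on |S| relies on this. *)
Lemma cyclic_projections : exists k : nat, exists2 pi : 'I_k -> A -> A,
  projections pi & k = 'm([set: A])%g /\
  forall i, exists2 x : A, #|summand pi [set i]| = #[x]%g & (1 < #[x]%g)%N.
Proof.
have abA : abelian [set: A] by apply: FinRing.zmod_abelian.
have [b defA ordb] := abelian_structure abA.
have sb : size b = 'm([set: A])%g.
  by rewrite (grank_abelian abA) -(size_abelian_type abA) -ordb size_map.
exists (size b).
have [|pi pi_proj piE] := @bigdprod_projections (size b) (fun i => <[tnth (in_tuple b) i]>%G).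
  by rewrite -defA [RHS]big_tnth.
exists pi => //; split=> // i; exists (tnth (in_tuple b) i); first by rewrite piE.
have /allP h := abelian_type_gt1 [set: A]%G.
by apply: (h #[_]%g); rewrite -ordb map_f // mem_tnth.
Qed.

Lemma prod_nat_const_in (T : finType) (B : {set T}) (F : T -> nat) (v : nat) :
  (forall i, i \in B -> F i = v) -> (\prod_(i in B) F i = v ^ #|B|)%N.
Proof. by move=> Fv; rewrite (eq_bigr _ Fv) prod_nat_const. Qed.

(* A power of [K_2] is bipartite, which would give an eigenvalue -1; merging the
   factors of order 2 in pairs makes them copies of [K_4]. *)
Lemma block_projections (d : nat) : (forall x : A, (#[x]%g <= d)%N) ->
  exists k : nat, exists2 pi : 'I_k -> A -> A, projections pi &
  [/\ forall i, (0 < #|summand pi [set i]| <= d.+2)%N,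
      (#|[set i | #|summand pi [set i]| == 2%N]| <= 1)%N &
      (\sum_i (#|summand pi [set i]|).-1 <= d * 'm([set: A])%g)%N].
Proof.
move=> expA; have [k [pi pi_proj [<- cyc]]] := cyclic_projections.
exists k; pose n i := #|summand pi [set i]|.
have nd i : (1 < n i <= d)%N.
  by rewrite /n; have [x -> x1] := cyc i; rewrite x1 expA.
pose T2 := [set i | n i == 2%N]; pose s := enum T2.
(* Pairs factors of order 2 by rounding their position in [s] down to an even number. An odd
   position keeps an empty fibre, hence a trivial summand. *)
pose c i := if i \in T2 then nth i s (index i s)./2.*2 else i.
have us : uniq s by apply: enum_uniq.
have ms i : (i \in s) = (i \in T2) by rewrite mem_enum.
have half2 m : (m./2.*2 <= m)%N by rewrite -[leqRHS]odd_double_half leq_addl.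
have idx i : i \in T2 -> ((index i s)./2.*2 < size s)%N.
  by rewrite -ms -index_mem => h; apply: leq_ltn_trans (half2 _) h.
have cT2 i : i \in T2 -> c i \in T2.
  by move=> iT; rewrite /c iT -ms mem_nth // idx.
have idxc i : i \in T2 -> index (c i) s = (index i s)./2.*2.
  by move=> iT; rewrite /c iT index_uniq // idx.
pose fib j := [set i | c i == j].
have fibN j : j \notin T2 -> fib j = [set j].
  move=> jT; apply/setP => i; rewrite !inE /c; case: ifP => // iT.
  have := cT2 i iT; rewrite /c iT => h.
  by apply/eqP/eqP => [e|e]; [rewrite e (negPf jT) in h|rewrite e (negPf jT) in iT].
have fibT j : j \in T2 -> fib j \subset T2.
  move=> jT; apply/subsetP => i; rewrite inE => /eqP ci; apply: contraLR jT => iT.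
  by rewrite -ci /c (negPf iT).
have fib2 j : j \in T2 -> (#|fib j| <= 2)%N.
  move=> jT; apply: (@leq_trans #|[set j; nth j s (index j s).+1]|); last first.
    by rewrite cards2; case: (_ != _).
  apply: subset_leq_card; apply/subsetP => i ifib.
  have iT := subsetP (fibT j jT) i ifib; move: ifib; rewrite !inE => /eqP ci.
  have e : index j s = (index i s)./2.*2 by rewrite -ci idxc.
  have := odd_double_half (index i s); rewrite -e; case: (odd _) => /= h.
    by rewrite -add1n h nth_index ?ms // eqxx orbT.
  by rewrite -(nth_index j (_ : i \in s)) ?ms // -h add0n nth_index ?ms // eqxx.
have mE j : #|summand (merge pi c) [set j]| = (\prod_(i in fib j) n i)%N.
  by rewrite summand_merge // card_summand_prod.
have mN j : j \notin T2 -> #|summand (merge pi c) [set j]| = n j.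
  by move=> jT; rewrite mE fibN // big_set1.
have mT j : j \in T2 -> #|summand (merge pi c) [set j]| = (2 ^ #|fib j|)%N.
  move=> jT; rewrite mE; apply: prod_nat_const_in => i ifib.
  by have := subsetP (fibT j jT) i ifib; rewrite inE => /eqP.
exists (merge pi c); first exact: merge_projections.
split.
- move=> j; have [jT|jT] := boolP (j \in T2); last first.
    by rewrite mN //; have /andP[h1 h2] := nd j; lia.
  have d2 : (2 <= d)%N by have := nd j; move: jT; rewrite inE => /eqP ->.
  rewrite mT // expn_gt0 /=; have := fib2 j jT.
  by case: #|fib j| => [|[|[|]]] //= _; lia.
- apply/card_le1_eqP.
  (* A summand of order 2 after merging is an unpaired factor, which must be the last one in [s]. *)
  have key j : j \in [set i | #|summand (merge pi c) [set i]| == 2%N] ->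
      j \in T2 /\ (index j s).+1 = size s.
    rewrite inE => /eqP j2; have jT : j \in T2.
      by apply: contraT => jT; rewrite mN // in j2; rewrite inE j2 eqxx in jT.
    split=> //; move: j2; rewrite mT // => j2.
    have f1 : #|fib j| = 1%N by move: j2; case: #|fib j| => [|[|m]] //; rewrite !expnS; nia.
    have [i ifib] : exists i, i \in fib j by apply/card_gt0P; rewrite f1.
    have iT := subsetP (fibT j jT) i ifib.
    have ji : index j s = (index i s)./2.*2.
      by move: ifib; rewrite inE => /eqP <-; rewrite idxc.
    have js : (index j s < size s)%N by rewrite index_mem ms.
    apply/eqP; rewrite eqn_leq js /= leqNgt; apply/negP => js1.
    pose j' := nth j s (index j s).+1.
    have j'T : j' \in T2 by rewrite -ms mem_nth.
    have jfib : j \in fib j.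
      by rewrite inE /c jT ji doubleK -ji nth_index ?ms.
    have j'fib : j' \in fib j.
      have ij' : index j' s = (index j s).+1 by rewrite index_uniq.
      have h : (index j' s)./2.*2 = index j s.
        by rewrite ij' ji -add1n halfD odd_double andbF /= !add0n doubleK.
      by rewrite inE /c j'T h (set_nth_default j) // nth_index ?ms.
    have jj' : j != j'.
      apply/eqP => /(congr1 (index^~ s)); rewrite /j' index_uniq //; lia.
    have : (#|[set j; j']| <= #|fib j|)%N.
      by apply: subset_leq_card; rewrite subUset !sub1set jfib.
    by rewrite cards2 jj' f1.
  move=> j j' /key[jT je] /key[j'T j'e].
  by rewrite -(nth_index j (_ : j \in s)) ?ms // -(nth_index j (_ : j' \in s)) ?ms //;
    congr nth; lia.
have -> : (d * k = \sum_j d * #|fib j|)%N.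
  rewrite -big_distrr /=; congr muln.
  rewrite -[LHS]card_ord -sum1_card (partition_big c xpredT) //=.
  by apply: eq_bigr => j _; rewrite -sum1_card; apply: eq_bigl => i; rewrite inE.
(* Fibres of 0, 1, 2 factors of order 2 contribute 0, 1, 3 generators, against 0, d, 2 d with d >=
   2. *)
apply: leq_sum => j _; have [jT|jT] := boolP (j \in T2); last first.
  by rewrite mN // fibN // cards1; have := nd j; lia.
have d2 : (2 <= d)%N by have := nd j; move: jT; rewrite inE => /eqP ->.
rewrite mT //; have := fib2 j jT.
by case: #|fib j| => [|[|[|]]] //= _; lia.
Qed.

End Structure.

(** * The Cayley graph *)

Section CayleyGraph.
Variables (A : finZmodType) (I : finType) (pi : I -> A -> A).
Hypothesis pi_proj : projections pi.

(** The nonzero elements of the single summands: the Cayley graph becomes the Hamming graph of the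
    decomposition. *)
Definition axes : {set A} := [set x | #|supp pi x| == 1%N].

Lemma supp_pi i x : supp pi (pi i x) \subset [set i].
Proof.
apply/subsetP => j; rewrite !inE; case: (pi_proj) => _ pij _.
by rewrite pij; case: (j == i); rewrite ?eqxx.
Qed.

Lemma gen_axes : <<axes>>%g = [set: A].
Proof.
apply/eqP; rewrite eqEsubset subsetT; apply/subsetP => x _.
case: (pi_proj) => _ _ pis; rewrite -(pis x).
elim/big_ind: _ => [|y z yS zS|i _]; [exact: group1|exact: groupM|].
have [->|pin] := eqVneq (pi i x) 0; first exact: group1.
apply: mem_gen; rewrite inE; have := supp_pi i x; rewrite subset1.
by case/orP => /eqP e; [rewrite e cards1|rewrite -(supp_eq0 pi_proj) e eqxx in pin].
Qed.

Lemma card_axes : (#|axes| <= \sum_i (#|summand pi [set i]|).-1)%N.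
Proof.
apply: (@leq_trans (\sum_i #|summand pi [set i] :\ 0%R|)); last first.
  apply: leq_sum => i _; rewrite [X in (_ <= X.-1)%N](cardsD1 0).
  by rewrite inE supp0 // sub0set.
have -> : (\sum_i #|summand pi [set i] :\ 0%R| =
    \sum_(x : A) \sum_(i : I) (x \in summand pi [set i] :\ 0%R))%N.
  rewrite exchange_big /=; apply: eq_bigr => i _.
  by rewrite -sum1_card big_mkcond; apply: eq_bigr => x _; case: (_ \in _).
rewrite -sum1_card big_mkcond; apply: leq_sum => x _; rewrite inE.
case: ifP => // /cards1P[i sx]; rewrite (bigD1 i) //= !inE sx subxx andbT.
by rewrite -(supp_eq0 pi_proj) sx -cards_eq0 cards1.
Qed.

Lemma cayleyE x y : cayley axes x y = (#|supp pi (y - x)| == 1%N).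
Proof.
apply/existsP/idP => [[s /andP[]]|h].
  rewrite inE => s1 /orP[]/eqP ->; first by rewrite addrC addKr.
  by rewrite opprD addrA subrr sub0r suppN.
by exists (y - x); rewrite inE h addrC subrK eqxx.
Qed.

(** An edge changes a single coordinate, so a walk is at least as long as the Hamming distance of
    its ends. *)
Lemma path_supp x p : path (cayley axes) x p ->
  (#|supp pi (last x p - x)%R| <= size p)%N.
Proof.
elim: p x => [|y p IH] x /=; first by rewrite subrr supp0 // cards0.
rewrite cayleyE => /andP[/eqP xy /IH yp].
have -> : last y p - x = (last y p - y) + (y - x) by rewrite addrA subrK.
apply: leq_trans (subset_leq_card (suppD pi_proj _ _)) _.
rewrite -addn1 -xy; apply: leq_trans (leq_add yp (leqnn _)).
by rewrite cardsU leq_subr.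
Qed.

Lemma geodesic x y : exists p, [/\ size p = #|supp pi (y - x)|,
  path (cayley axes) x p & last x p = y].
Proof.
move e : #|supp pi (y - x)| => m; elim: m x e => [|m IH] x e.
  exists [::]; split => //=; apply/esym/eqP; rewrite -subr_eq0 -(supp_eq0 pi_proj).
  by rewrite -cards_eq0 e.
have [i ixy] : exists i, i \in supp pi (y - x) by apply/card_gt0P; rewrite e.
pose x' := x + pi i (y - x).
have s1 : supp pi (pi i (y - x)) = [set i].
  have := supp_pi i (y - x); rewrite subset1 => /orP[/eqP //|].
  by move: ixy; rewrite inE => h; rewrite (supp_eq0 pi_proj) (negPf h).
have sm : supp pi (y - x') = supp pi (y - x) :\ i.
  rewrite /x' opprD addrA; move: (y - x) => z; apply/setP => j.
  rewrite !inE (piD pi_proj) (piN pi_proj); case: (pi_proj) => _ pij _; rewrite pij.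
  by case: (eqVneq j i) => [->|_] /=; rewrite ?subrr ?eqxx // subr0.
have [|p [sp pp lp]] := IH x'.
  by rewrite sm; move: e; rewrite (cardsD1 i) ixy add1n => -[].
exists (x' :: p); split => //=; first by rewrite sp.
by rewrite pp andbT cayleyE /x' addrC addKr s1 cards1.
Qed.

Lemma dist_axes x y : dist (cayley axes) x y = Some #|supp pi (y - x)|.
Proof.
have [p [sp pp lp]] := geodesic x y.
have w : walk (cayley axes) x y #|supp pi (y - x)|.
  by apply/existsP; exists (tcast sp (in_tuple p)); rewrite val_tcast pp lp eqxx.
rewrite /dist; case: pselect => [h|[]]; last by exists #|supp pi (y - x)|.
congr Some; case: ex_minnP => m /existsP[q /andP[qp /eqP lq]] mmin.
apply/eqP; rewrite eqn_leq mmin //=.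
by have := path_supp qp; rewrite lq size_tuple.
Qed.

Lemma sphere_axes x r : sphere (cayley axes) x r = [set y | #|supp pi (y - x)| == r].
Proof. by apply/setP => y; rewrite !inE dist_axes. Qed.

Lemma sum_sphere_axes (V : nmodType) (f : A -> V) x r :
  \sum_(y in sphere (cayley axes) x r) f y = \sum_(h in hsphere pi setT r) f (x + h).
Proof.
rewrite (reindex_inj (addrI x)) /=; apply: eq_bigl => h.
by rewrite sphere_axes !inE subsetT addrC addKr.
Qed.

Lemma card_sphere_axes x r : #|sphere (cayley axes) x r| = #|hsphere pi setT r|.
Proof. by rewrite -!sum1_card sum_sphere_axes. Qed.

End CayleyGraph.

(** * Composing the maximal operators of the classes *)

Section Iteration.
Variables (R : realType) (A : finZmodType) (I : finType) (pi : I -> A -> A).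
Hypothesis pi_proj : projections pi.
Implicit Types (f g : A -> R) (D K : {set I}).

Lemma sum_hsphere_split (V : nmodType) D K r (G : A -> V) : [disjoint D & K] ->
  \sum_(h in hsphere pi (D :|: K) r) G h =
  \sum_(s < r.+1) \sum_(a in hsphere pi D s) \sum_(b in hsphere pi K (r - s)%N) G (a + b).
Proof.
move=> dDK.
transitivity (\sum_(h in summand pi (D :|: K)) if #|supp pi h| == r then G h else 0).
  by rewrite -big_mkcondr; apply: eq_bigl => h; rewrite !inE.
rewrite sum_summand //.
have -> : \sum_(s < r.+1) \sum_(a in hsphere pi D s) \sum_(b in hsphere pi K (r - s)%N) G (a + b) =
   \sum_(a in summand pi D) \sum_(s < r.+1) if #|supp pi a| == s then
      \sum_(b in hsphere pi K (r - s)%N) G (a + b) else 0.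
  rewrite exchange_big /=; apply: eq_bigr => s _.
  by rewrite -big_mkcondr; apply: eq_bigl => a; rewrite !inE.
apply: eq_bigr => a; rewrite inE => aD.
have sab b : b \in summand pi K -> #|supp pi (a + b)| = (#|supp pi a| + #|supp pi b|)%N.
  rewrite inE => bK; rewrite (supp_direct pi_proj dDK) // cardsU.
  rewrite (_ : _ :&: _ = set0) ?cards0 ?subn0 //.
  apply/eqP; rewrite -subset0 -(disjoint_setI0 dDK); exact: setISS.
have [ar|ar] := ltnP #|supp pi a| r.+1.
  rewrite (bigD1 (Ordinal ar)) //= eqxx [X in _ = _ + X]big1 ?addr0; last first.
    by move=> s; rewrite eq_sym -val_eqE /= => /negPf ->.
  rewrite -big_mkcondr; apply: eq_bigl => b; rewrite [in RHS]inE.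
  apply: andb_id2l => bK; rewrite sab //; apply/eqP/eqP => [<-|->].
    by rewrite addKn.
  by rewrite subnKC.
rewrite [RHS]big1 => [|s _]; last first.
  by case: eqP => // e; have := ltn_ord s; rewrite -e ltnNge ar.
rewrite big1 // => b bK; rewrite sab //; case: eqP => // e.
by move: ar; rewrite -e -ltn_subRL subnn.
Qed.

Fixpoint itermax (E : nat -> {set I}) f k : A -> R :=
  if k is k'.+1 then maximal pi (E k') (itermax E f k') else f.

Lemma itermax_ge0 (E : nat -> {set I}) f k x : (forall y, 0 <= f y) -> 0 <= itermax E f k x.
Proof. by case: k => [|k] f0 //=; exact: maximal_ge0. Qed.

(** A sphere on the union of two sets of coordinates is a union of products of spheres. The inner
    factor is bounded by induction, the outer one by one more maximal operator. Sums weighted by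
    cardinality avoid dividing by the size of an empty sphere. *)
Lemma sum_hsphere_itermax (col : I -> nat) f k r x : (forall y, 0 <= f y) ->
  \sum_(h in hsphere pi [set i | (col i < k)%N] r) f (x + h) <=
  #|hsphere pi [set i | (col i < k)%N] r|%:R *
    itermax (fun l => [set i | col i == l]) f k x.
Proof.
move=> f0; set D : nat -> {set I} := fun l => _; elim: k r x => [|k IH] r x /=.
  rewrite -sumr_constM; apply: ler_sum => h; rewrite !inE => /andP[h0 _].
  have : supp pi h \subset set0 by apply: subset_trans h0 _; apply/subsetP => i; rewrite !inE.
  by rewrite subset0 supp_eq0 // => /eqP ->; rewrite addr0.
set K := [set i | (col i < k)%N].
have -> : [set i | (col i < k.+1)%N] = D k :|: K.
  by apply/setP => i; rewrite !inE ltnS leq_eqVlt.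
have dDK : [disjoint D k & K].
  by rewrite -setI_eq0; apply/eqP/setP => i; rewrite !inE; case: eqP => // ->; rewrite ltnn.
have -> : #|hsphere pi (D k :|: K) r|%:R =
    \sum_(s < r.+1) #|hsphere pi (D k) s|%:R * #|hsphere pi K (r - s)%N|%:R :> R.
  rewrite -[in LHS]sum1_card natr_sum sum_hsphere_split //.
  by apply: eq_bigr => s _; rewrite -sumr_constM; apply: eq_bigr => a _; rewrite sumr_constM mulr1.
rewrite sum_hsphere_split // mulr_suml; apply: ler_sum => s _.
apply: (@le_trans _ _ (\sum_(a in hsphere pi (D k) s)
    #|hsphere pi K (r - s)%N|%:R * itermax D f k (x + a))).
  apply: ler_sum => a _; apply: le_trans (IH _ _).
  by apply: ler_sum => b _; rewrite addrA.
rewrite -mulr_sumr [X in _ <= X * _]mulrC -mulrA ler_wpM2l ?ler0n //.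
have [/eqP e|Dn] := boolP (#|hsphere pi (D k) s| == 0)%N.
  by rewrite e mul0r (cards0_eq e) big_set0.
have sD : (s <= #|D k|)%N.
  move: Dn; rewrite -lt0n => /card_gt0P[h]; rewrite !inE => /andP[hD /eqP <-].
  exact: subset_leq_card.
have := sph_le_maximal pi (itermax D f k) x sD.
by rewrite /sph /avg mulrC ler_pdivrMr ?ltr0n ?lt0n // mulrC.
Qed.

(** Only radii 0 and 1 occur, and both means contract l^p; this handles a lone factor of order 2 and
    trivial classes. *)
Lemma thin_maximal p D f : 1 < p -> (forall y, 0 <= f y) ->
  (forall h, h \in summand pi D -> (#|supp pi h| <= 1)%N) ->
  \sum_x maximal pi D f x `^ p <= 2 `^ p * 2 * \sum_x f x `^ p.
Proof.
move=> p1 f0 thin; have p0 : 0 <= p by apply: ltW; apply: lt_trans p1.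
have s0 s x : 0 <= sph pi D s f x by apply: avg_ge0.
apply: (@le_trans _ _ (\sum_x 2 `^ p * (sph pi D 0 f x `^ p + sph pi D 1 f x `^ p))).
  apply: ler_sum => x _; apply: le_trans (powRD_le p0 (s0 0%N x) (s0 1%N x)).
  apply: powR_le2; [exact: p0|exact: maximal_ge0|].
  apply: maximal_le; first exact: addr_ge0.
  move=> [|[|s]] _; [by rewrite lerDl|by rewrite lerDr|].
  have -> : sph pi D s.+2 f x = 0; last exact: addr_ge0.
  rewrite /sph /avg big_pred0 ?mulr0 // => h; rewrite inE.
  by apply/negP => /andP[/thin h1 /eqP hs]; rewrite hs in h1.
rewrite -mulr_sumr -mulrA ler_wpM2l ?powR_ge0 // big_split /= mulr_natl mulr2n.
by apply: lerD; apply: sum_avg_powR.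
Qed.

End Iteration.

(** * Uniform bounds and the passage to complex functions *)

Section Final.
Variable R : realType.

Lemma class_maximal (p : R) : 1 < p -> exists2 C : R, 0 <= C &
  forall (A : finZmodType) (I : finType) (pi : I -> A -> A), projections pi ->
  forall (D : {set I}) (n : nat), (forall i, i \in D -> #|summand pi [set i]| = n) ->
  (2 < n)%N \/ (forall h, h \in summand pi D -> (#|supp pi h| <= 1)%N) ->
  forall f : A -> R, (forall x, 0 <= f x) ->
  \sum_x maximal pi D f x `^ p <= C * \sum_x f x `^ p.
Proof.
move=> p1; have [C C0 strong] := strong_maximal p1.
have D0 : 0 <= 2 `^ p * 2 :> R by rewrite mulr_ge0 ?powR_ge0.
exists (C + 2 `^ p * 2); first exact: addr_ge0.
move=> A I pi pi_proj D n cD hD f f0.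
have S0 : 0 <= \sum_x f x `^ p by apply: sumr_ge0 => x _; apply: powR_ge0.
rewrite mulrDl; case: hD => [n2|thin].
  by apply: le_trans (strong A I pi pi_proj D n cD n2 f f0) _; rewrite lerDl mulr_ge0.
by apply: le_trans (thin_maximal p1 f0 thin) _; rewrite lerDr mulr_ge0.
Qed.

Lemma normc_mean (T : finType) (B : {set T}) (F : T -> R[i]) :
  ComplexField.Normc.normc (#|B|%:R^-1 * \sum_(h in B) F h) <=
  #|B|%:R^-1 * \sum_(h in B) ComplexField.Normc.normc (F h).
Proof.
rewrite ComplexField.Normc.normcM ComplexField.Normc.normcV.
have -> : ComplexField.Normc.normc (#|B|%:R : R[i]) = #|B|%:R.
  rewrite -(rmorph_nat (real_complex R)) /= expr0n addr0 sqrtr_sqr ger0_norm //.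
rewrite ler_wpM2l ?invr_ge0 //.
elim/big_ind2: _ => [|a1 a2 b1 b2 h1 h2|//]; first by rewrite ComplexField.Normc.normc0.
by apply: le_trans (le_normcD _ _) _; exact: lerD.
Qed.

Lemma normc_ge0 (z : R[i]) : 0 <= ComplexField.Normc.normc z.
Proof. by case: z => a b; exact: sqrtr_ge0. Qed.

Lemma normc_real (a : R) : ComplexField.Normc.normc (a%:C) = `|a|.
Proof. by rewrite /= expr0n addr0 sqrtr_sqr. Qed.

Section Fixed.
Variables (A : finZmodType) (I : finType) (pi : I -> A -> A).
Hypothesis pi_proj : projections pi.

Let col i := #|summand pi [set i]|.
Let classes l := [set i | col i == l].

(** Spheres of the Cayley graph are translated Hamming spheres, so [sum_hsphere_itermax] bounds each
    average of |f|. The lower bound covers the empty supremum and lets the modulus of the maximal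
    function be dropped. *)
Lemma spherical_maximal_le (m : nat) (f : A -> R[i]) x : (forall i, (col i < m)%N) ->
  0 <= spherical_maximal (axes pi) f x <=
    itermax pi classes (fun y => ComplexField.Normc.normc (f y)) m x.
Proof.
move=> colm; set g := fun y => _.
have g0 y : 0 <= g y by apply: normc_ge0.
have avg_le r : sphere (cayley (axes pi)) x r != finset.set0 ->
  ComplexField.Normc.normc (spherical_average (axes pi) f x r) <= itermax pi classes g m x.
  move=> sne; rewrite /spherical_average; apply: le_trans (normc_mean _ _) _.
  rewrite sum_sphere_axes // card_sphere_axes //.
  have := sum_hsphere_itermax pi_proj col m r x g0.
  have -> : [set i | (col i < m)%N] = setT by apply/setP => i; rewrite !inE colm.
  move=> h; have B0 : (0 < #|hsphere pi setT r|)%N.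
    by rewrite -(card_sphere_axes pi_proj x) card_gt0.
  by rewrite mulrC ler_pdivrMr ?ltr0n // mulrC.
rewrite /spherical_maximal; set E := (X in sup X).
have [E0|[a Ea]] : E = classical_sets.set0 \/ exists a, E a.
  have [h|h] := pselect (exists a, E a); [by right|left].
  by rewrite -classical_sets.subset0 => a Ea; apply: h; exists a.
  by rewrite E0 sup0 lexx itermax_ge0.
have ubE : classical_sets.ubound E (itermax pi classes g m x).
  by move=> _ [r [r0 rne] <-]; exact: avg_le.
apply/andP; split; last by apply: ge_sup => //; exists a.
apply: (@le_trans _ _ a); last by apply: ub_le_sup => //; exists (itermax pi classes g m x).
by case: Ea => r _ <-; exact: normc_ge0.
Qed.

Lemma itermax_bound (p C : R) (m : nat) (f : A -> R) : 0 <= C -> (forall x, 0 <= f x) ->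
  (forall l (g : A -> R), (forall x, 0 <= g x) ->
     \sum_x maximal pi (classes l) g x `^ p <= C * \sum_x g x `^ p) ->
  \sum_x itermax pi classes f m x `^ p <= C ^+ m * \sum_x f x `^ p.
Proof.
move=> C0 f0 H; elim: m => [|m IH] /=; first by rewrite expr0 mul1r.
apply: le_trans (H m _ _) _; first by move=> x; exact: itermax_ge0.
by rewrite exprS -mulrA ler_wpM2l.
Qed.

End Fixed.
End Final.

Theorem corollary1p8 (R : realType) (d : nat) (d_gt0 : (0 < d)%N) :
  exists C : R -> R,
    forall A : finZmodType, (forall x : A, (#[x]%g <= d)%N) ->
    exists S : {set A},
      [/\ <<S>>%g = [set: A],
          (#|S| <= d * 'm([set: A])%g)%N &
          forall (p : R) (f : A -> R[i]), 1 < p ->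
            lpnorm p (fun x => (spherical_maximal S f x)%:C)
              <= C p * lpnorm p f].
Proof.
have exC (p : R) : exists C : R, 1 < p -> 0 <= C /\
    forall (A : finZmodType) (I : finType) (pi : I -> A -> A), projections pi ->
    forall (D : {set I}) (n : nat), (forall i, i \in D -> #|summand pi [set i]| = n) ->
    (2 < n)%N \/ (forall h, h \in summand pi D -> (#|supp pi h| <= 1)%N) ->
    forall f : A -> R, (forall x, 0 <= f x) ->
    \sum_x maximal pi D f x `^ p <= C * \sum_x f x `^ p.
  have [p1|p1] := ltP 1 p; last by exists 0.
  by have [C C0 h] := class_maximal p1; exists C.
have [C CP] := boolp.choice exC.
(* Summands have order at most d + 2, so orders below d + 3 give d + 3 classes, each costing a
   factor [C p]. *)
exists (fun p => (C p ^+ d.+3) `^ p^-1) => A expA.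
have [k [pi pi_proj [card_pi one2 sum_pi]]] := block_projections expA.
exists (axes pi); split.
- exact: gen_axes.
- exact: leq_trans (card_axes pi_proj) sum_pi.
move=> p f p1; have [C0 Cmax] := CP p p1.
have p0 : 0 < p by apply: lt_trans p1.
have colm i : (#|summand pi [set i]| < d.+3)%N by have /andP[_ h] := card_pi i.
pose g y := ComplexField.Normc.normc (f y).
have g0 y : 0 <= g y by apply: normc_ge0.
have nontriv h i : i \in supp pi h -> (1 < #|summand pi [set i]|)%N.
  rewrite inE => ih; apply: (@leq_trans #|[set 0; pi i h]|).
    by rewrite cards2 eq_sym ih.
  apply: subset_leq_card; rewrite subUset !sub1set !inE supp0 // sub0set.
  exact: supp_pi.
(* Class 2 has at most one factor; classes 0 and 1 contain no nonzero element. *)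
have cls l : (2 < l)%N \/ (forall h, h \in summand pi [set i | #|summand pi [set i]| == l] ->
    (#|supp pi h| <= 1)%N).
  have [l2|l2] := leqP l 1; last first.
    move: l2; rewrite leq_eqVlt => /predU1P[<-|]; [right|by left] => h; rewrite inE.
    by move/subset_leq_card/leq_trans; apply.
  right=> h; rewrite inE => hl; rewrite (_ : supp pi h = finset.set0) ?cards0 //.
  apply/setP => i; rewrite [RHS]inE; apply/negP => ih; have := nontriv h i ih.
  by have := subsetP hl i ih; rewrite inE => /eqP ->; rewrite ltnNge l2.
have bound := @itermax_bound R A _ pi p (C p) d.+3 g C0 g0 _.
rewrite /lpnorm -powRM ?exprn_ge0 ?sumr_ge0 // => [|x _]; last exact: powR_ge0.
apply: powR_le2; rewrite ?invr_ge0 ?(ltW p0) //.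
  by apply: sumr_ge0 => x _; exact: powR_ge0.
apply: le_trans (bound _); last first.
  move=> l h h0; apply: (Cmax A _ pi pi_proj _ l) => // i; by rewrite inE => /eqP.
apply: ler_sum => x _; rewrite normc_real.
have /andP[h1 h2] := spherical_maximal_le pi_proj f x colm.
by apply: powR_le2; rewrite ?ger0_norm // ltW.
Qed.
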